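(* Let $r>0$, $d\in\mathbb{N}$, $H\in(\tfrac12,1)$, and let $(\Omega,\mathcal{F},\mathbb{P},(\theta_t)_{t\in\mathbb{R}})$ be the fractional Brownian motion metric dynamical system described in the context, with $B^H(t,\omega)=\omega(t)$. Let $F,G:\mathcal{C}_r\to\mathbb{R}^d$ satisfy: (i) there exist constants $L_1,L_2>0$ such that for all $\xi,\eta\in\mathcal{C}_r$, $\|F(\xi)-F(\eta)\|\le L_1\|\xi-\eta\|_\infty$ and $\|F(\xi)\|\le L_2(1+\|\xi\|_\infty)$; (ii) $G$ is $C^1$ (Fréchet) and there exist constants $L_3,L_4>0$ such that for all $\xi,\eta\in\mathcal{C}_r$, $\|D^1G(\xi)\|\le L_3$ and $\|D^1G(\xi)-D^1G(\eta)\|\le L_4\|\xi-\eta\|_\infty$. Fix $\alpha\in(1-H,\tfrac12)$ and $T>0$. Then for each $\eta\in C^{0,1-\alpha}([-r,0],\mathbb{R}^d)$ there exists a unique solution $X(t,\omega,\eta)$ of $$X(t)=\eta(0)+\int_0^tF(X_s)\,ds+\int_0^tG(X_s)\,dB^H(s),\quad t\ge0,\qquad X_0=\eta,$$ such that $X(\cdot,\omega,\eta)\in C^{0,1-\alpha}([-r,T],\mathbb{R}^d)$ almost surely. Moreover, the solution generates a continuous random dynamical system $\varphi:\mathbb{R}_+\times\Omega\times C^{0,1-\alpha}([-r,0],\mathbb{R}^d)\to C^{0,1-\alpha}([-r,0],\mathbb{R}^d)$ given by $\varphi(t,\omega,\eta)=X_t(\cdot,\omega,\eta)$ for all $t\g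e0$.
   Context: $\|\cdot\|$ denotes the Euclidean norm on $\mathbb{R}^d$ (and operator norm for linear maps). $\mathcal{C}_r=C([-r,0],\mathbb{R}^d)$ with sup norm $\|\eta\|_\infty=\max_{s\in[-r,0]}\|\eta(s)\|$; $D^1G(\xi)$ is the Fréchet derivative of $G$ at $\xi$. For a function $X$ on $[-r,\infty)$ and $s\ge0$, $X_s\in\mathcal{C}_r$ denotes the segment $X_s(\theta)=X(s+\theta)$, $\theta\in[-r,0]$; $X_0=\eta$ means $X(\theta)=\eta(\theta)$ for $\theta\in[-r,0]$. Hölder spaces: for $\beta\in(0,1]$, $C^\beta([a,b],\mathbb{R}^d)$ is the space of $f:[a,b]\to\mathbb{R}^d$ with norm $\|f\|_\beta:=\sup_t\|f(t)\|+\sup_{a\le s<t\le b}\frac{\|f(t)-f(s)\|}{|t-s|^\beta}<\infty$; for $\delta>0$, $\|f\|_{\beta,\delta,a,b}:=\sup_{a\le s<t\le b,\,|t-s|<\delta}\frac{\|f(t)-f(s)\|}{|t-s|^\beta}$, and $C^{0,\beta}([a,b],\mathbb{R}^d):=\{f\in C^\beta([a,b],\mathbb{R}^d):\lim_{\delta\to0}\|f\|_{\beta,\delta,a,b}=0\}$, a separable Banach space with norm $\|\cdot\|_\beta$. Noise: a fractional Brownian motion with Hurst parameter $H$ is a centered real Gaussian process with continuous paths and covariance $\frac12(|t|^{2H}+|s|^{2H}-|t-s|^{2H})$. $\Omega$ is the set of continuous $\omega:\mathbb{R}\to\mathbb{R}$ with $\omega(0)=0$ that are $\beta$-Hölder on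 every compact interval, for a fixed $\beta\in(0,H)$ (chosen with $\beta>1-H$ so that paths are integrators in the sense below), $\mathcal{F}$ the trace on $\Omega$ of the Borel $\sigma$-algebra of the compact-open topology, $\mathbb{P}$ the law of two-sided fBm, and $\theta_t\omega(\cdot)=\omega(t+\cdot)-\omega(t)$ (the Wiener shift), which is measurable, $\mathbb{P}$-preserving and satisfies $\theta_{t+s}=\theta_t\circ\theta_s$. The stochastic integral is defined pathwise as the generalized Riemann–Stieltjes (Young) integral via fractional calculus: $\int_a^b f\,d\omega=(-1)^{\alpha}\int_a^b D^{\alpha}_{a+}f(s)\,D^{1-\alpha}_{b-}\omega_{b-}(s)\,ds$ with $\omega_{b-}(s)=\omega(s)-\omega(b)$, $D^{\alpha}_{a+}f(s)=\frac{1}{\Gamma(1-\alpha)}\big(\frac{f(s)}{(s-a)^\alpha}+\alpha\int_a^s\frac{f(s)-f(u)}{(s-u)^{1+\alpha}}du\big)$, $D^{1-\alpha}_{b-}g(s)=\frac{(-1)^{1-\alpha}}{\Gamma(\alpha)}\big(\frac{g(s)}{(b-s)^{1-\alpha}}+(1-\alpha)\int_s^b\frac{g(s)-g(u)}{(u-s)^{2-\alpha}}du\big)$; it agrees with the limit of Riemann–Stieltjes sums. Random dynamical system: for a Banach space $X$, a measurable map $\varphi:\mathbb{R}_+\times\Omega\times X\to X$ (w.r.t. $\mathcal{B}(\mathbb{R}_+)\otimes\mathcal{F}\otimes\mathcal{B}(X)$) with $\varphi(0,\omega)=\mathrm{id}_X$ and $\varphi(t+s,\omega,x)=\varphi(t,\theta_s\omega,\varphi(s,\omega,x))$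 for all $t,s\ge0$, $\omega\in\Omega$, $x\in X$. It is continuous if each map $x\mapsto\varphi(t,\omega,x)$ is continuous. *)

(* Defs.v *)
From HB Require Import structures.
From mathcomp Require Import all_boot all_order all_algebra.
From mathcomp Require Import all_classical all_reals all_analysis.
Unset Printing Implicit Defensive.
Import Order.TTheory GRing.Theory Num.Theory.
Import numFieldNormedType.Exports.
Local Open Scope classical_set_scope.
Local Open Scope ring_scope.

Section Defs.
Variable R : realType.

Definition omega_prop (beta : R) (w : R -> R) : Prop :=
  w 0 = 0 /\ continuous w /\
  forall a b : R, exists C : R, forall s t : R,
    a <= s <= b -> a <= t <= b -> `|w t - w s| <= C * (`|t - s| `^ beta).

Record Omega (beta : R) := MkOmega { oval :> R -> R; oprop : omega_prop beta oval }.
Arguments oval {beta}.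

Lemma omega_prop0 beta : omega_prop beta (fun _ => 0).
Proof.
split; first by []. split; first by move=> x; exact: cvg_cst.
move=> a b; exists 0 => s t _ _; by rewrite subrr normr0 mul0r.
Qed.

Section OmegaInst.
Variable beta : R.
HB.instance Definition _ := gen_eqMixin (Omega beta).
HB.instance Definition _ := gen_choiceMixin (Omega beta).
HB.instance Definition _ := isPointed.Build (Omega beta) (@MkOmega beta _ (omega_prop0 beta)).
End OmegaInst.

(* generators of F: preimages of Borel sets under evaluations w |-> w(t)
   (the trace on Omega of the Borel sigma-algebra of the compact-open topology) *)
Definition omega_gen (beta : R) : set (set (Omega beta)) :=
  [set A | exists (t : R) (B : set R),
     measurable B /\ A = (fun w : Omega beta => oval w t) @^-1` B].

Definition OmegaM (beta : R) := g_sigma_algebraType (omega_gen beta).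

Lemma omega_prop_shift beta (t : R) (w : Omega beta) :
  omega_prop beta (fun s => oval w (t + s) - oval w t).
Proof.
case: w => w [w0 [wc wh]] /=; split; first by rewrite addr0 subrr.
split.
  move=> x; apply: cvgB; last exact: cvg_cst.
  apply: continuous_comp; last exact: wc.
  by apply: cvgD; [exact: cvg_cst| exact: cvg_id].
move=> a b; have [C HC] := wh (t + a) (t + b); exists C => s u Hs Hu.
rewrite opprB addrA subrK.
have -> : `|u - s| = `|(t + u) - (t + s)| by rewrite opprD addrACA subrr add0r.
apply: HC.
  by move/andP: Hs => [? ?]; apply/andP; split; rewrite lerD2l.
by move/andP: Hu => [? ?]; apply/andP; split; rewrite lerD2l.
Qed.

Definition theta (beta : R) (t : R) (w : OmegaM beta) : OmegaM beta :=
  @MkOmega beta _ (omega_prop_shift beta t w).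

Definition fbm_cov (H s t : R) : R :=
  2^-1 * (`|t| `^ (2 * H) + `|s| `^ (2 * H) - `|t - s| `^ (2 * H)).

(* P is the law of a two-sided fBm with Hurst index H (B^H(t,w) = w(t)):
   every finite linear combination sum_k l_k w(t_k) is a centered Gaussian
   with variance sum_{j,k} l_j l_k cov(t_j,t_k), expressed through its
   characteristic function (real and imaginary parts). *)
Definition is_fbm_law (beta H : R) (P : probability (OmegaM beta) R) : Prop :=
  forall (n : nat) (tt l : 'I_n -> R),
    let Y := fun w : OmegaM beta => \sum_(k < n) l k * oval w (tt k) in
    let Q := \sum_(j < n) \sum_(k < n) l j * l k * fbm_cov H (tt j) (tt k) in
    (\int[P]_w (cos (Y w))%:E = (expR (- (2^-1 * Q)))%:E)%E /\
    (\int[P]_w (sin (Y w))%:E = 0%:E)%E.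

Definition vec (d : nat) := 'rV[R]_d.

Definition enorm {d : nat} (v : vec d) : R := Num.sqrt (\sum_(i < d) (v ord0 i) ^+ 2).

(* C_r : functions continuous on [-r,0] (only their values on [-r,0] matter) *)
Definition in_Cr {d : nat} (r : R) (f : R -> vec d) : Prop :=
  {within `[- r, 0], continuous f}.

Definition supn {d : nat} (r : R) (f : R -> vec d) : R :=
  sup [set enorm (f x) | x in `[- r, 0]].

Definition opnorm {d : nat} (r : R) (L : (R -> vec d) -> vec d) : R :=
  sup [set enorm (L h) | h in [set h | in_Cr r h /\ supn r h <= 1]].

Definition is_frechet_deriv {d : nat} (r : R) (G : (R -> vec d) -> vec d)
    (DG : (R -> vec d) -> (R -> vec d) -> vec d) : Prop :=
  forall xi, in_Cr r xi ->
    (forall h k, in_Cr r h -> in_Cr r k -> DG xi (h \+ k) = DG xi h + DG xi k) /\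
    (forall (c : R) h, in_Cr r h -> DG xi (fun x => c *: h x) = c *: DG xi h) /\
    (exists M : R, forall h, in_Cr r h -> enorm (DG xi h) <= M * supn r h) /\
    (forall e : R, 0 < e -> exists del : R, 0 < del /\ forall h, in_Cr r h ->
       supn r h < del -> enorm (G (xi \+ h) - G xi - DG xi h) <= e * supn r h).

Definition in_C0H {d : nat} (b a c : R) (f : R -> vec d) : Prop :=
  (exists C : R, forall s t, a <= s <= c -> a <= t <= c ->
      enorm (f t - f s) <= C * (`|t - s| `^ b)) /\
  (forall e : R, 0 < e -> exists del : R, 0 < del /\ forall s t,
      a <= s <= c -> a <= t <= c -> `|t - s| < del ->
      enorm (f t - f s) <= e * (`|t - s| `^ b)).

Definition holnorm {d : nat} (b a c : R) (f : R -> vec d) : R :=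
  sup [set enorm (f x) | x in `[a, c]] +
  sup [set z | exists s t : R, a <= s /\ s < t /\ t <= c /\
                    z = enorm (f t - f s) / ((t - s) `^ b)].

(* Borel sigma-algebra of C^{0,b}([a,c]) (separable, hence generated by open balls) *)
Definition holder_borel {d : nat} (b a c : R) : set (set (R -> vec d)) :=
  <<s [set B | exists f e, in_C0H b a c f /\ 0 < e /\
         B = [set g | in_C0H b a c g /\ holnorm b a c (g \- f) < e]] >>.

Definition is_RS {d : nat} (f : R -> vec d) (g : R -> R) (a b : R) (I : vec d) : Prop :=
  forall e : R, 0 < e -> exists del : R, 0 < del /\
    forall (n : nat) (p xi : nat -> R), p 0%N = a -> p n = b ->
      (forall i : nat, (i < n)%N -> p i <= xi i <= p i.+1 /\ p i.+1 - p i < del) ->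
      enorm (\sum_(i < n) (g (p i.+1) - g (p i)) *: f (xi i) - I) < e.

Definition seg {d : nat} (X : R -> vec d) (s : R) : R -> vec d := fun th => X (s + th).

Definition is_solution {d : nat} (r T : R) (F G : (R -> vec d) -> vec d)
    (w : R -> R) (eta X : R -> vec d) : Prop :=
  (forall th, - r <= th <= 0 -> X th = eta th) /\
  forall t, 0 <= t <= T -> exists I1 I2 : vec d,
    is_RS (fun s => F (seg X s)) id 0 t I1 /\
    is_RS (fun s => G (seg X s)) w 0 t I2 /\
    X t = eta 0 + I1 + I2.

Definition prod3_sigma (beta : R) (d : nat) (SV : set (set (R -> vec d)))
  : set (set ((R * OmegaM beta) * (R -> vec d))) :=
  <<s [set A | exists (A1 : set R) (A2 : set (OmegaM beta)) A3,
        measurable A1 /\ measurable A2 /\ SV A3 /\ A = (A1 `*` A2) `*` A3] >>.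

End Defs.
Arguments oval {R beta}.

(* Main.v *)
(** Almost every path of fractional Brownian motion is Hoelder of every order g < H on compact
    intervals: the tails of the increments follow from the characteristic function, and
    Borel-Cantelli on dyadic grids plus chaining give the modulus.  Taking
    b = 1 - alpha < g < H, so that b + g > 1, dyadic Riemann sums converge to the Young integral,
    which is additive and shift-compatible because it is the only function J with
    J v - J u - f u (w v - w u) = O((v - u)^(b + g)).  In the b-Hoelder norm the solution map on
    [0, T] is a contraction for small T, with T depending only on the g-Hoelder constant of the
    path and, for differences, on an a priori bound of the solutions; iterating over steps of
    fixed length gives global existence, uniqueness and local Lipschitz dependence on the initial
    segment and on the path.  Shifting the integral gives the cocycle property, and joint
    continuity in (t, w, eta) together with a countable family of rational polygons gives joint
    measurability. *)

Require Import Defs.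
From HB Require Import structures.
From mathcomp Require Import all_boot all_order all_algebra.
From mathcomp Require Import all_classical all_reals all_analysis.
From mathcomp Require Import measurable_realfun.
From mathcomp Require Import ring lra zify.
Import Order.TTheory GRing.Theory Num.Theory.
Import numFieldNormedType.Exports.
Local Open Scope classical_set_scope.
Local Open Scope ring_scope.

(** The exponents b < g are kept apart because their gap does the work: on an interval of length T
    the increments of a solution are g-Hoelder, so in the b-norm they carry a factor T^(g - b). The
    obstacle to a plain fixed point argument is that X |-> G(X_s) is Lipschitz for Hoelder norms
    only on bounded sets, with a constant that grows with the bound. Its growth is affine, however,
    so solutions can be bounded before they are compared or even constructed, and the steps cannot
    shrink. The second obstacle is measurability: the sigma-algebra knows a path through its values
    at fixed times, whereas the solution is continuous for a Hoelder distance of paths. Two orders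
    g1 < g2 below H resolve this: a path of order g2 is little g1-Hoelder, and such paths are
    separable in the g1-norm. The axioms of a random dynamical system hold for every path, although
    [Omega] guarantees only the order beta, which need not exceed b; hence the special treatment of
    paths that are not of order g2. Estimates are componentwise, with one constant for supremum and
    seminorm; Euclidean norms enter only at the interface with the statement. *)

Section RealPrelim.
Variable R : realType.
Implicit Types (x y b g q : R).

(** * Real powers and geometric sequences *)

Lemma ler_powRr (b x y : R) : 0 <= b -> 0 <= x -> x <= y -> x `^ b <= y `^ b.
Proof.
move=> b0 x0 xy; apply: (ge0_ler_powR b0) => //; rewrite nnegrE //.
exact: le_trans xy.
Qed.

(** Positive exponents keep clear of the convention that 0 to the power 0 is 1, so x = 0 is
    allowed. *)
Lemma powRDp (x b g : R) : 0 <= x -> 0 < b -> 0 < g -> x `^ (b + g) = x `^ b * x `^ g.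
Proof.
move=> x0 b0 g0; apply: powRD; apply/implyP => /eqP; lra.
Qed.

(** The surplus exponent turns into a factor that is small with the length t; the smallness of the
    Picard map and the little Hoelder property both come from here. *)
Lemma powR_split (x t b g : R) : 0 <= x <= t -> 0 < b -> b < g ->
  x `^ g <= t `^ (g - b) * x `^ b.
Proof.
move=> /andP[x0 xt] b0 bg.
rewrite -{1}(subrK b g) (powRDp x) //; last lra.
rewrite ler_wpM2r ?powR_ge0 // ler_powRr //; lra.
Qed.

Lemma powR_le_exp (x b g : R) : 0 <= x <= 1 -> 0 < b -> b <= g -> x `^ g <= x `^ b.
Proof.
move=> /andP[x0 x1] b0 bg.
have [->|xn] := eqVneq x 0; first by rewrite !powR0 //; lra.
apply: ger_powR => //; rewrite x1 andbT lt_neqAle eq_sym xn //.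
Qed.

Lemma powR_small (b e : R) : 0 < b -> 0 < e ->
  exists2 t : R, 0 < t <= 1 & t `^ b <= e.
Proof.
move=> b0 e0; have b1 : 0 < b^-1 by rewrite invr_gt0.
exists (Num.min 1 (e `^ b^-1)).
  by rewrite lt_min ltr01 powR_gt0 //= ge_min.
rewrite [leRHS](_ : e = (e `^ b^-1) `^ b); last by rewrite -powRrM mulVf ?powRr1 ?ltW// gt_eqF.
apply: ler_powRr; first exact: ltW.
  by rewrite le_min ler01 powR_ge0.
by rewrite ge_min lexx orbT.
Qed.

Lemma geo_small (q C e : R) : 0 <= q -> q < 1 -> 0 < e -> exists n, C * q ^+ n < e.
Proof.
move=> q0 q1 e0.
have := @cvg_geometric R C q.
rewrite ger0_norm // => /(_ q1) /cvgrPdist_lt /(_ e e0) [n _ /(_ n)] /= H.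
exists n; apply: le_lt_trans (H (leqnn n)).
by rewrite sub0r normrN ler_norm.
Qed.

(** Lets a bound be proved by iteration: each round of a contraction shrinks the error term, and no
    limit of functions has to be formed. *)
Lemma ler_geo (q C x y : R) : 0 <= q -> q < 1 ->
  (forall n, x <= y + C * q ^+ n) -> x <= y.
Proof.
move=> q0 q1 H; apply/ler_addgt0Pr => e e0.
have [n Hn] := geo_small _ C _ q0 q1 e0.
by apply: le_trans (H n) _; rewrite lerD2l ltW.
Qed.

Lemma lim_le_abs (u : R^nat) (l c M : R) : u @ \oo --> l ->
  (forall n, `|u n - c| <= M) -> `|l - c| <= M.
Proof.
move=> ul H.
apply/ler_addgt0Pr => e e0.
move/cvgrPdist_lt : ul => /(_ e e0) [n _ /(_ n (leqnn n))] /= Hn.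
have -> : l - c = (l - u n) + (u n - c) by ring.
apply: le_trans (ler_normD _ _) _; rewrite addrC; apply: lerD => //; exact: ltW.
Qed.

Lemma cvg_addl (u : R^nat) (l : R) n : u @ \oo --> l -> u (n + k)%N @[k --> \oo] --> l.
Proof.
have := @cvg_shiftn n R u (nbhs l).
have -> : (fun k => u (n + k)%N) = (fun k => u (k + n)%N) by apply/funext => k; rewrite addnC.
by move=> ->.
Qed.

Lemma geo_cvg (q C : R) (u : R^nat) : 0 <= q -> q < 1 ->
  (forall n, `|u n.+1 - u n| <= C * q ^+ n) ->
  (exists l : R, u @ \oo --> l) /\
  (forall l : R, u @ \oo --> l -> forall n, `|l - u n| <= C / (1 - q) * q ^+ n).
Proof.
move=> q0 q1 H.
have q1' : 0 < 1 - q by lra.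
have P m n : `|u (m + n)%N - u m| <= C / (1 - q) * q ^+ m.
  (* The induction carries the closed form of the partial geometric sum; the factor 1 - q ^+ n is
     dropped afterwards. *)
  have E : `|u (m + n)%N - u m| <= C / (1 - q) * q ^+ m * (1 - q ^+ n).
    elim: n => [|n IH]; first by rewrite addn0 subrr normr0 expr0 subrr mulr0.
    have -> : u (m + n.+1)%N - u m = (u (m + n).+1%N - u (m + n)%N) + (u (m + n)%N - u m).
      by rewrite addnS; ring.
    apply: le_trans (ler_normD _ _) _; apply: le_trans (lerD (H _) IH) _.
    rewrite exprS exprD le_eqVlt; apply/orP; left; apply/eqP; field; lra.
  apply: le_trans E _.
  have C0 : 0 <= C by have := H 0%N; rewrite expr0 mulr1; apply: le_trans.
  rewrite ler_piMr //; last by rewrite gerBl exprn_ge0.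
  by rewrite mulr_ge0 ?exprn_ge0// mulr_ge0 // invr_ge0 ltW.
split; last first.
  move=> l ul n.
  apply: (lim_le_abs (fun k => u (n + k)%N)) => //.
  exact: cvg_addl.
suff : cvgn u by move=> cu; exists (limn u).
have -> : u = (fun n => u 0%N + series (telescope u) n).
  by apply/funext => n; exact: eq_sum_telescope.
apply: is_cvgD; first exact: is_cvg_cst.
apply: normed_cvg.
apply: (@series_le_cvg _ _ (geometric C q)).
- by move=> n; exact: normr_ge0.
- move=> n /=; rewrite mulr_ge0 ?exprn_ge0//.
  by have := H 0%N; rewrite expr0 mulr1; apply: le_trans.
- by move=> n; exact: H.
- by apply: is_cvg_geometric_series; rewrite ger0_norm.
Qed.

Lemma powR_exprn (x p : R) n : 0 <= x -> (x ^+ n) `^ p = (x `^ p) ^+ n.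
Proof.
move=> x0; elim: n => [|n IH]; first by rewrite !expr0 powR1.
by rewrite !exprS powRM ?exprn_ge0 // IH.
Qed.

End RealPrelim.

(** * The Young integral as a limit of dyadic sums *)

Section Young.
Variable R : realType.

Definition hold (b K a c : R) (f : R -> R) : Prop :=
  forall s t, a <= s -> s <= t -> t <= c -> `|f t - f s| <= K * (t - s) `^ b.

Lemma hold_abs b K a c f s t : hold b K a c f ->
  a <= s <= c -> a <= t <= c -> `|f t - f s| <= K * `|t - s| `^ b.
Proof.
move=> hf /andP[s1 s2] /andP[t1 t2]; have [st|ts] := leP s t.
  by rewrite (ger0_norm (_ : 0 <= t - s)) ?subr_ge0//; apply: hf.
rewrite distrC (distrC t) (ger0_norm (_ : 0 <= s - t)) ?subr_ge0 ?(ltW ts)//.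
by apply: hf => //; apply: ltW.
Qed.

Definition cell (h t : R) : nat := Num.truncn (t / h).

Lemma cellP (h t : R) : 0 < h -> 0 <= t ->
  (cell h t)%:R * h <= t < (cell h t).+1%:R * h.
Proof.
move=> h0 t0; have /truncn_itv : 0 <= t / h by rewrite divr_ge0 // ltW.
by rewrite ler_pdivlMr // ltr_pdivrMr.
Qed.

(** A left-point sum that includes the unfinished last cell: it becomes a function of t whose
    increment inside one cell is a single product. *)
Definition lstep (h : R) (f g : R -> R) (t : R) : R :=
  \sum_(0 <= k < cell h t) f (k%:R * h) * (g (k.+1%:R * h) - g (k%:R * h))
  + f ((cell h t)%:R * h) * (g t - g ((cell h t)%:R * h)).

Lemma lstepE h f g (k : nat) t : 0 < h -> k%:R * h <= t <= k.+1%:R * h ->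
  lstep h f g t =
  \sum_(0 <= j < k) f (j%:R * h) * (g (j.+1%:R * h) - g (j%:R * h))
  + f (k%:R * h) * (g t - g (k%:R * h)).
Proof.
move=> h0 /andP[kt tk].
have t0 : 0 <= t by apply: le_trans kt; rewrite mulr_ge0 // ltW.
(* At the right end of the cell, [cell] already returns k.+1; both formulas give the same sum
   there. *)
move: tk; rewrite le_eqVlt => /orP[/eqP tE|tk].
  have -> : lstep h f g t = lstep h f g (k.+1%:R * h) by rewrite tE.
  rewrite /lstep.
  have -> : cell h (k.+1%:R * h) = k.+1.
    by rewrite /cell mulfK ?gt_eqF // natrK.
  by rewrite subrr mulr0 addr0 big_nat_recr //= tE.
have ck : cell h t = k.
  by apply: truncn_def; rewrite ler_pdivlMr // ltr_pdivrMr // kt tk.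
by rewrite /lstep ck.
Qed.

Lemma lstepB h f g (k : nat) u v : 0 < h -> k%:R * h <= u -> u <= v -> v <= k.+1%:R * h ->
  lstep h f g v - lstep h f g u = f (k%:R * h) * (g v - g u).
Proof.
move=> h0 ku uv vk.
rewrite (lstepE h f g k v) //; last by rewrite vk (le_trans ku).
rewrite (lstepE h f g k u) //; last by rewrite ku (le_trans uv).
ring.
Qed.

Lemma lstep0 h f g : 0 < h -> lstep h f g 0 = 0.
Proof.
move=> h0; rewrite (lstepE h f g 0) // ?mul0r ?mul1r ?lexx ?ltW //.
by rewrite big_geq // subrr mulr0 addr0.
Qed.

(* [u, v] meets at most (v - u) / h + 2 <= 3 (v - u) / h cells of the grid h * nat. *)
Lemma chain (D : R -> R) (h E g u v : R) : 0 < h -> 0 <= u -> h <= v - u ->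
  0 < g -> 0 <= E ->
  (forall (k : nat) x y, u <= x -> x <= y -> y <= v ->
     k%:R * h <= x -> y <= k.+1%:R * h -> `|D y - D x| <= E * (y - x) `^ g) ->
  `|D v - D u| <= 3 * E * h `^ (g - 1) * (v - u).
Proof.
move=> h0 u0 huv g0 E0 H.
have hg : h `^ g = h `^ (g - 1) * h.
  by rewrite -{3}(powRr1 (ltW h0)) -powRD ?subrK // (gt_eqF h0) implybT.
have /andP[k1 k2] := cellP h u h0 u0; set k0 := cell h u in k1 k2.
have P m y : u <= y -> y <= v -> y <= (k0 + m).+1%:R * h ->
    `|D y - D u| <= m.+1%:R * (E * h `^ g).
  elim: m y => [|m IH] y uy yv ym.
    rewrite mul1r; apply: le_trans (H k0 u y _ _ _ _ _) _ => //; first by rewrite addn0 in ym.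
    rewrite ler_wpM2l // ler_powRr ?(ltW g0)// ?subr_ge0 //.
    rewrite addn0 -natr1 mulrDl mul1r in ym; lra.
  have [ys|ys] := leP y ((k0 + m).+1%:R * h).
    apply: le_trans (IH y uy yv ys) _; rewrite ler_wpM2r ?ler_nat ?mulr_ge0 ?powR_ge0 //.
  set z := (k0 + m).+1%:R * h in ys *.
  have uz : u <= z.
    apply: ltW; apply: lt_le_trans k2 _; rewrite ler_pM2r // ler_nat ltnS leq_addr //.
  have zv : z <= v by apply: le_trans yv; apply: ltW.
  have -> : D y - D u = (D y - D z) + (D z - D u) by ring.
  apply: le_trans (ler_normD _ _) _.
  have -> : m.+2%:R = 1 + m.+1%:R :> R by rewrite -natr1 addrC.
  rewrite mulrDl mul1r.
  apply: lerD; last by apply: IH.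
  apply: le_trans (H (k0 + m).+1 z y _ _ _ _ _) _ => //; [exact: ltW|by rewrite addnS in ym|].
  rewrite ler_wpM2l // ler_powRr ?(ltW g0)// ?subr_ge0 ?(ltW ys)//.
  by move: ym; rewrite addnS -natr1 mulrDl mul1r -/z => ym; lra.
have vu0 : 0 <= v - u by apply: le_trans huv; apply: ltW.
set m := (cell h (v - u)).+1.
have /andP[m1 m2] := cellP h (v - u) h0 vu0.
have := P m v _ (lexx _) _.
rewrite -subr_ge0 => /(_ vu0) /= Q.
have {}Q : `|D v - D u| <= m.+1%:R * (E * h `^ g).
  apply: Q; rewrite -addSn natrD mulrDl; move: m2 k2; rewrite -/m => m2 k2.
  by rewrite -(subrK u v) [leLHS]addrC; apply: lerD; exact: ltW.
apply: le_trans Q _.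
rewrite hg.
have -> : m.+1%:R * (E * (h `^ (g - 1) * h)) = E * h `^ (g - 1) * (m.+1%:R * h) by ring.
have -> : 3 * E * h `^ (g - 1) * (v - u) = E * h `^ (g - 1) * (3 * (v - u)) by ring.
rewrite ler_wpM2l ?mulr_ge0 ?powR_ge0 //.
have -> : m.+1%:R = (cell h (v - u))%:R + 2 :> R by rewrite /m -addn2 natrD.
rewrite mulrDl; lra.
Qed.

Definition dy (n : nat) : R := 2^-1 ^+ n.

Lemma dy_gt0 n : 0 < dy n. Proof. by rewrite exprn_gt0. Qed.
Lemma dyS n : dy n.+1 = dy n / 2. Proof. by rewrite /dy exprSr. Qed.

Definition young (f g : R -> R) (t : R) : R :=
  lim (lstep (dy n) f g t @[n --> \oo]).

Section Est.
Variables (b g A B T : R) (f w : R -> R).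
Hypotheses (b0 : 0 < b) (g0 : 0 < g) (bg : 1 < b + g) (A0 : 0 <= A) (B0 : 0 <= B).
Hypotheses (hf : hold b A 0 T f) (hw : hold g B 0 T w).

(** On a fine cell the two sums differ only in the point where f is read, and these points are at
    most one fine mesh apart. This gives A h^b times the increment of w, and [chain] adds it up over
    the cells. *)
Lemma lstep_refine n u v : 0 <= u -> v <= T -> dy n.+1 <= v - u ->
  `|(lstep (dy n.+1) f w v - lstep (dy n) f w v)
    - (lstep (dy n.+1) f w u - lstep (dy n) f w u)|
  <= 3 * A * B * (v - u) * dy n.+1 `^ (b + g - 1).
Proof.
move=> u0 vT huv; set h' := dy n.+1.
have h'0 : 0 < h' := dy_gt0 _.
have hE : dy n = h' * 2 by rewrite /h' dyS divfK.
have h0 := dy_gt0 n.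
have -> : 3 * A * B * (v - u) * h' `^ (b + g - 1) = 3 * (A * B * h' `^ b) * h' `^ (g - 1) * (v - u).
  have -> : h' `^ (b + g - 1) = h' `^ b * h' `^ (g - 1).
    by rewrite -powRD ?addrA // (gt_eqF h'0) implybT.
  ring.
apply: (chain (fun x => lstep h' f w x - lstep (dy n) f w x)) => //.
  by rewrite !mulr_ge0 // powR_ge0.
move=> k x y ux xy yv kx yk.
(* Fine cell k lies in coarse cell k./2; the left ends differ exactly for odd k. *)
pose j := k./2.
have kE : k = (odd k + j.*2)%N by rewrite odd_double_half.
have lo : j%:R * dy n <= x.
  apply: le_trans kx; rewrite hE mulrA mulrAC -natrM ler_pM2r // ler_nat muln2.
  by rewrite [leqRHS]kE leq_addl.
have hi : y <= j.+1%:R * dy n.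
  apply: le_trans yk _; rewrite hE mulrA mulrAC -natrM ler_pM2r // ler_nat muln2 doubleS.
  by rewrite ltnS [leqLHS]kE -add1n leq_add2r leq_b1.
have -> : (lstep h' f w y - lstep (dy n) f w y) - (lstep h' f w x - lstep (dy n) f w x) =
   (f (k%:R * h') - f (j%:R * dy n)) * (w y - w x).
  have e1 := lstepB h' f w k x y h'0 kx xy yk.
  have e2 := lstepB (dy n) f w j x y h0 lo xy hi.
  rewrite mulrBl -e1 -e2; ring.
rewrite normrM.
have jk : `|k%:R * h' - j%:R * dy n| <= h' /\ j%:R * dy n <= k%:R * h'.
  rewrite hE mulrA mulrAC -natrM muln2 -mulrBl normrM (ger0_norm (ltW h'0)).
  have -> : k%:R - (j.*2)%:R = (odd k)%:R :> R.
    by rewrite {1}kE natrD addrK.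
  split; first by rewrite ler_piMl ?(ltW h'0)//; case: (odd k); rewrite ?normr1 ?normr0.
  by rewrite ler_pM2r // ler_nat [leqRHS]kE leq_addl.
have k0 : 0 <= j%:R * dy n by rewrite mulr_ge0 // ltW.
have kT : k%:R * h' <= T by apply: le_trans kx _; apply: le_trans xy _; apply: le_trans vT.
have -> : A * B * h' `^ b * (y - x) `^ g = (A * h' `^ b) * (B * (y - x) `^ g) by ring.
apply: ler_pM => //; last by apply: hw => //; [exact: le_trans ux|exact: le_trans vT].
apply: le_trans (hf _ _ _ _ _) _ => //; first by case: jk.
rewrite ler_wpM2l // ler_powRr ?(ltW b0) ?subr_ge0 //; first by case: jk.
by case: jk => jk _; apply: le_trans jk; exact: ler_norm.
Qed.

Let q : R := 2^-1 `^ (b + g - 1).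

Lemma q_ge0 : 0 <= q. Proof. exact: powR_ge0. Qed.
Lemma q_lt1 : q < 1.
Proof.
have -> : 1 = 1 `^ (b + g - 1) :> R by rewrite powR1.
apply: gt0_ltr_powR; rewrite ?nnegrE //; have bg1 := bg; lra.
Qed.

Lemma dy_q n : dy n `^ (b + g - 1) = q ^+ n.
Proof. by rewrite powR_exprn. Qed.

(** Refinement starts at a level n0 whose mesh fits into [u, v], because [chain] needs cells no
    longer than the interval. *)
Lemma lstep_geo u v n0 n : 0 <= u -> v <= T -> dy n0 <= v - u ->
  `|(lstep (dy (n0 + n).+1) f w v - lstep (dy (n0 + n).+1) f w u)
   - (lstep (dy (n0 + n)) f w v - lstep (dy (n0 + n)) f w u)|
  <= 3 * A * B * (v - u) * q ^+ n0 * q ^+ n.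
Proof.
move=> u0 vT huv.
have H : dy (n0 + n).+1 <= v - u.
  apply: le_trans huv; rewrite /dy -addnS exprD ler_piMr ?exprn_ge0 // exprn_ile1 //; lra.
have := lstep_refine (n0 + n) u v u0 vT H.
rewrite dy_q; set a1 := lstep _ _ _ _; set a2 := lstep _ _ _ _; set a3 := lstep _ _ _ _; set a4 := lstep _ _ _ _.
have -> : a1 - a2 - (a3 - a4) = a1 - a3 - (a2 - a4) by ring.
move=> /le_trans; apply.
rewrite [leRHS](_ : _ = 3 * A * B * (v - u) * q ^+ (n0 + n)); last by rewrite exprD; ring.
rewrite ler_wpM2l //.
  by rewrite !mulr_ge0 //; apply: le_trans huv; apply: ltW; exact: dy_gt0.
rewrite exprS ler_piMl ?exprn_ge0 ?q_ge0 //; apply: ltW; exact: q_lt1.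
Qed.

Lemma dy_le (x : R) : 0 < x -> exists n, dy n <= x.
Proof.
move=> x0; have [n] := geo_small R 2^-1 1 x ltac:(lra) ltac:(lra) x0.
by rewrite mul1r => /ltW; exists n.
Qed.

Lemma dy_between (x : R) : 0 < x <= 1 -> exists2 n, dy n <= x & x <= 2 * dy n.
Proof.
move=> /andP[x0 x1].
have ex : exists n, dy n <= x by exact: dy_le.
case: (ex_minnP ex) => -[|n] Hn Hm.
  by exists 0%N => //; rewrite /dy expr0; lra.
exists n.+1 => //; have [//|xn] := leP x (2 * dy n.+1).
have : dy n <= x by rewrite ltW //; move: xn; rewrite dyS; lra.
by move/Hm; rewrite ltnn.
Qed.

Lemma young_cvg t : 0 <= t <= T -> lstep (dy n) f w t @[n --> \oo] --> young f w t.
Proof.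
move=> /andP[]; rewrite le_eqVlt => /orP[/eqP <- _|t0 tT].
    rewrite /young.
    suff -> : (fun n => lstep (dy n) f w 0) = fun=> 0 by rewrite lim_cst //; exact: cvg_cst.
    by apply/funext => n; rewrite lstep0 // dy_gt0.
have [n0 n0t] := dy_le t t0.
have [[l ul] _] := @geo_cvg R q (3 * A * B * (t - 0) * q ^+ n0)
  (fun n => lstep (dy (n0 + n)) f w t) q_ge0 q_lt1 ltac:(move=> n;
   have := lstep_geo 0 t n0 n (lexx _) tT; rewrite subr0 !lstep0 ?dy_gt0 // !subr0 -addnS;
   exact).
suff cv : cvgn (fun n => lstep (dy n) f w t) by exact: cv.
apply/cvg_ex; exists l => /=.
rewrite -(@cvg_shiftn n0 R _ (nbhs l)).
by under eq_fun do rewrite addnC.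
Qed.

Lemma young_est0 u v n0 : 0 <= u -> v <= T -> dy n0 <= v - u ->
  `|(young f w v - young f w u) - (lstep (dy n0) f w v - lstep (dy n0) f w u)|
  <= 3 / (1 - q) * A * B * (v - u) * dy n0 `^ (b + g - 1).
Proof.
move=> u0 vT huv.
have d0 := dy_gt0 n0.
have cvv : lstep (dy n) f w v - lstep (dy n) f w u @[n --> \oo] --> young f w v - young f w u.
  apply: cvgB; apply: young_cvg.
    by rewrite vT andbT; lra.
  by rewrite u0 /=; lra.
have [_ H] := @geo_cvg R q (3 * A * B * (v - u) * q ^+ n0)
  (fun n => lstep (dy (n0 + n)) f w v - lstep (dy (n0 + n)) f w u) q_ge0 q_lt1 ltac:(move=> n;
   have := lstep_geo u v n0 n u0 vT huv; rewrite -addnS; exact).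
have {}H := H (young f w v - young f w u).
rewrite dy_q.
have := H _ 0%N; rewrite expr0 mulr1 addn0.
rewrite (_ : 3 / (1 - q) * A * B * (v - u) * q ^+ n0 = 3 * A * B * (v - u) * q ^+ n0 / (1 - q)); last by ring.
apply.
exact: cvg_addl cvv.
Qed.

Lemma young0 : young f w 0 = 0.
Proof.
rewrite /young.
suff -> : (fun n => lstep (dy n) f w 0) = fun=> 0 by rewrite lim_cst.
by apply/funext => n; rewrite lstep0 // dy_gt0.
Qed.

(** The first term sums all refinements below the scale v - u, the second compares the sum at that
    scale with a single product. *)
Definition Cyoung : R := 3 / (1 - q) + 3 * 3 `^ b.

Lemma Cyoung_ge0 : 0 <= Cyoung.
Proof.
have q1 := q_lt1; rewrite addr_ge0 ?mulr_ge0 ?powR_ge0 // ?invr_ge0; lra.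
Qed.

(** The grid is taken at the scale of v - u, so a bounded number of cells is involved. The tag x is
    arbitrary in [u, v] because Riemann-Stieltjes sums with any tags are compared with the integral
    later. *)
Lemma young_est u x v : 0 <= u -> u <= x -> x <= v -> v <= T -> v - u <= 1 ->
  `|young f w v - young f w u - f x * (w v - w u)| <= Cyoung * A * B * (v - u) `^ (b + g).
Proof.
move=> u0 ux xv vT vu1; have bg1 := bg.
have : 0 <= v - u by lra.
rewrite le_eqVlt => /orP[/eqP vu|vu0].
  have -> : v = u by lra.
  rewrite !subrr mulr0 subrr normr0 powR0 ?mulr0 //; apply/eqP; lra.
have [n0 hn nh] := dy_between (v - u) ltac:(by apply/andP).
set h := dy n0 in hn nh.
have h0 : 0 < h := dy_gt0 _.
have P0 : h `^ (b + g - 1) * (v - u) <= (v - u) `^ (b + g).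
  have -> : (v - u) `^ (b + g) = (v - u) `^ (b + g - 1) * (v - u).
    by rewrite -{3}(powRr1 (ltW vu0)) -powRD ?subrK // (gt_eqF vu0) implybT.
  rewrite ler_wpM2r ?(ltW vu0) // ler_powRr //; [lra|exact: ltW].
have P1 := young_est0 u v n0 u0 vT hn.
have P2 : `|(lstep h f w v - lstep h f w u) - f x * (w v - w u)|
   <= 3 * 3 `^ b * A * B * (h `^ (b + g - 1) * (v - u)).
  have -> : (lstep h f w v - lstep h f w u) - f x * (w v - w u) =
    (lstep h f w v - f x * w v) - (lstep h f w u - f x * w u) by ring.
  have -> : 3 * 3 `^ b * A * B * (h `^ (b + g - 1) * (v - u)) =
     3 * (A * (3 * h) `^ b * B) * h `^ (g - 1) * (v - u).
    have -> : h `^ (b + g - 1) = h `^ b * h `^ (g - 1).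
      by rewrite -powRD ?addrA // (gt_eqF h0) implybT.
    rewrite powRM //; [ring|exact: ltW].
  apply: (chain (fun t => lstep h f w t - f x * w t)) => //.
    by rewrite !mulr_ge0 // powR_ge0.
  move=> k y z uy yz zv ky zk.
  have -> : lstep h f w z - f x * w z - (lstep h f w y - f x * w y) =
     (f (k%:R * h) - f x) * (w z - w y).
    rewrite mulrBl -(lstepB h f w k y z h0 ky yz zk); ring.
  rewrite normrM -mulrA; apply: ler_pM => //; last first.
    by apply: hw => //; [exact: le_trans uy|exact: le_trans vT].
  have k0 : 0 <= k%:R * h by rewrite mulr_ge0 // ltW.
  apply: le_trans (hold_abs b A 0 T f _ _ hf _ _) _.
  - by apply/andP; lra.
  - by apply/andP; lra.
  rewrite ler_wpM2l // ler_powRr ?(ltW b0) //.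
  have := zk; rewrite -natr1 mulrDl mul1r ler_norml => zk'; apply/andP; lra.
have -> : young f w v - young f w u - f x * (w v - w u) =
  (young f w v - young f w u - (lstep h f w v - lstep h f w u)) +
  ((lstep h f w v - lstep h f w u) - f x * (w v - w u)) by ring.
apply: le_trans (ler_normD _ _) _; apply: le_trans (lerD P1 P2) _.
rewrite [leLHS](_ : _ = Cyoung * A * B * (h `^ (b + g - 1) * (v - u))).
  by rewrite ler_wpM2l // !mulr_ge0 // Cyoung_ge0.
rewrite /Cyoung; ring.
Qed.

(** Over about t / h cells the increments add up to order t h^(p - 1), which vanishes with h. *)
Lemma const_of_superlinear (D : R -> R) (C p : R) : 1 < p -> 0 <= C ->
  (forall u v, 0 <= u -> u <= v -> v <= T -> v - u <= 1 -> `|D v - D u| <= C * (v - u) `^ p) ->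
  forall t, 0 <= t <= T -> D t = D 0.
Proof.
move=> p1 C0 H t /andP[]; rewrite le_eqVlt => /orP[/eqP <- //|t0 tT].
apply/eqP; rewrite -subr_eq0 -normr_le0.
have [n0 n0t] := dy_le t t0.
pose qp : R := 2^-1 `^ (p - 1).
have qp1 : qp < 1.
  have -> : 1 = 1 `^ (p - 1) :> R by rewrite powR1.
  by apply: gt0_ltr_powR; rewrite ?nnegrE //; lra.
apply: (@ler_geo R qp (3 * C * t)); [exact: powR_ge0|by []|] => n.
rewrite add0r.
set h := dy (n0 + n).
have h0 : 0 < h := dy_gt0 _.
have h1 : h <= 1 by rewrite exprn_ile1 //; lra.
have ht : h <= t - 0.
  rewrite subr0; apply: le_trans n0t.
  by rewrite /h /dy exprD ler_piMr ?exprn_ge0 // exprn_ile1 //; lra.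
have := chain D h (C * h `^ (p - 1)) 1 0 t h0 (lexx _) ht ltr01.
rewrite subrr powRr0 subr0 mulr1 => H1.
have hE : h `^ (p - 1) = qp ^+ (n0 + n) by rewrite powR_exprn.
apply: le_trans (H1 _ _) _.
- by rewrite mulr_ge0 // powR_ge0.
- move=> k x y x0 xy yt kx yk.
  have yx : y - x <= h by move: yk; rewrite -natr1 mulrDl mul1r => yk; lra.
  apply: le_trans (H _ _ _ _ _ _) _ => //; [exact: le_trans yt tT|exact: le_trans h1|].
  have yx0 : 0 <= y - x by lra.
  rewrite powRr1 // -[leRHS]mulrA ler_wpM2l //.
  rewrite -{1}(subrK 1 p) (@powRDp _ (y - x)) //; last by lra.
  by rewrite powRr1 // ler_wpM2r // ler_powRr //; lra.
- rewrite hE mulrA [leLHS]mulrAC ler_wpM2l //; first by rewrite !mulr_ge0 // ltW.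
  by rewrite exprD ler_piMl ?exprn_ge0 ?exprn_ile1 ?powR_ge0 // ltW.
Qed.

(** Two functions with the same local expansion differ by one with superlinear increments. The laws
    of the integral follow by exhibiting an expansion, without manipulating sums. *)
Lemma young_uniq (J : R -> R) (C : R) : J 0 = 0 -> 0 <= C ->
  (forall u v, 0 <= u -> u <= v -> v <= T -> v - u <= 1 ->
     `|J v - J u - f u * (w v - w u)| <= C * (v - u) `^ (b + g)) ->
  forall t, 0 <= t <= T -> J t = young f w t.
Proof.
move=> J0 C0 H t tT.
have E := const_of_superlinear (fun t => J t - young f w t) (C + Cyoung * A * B) (b + g) bg.
suff : J t - young f w t = J 0 - young f w 0 by rewrite J0 young0 subrr => /eqP; rewrite subr_eq0 => /eqP.
apply: E => //; first by rewrite addr_ge0 // !mulr_ge0 // Cyoung_ge0.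
move=> u v u0 uv vT vu1.
have -> : J v - young f w v - (J u - young f w u) =
  (J v - J u - f u * (w v - w u)) - (young f w v - young f w u - f u * (w v - w u)) by ring.
apply: le_trans (ler_normB _ _) _; rewrite mulrDl; apply: lerD; first exact: H.
exact: young_est.
Qed.

(** A cell of length l contributes an error K l^(b + g), at most K del^(b + g - 1) l, and the
    lengths add up to t. *)
Lemma young_RS t : 0 <= t <= T -> forall e, 0 < e -> exists del : R, 0 < del /\
  forall (n : nat) (p xi : nat -> R), p 0%N = 0 -> p n = t ->
    (forall i : nat, (i < n)%N -> p i <= xi i <= p i.+1 /\ p i.+1 - p i < del) ->
    `|\sum_(i < n) (w (p i.+1) - w (p i)) * f (xi i) - young f w t| < e.
Proof.
move=> /andP[t0 tT] e e0; have bg1 := bg.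
pose K := Cyoung * A * B.
have K0 : 0 <= K by rewrite !mulr_ge0 // Cyoung_ge0.
have Kt : 0 < K * t + 1 by have := mulr_ge0 K0 t0; lra.
have e2 : 0 < e / (K * t + 1) / 2 by rewrite !divr_gt0.
have [del /andP[d0 d1] dE] := powR_small R (b + g - 1) _ ltac:(lra) e2.
exists del; split=> // n p xi p0 pn H.
have mono i j : (i <= j)%N -> (j <= n)%N -> p i <= p j.
  move=> ij; rewrite -(subnKC ij); elim: (j - i)%N => [|k IH]; first by rewrite addn0.
  rewrite addnS => kn; apply: le_trans (IH (ltnW kn)) _.
  by have [/andP[h1 h2] _] := H _ kn; apply: le_trans h2.
have tel : \sum_(i < n) (young f w (p i.+1) - young f w (p i)) = young f w t.
  rewrite -(big_mkord xpredT (fun i => young f w (p i.+1) - young f w (p i))).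
  by rewrite telescope_sumr // p0 pn young0 subr0.
have telp : \sum_(i < n) (p i.+1 - p i) = t.
  rewrite -(big_mkord xpredT (fun i => p i.+1 - p i)).
  by rewrite telescope_sumr // p0 pn subr0.
rewrite -tel -sumrB.
apply: le_lt_trans (ler_norm_sum _ _ _) _.
apply: (@le_lt_trans _ _ (\sum_(i < n) (K * del `^ (b + g - 1)) * (p i.+1 - p i))).
  apply: ler_sum => i _.
  have [/andP[h1 h2] h3] := H i (ltn_ord i).
  rewrite distrC [X in _ - X]mulrC.
  have q0 : 0 <= p i by rewrite -p0 mono // ltnW.
  have qT : p i.+1 <= T by apply: le_trans tT; rewrite -pn mono.
  have dd : p i.+1 - p i <= 1 by apply: ltW; apply: lt_le_trans h3 _.
  apply: le_trans (young_est (p i) (xi i) (p i.+1) q0 h1 h2 qT dd) _.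
  have ge0 : 0 <= p i.+1 - p i by rewrite subr_ge0 (le_trans h1).
  rewrite -[leRHS]mulrA ler_wpM2l //.
  rewrite -{1}(subrK 1 (b + g)) (@powRDp _ (p i.+1 - p i)) //; last by lra.
  by rewrite powRr1 // ler_wpM2r // ler_powRr //; [lra|exact: ltW].
rewrite -mulr_sumr telp.
apply: (@le_lt_trans _ _ (K * t * (e / (K * t + 1) / 2))).
  by rewrite [leLHS]mulrAC ler_wpM2l // mulr_ge0.
have -> : K * t * (e / (K * t + 1) / 2) = e * ((K * t) / (K * t + 1)) / 2.
  field; lra.
have : (K * t) / (K * t + 1) <= 1 by rewrite ler_pdivrMr // mul1r; lra.
move=> /(ler_wpM2l (ltW e0)); rewrite mulr1 => ?; lra.
Qed.

End Est.

(** The Hoelder constant A guarantees convergence of the sums, but the bound depends on sup |f|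
    alone. This suits the drift, whose differences are controlled in the sup norm only. *)
Lemma young_lip (b A T M : R) (f : R -> R) : 0 < b -> 0 <= A -> hold b A 0 T f ->
  0 <= M -> (forall s, 0 <= s <= T -> `|f s| <= M) ->
  forall u v, 0 <= u -> u <= v -> v <= T -> `|young f id v - young f id u| <= 3 * M * (v - u).
Proof.
move=> b0 A0 hf M0 fM u v u0 uv vT.
have hid : hold 1 1 0 T id by move=> s t _ st _; rewrite mul1r powRr1 ?ger0_norm ?subr_ge0.
have b1 : 1 < b + 1 by lra.
move: uv; rewrite le_eqVlt => /orP[/eqP ->|uv]; first by rewrite !subrr normr0 mulr0.
have [n0 n0v] := dy_le (v - u) ltac:(lra).
have cvv : lstep (dy n) f id v - lstep (dy n) f id u @[n --> \oo] --> young f id v - young f id u.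
  apply: cvgB; apply: (@young_cvg b 1 A 1 T) => //; apply/andP; lra.
rewrite -(subr0 (young f id v - _)).
apply: (lim_le_abs _ _ _ _ _ (cvg_addl _ _ _ n0 cvv)) => n /=.
rewrite subr0; set h := dy (n0 + n).
have h0 : 0 < h := dy_gt0 _.
have hv : h <= v - u.
  apply: le_trans n0v.
  by rewrite /h /dy exprD ler_piMr ?exprn_ge0 // exprn_ile1 //; lra.
have := chain (lstep h f id) h M 1 u v h0 u0 hv ltr01 M0.
rewrite subrr powRr0 mulr1; apply.
move=> k x y ux xy yv kx yk; rewrite (lstepB h f id k) // normrM powRr1 ?subr_ge0 //.
rewrite (ger0_norm (_ : 0 <= id y - id x)) ?subr_ge0 // ler_wpM2r ?subr_ge0 //.
apply: fM; rewrite mulr_ge0 ?(ltW h0) //=; lra.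
Qed.

Lemma holdB b K1 K2 a c (f1 f2 : R -> R) : hold b K1 a c f1 -> hold b K2 a c f2 ->
  hold b (K1 + K2) a c (fun t => f1 t - f2 t).
Proof.
move=> h1 h2 s t as_ st tc.
have -> : f1 t - f2 t - (f1 s - f2 s) = (f1 t - f1 s) - (f2 t - f2 s) by ring.
by apply: le_trans (ler_normB _ _) _; rewrite mulrDl lerD // ?h1 ?h2.
Qed.

Lemma hold_sub b K a c a' c' f : a <= a' -> c' <= c -> hold b K a c f -> hold b K a' c' f.
Proof.
move=> aa cc h s t as_ st tc; apply: h => //; [exact: le_trans as_|exact: le_trans cc].
Qed.

Lemma hold_le b K K' a c f : K <= K' -> hold b K a c f -> hold b K' a c f.
Proof.
by move=> KK h s t as_ st tc; apply: le_trans (h _ _ as_ st tc) _; rewrite ler_wpM2r ?powR_ge0.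
Qed.

Lemma hold_eq b K a c (f f' : R -> R) : (forall t, a <= t <= c -> f t = f' t) -> hold b K a c f ->
  hold b K a c f'.
Proof.
move=> E h s t as_ st tc.
have -> : f' t = f t by rewrite E // tc andbT; lra.
have -> : f' s = f s by rewrite E // as_ /=; lra.
exact: h.
Qed.

Lemma hold_shift b K a c s (f : R -> R) : hold b K a c f ->
  hold b K (a - s) (c - s) (fun x => f (s + x)).
Proof.
move=> h x y x1 xy y1.
have -> : y - x = (s + y) - (s + x) by ring.
apply: h; lra.
Qed.

Lemma hold_theta g B S T (w : R -> R) : hold g B 0 T w -> 0 <= S ->
  hold g B 0 (T - S) (fun s => w (S + s) - w S).
Proof.
move=> h S0 x y x1 xy y1.
have -> : w (S + y) - w S - (w (S + x) - w S) = w (S + y) - w (S + x) by ring.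
have -> : y - x = (S + y) - (S + x) by ring.
apply: h; lra.
Qed.

(** * Algebraic laws of the integral *)

Section Laws.
Variables (b g A B T : R).
Hypotheses (b0 : 0 < b) (g0 : 0 < g) (bg : 1 < b + g) (A0 : 0 <= A) (B0 : 0 <= B).

Lemma young_ext (f f' w w' : R -> R) : hold b A 0 T f -> hold g B 0 T w ->
  (forall s, 0 <= s <= T -> f s = f' s) -> (forall s, 0 <= s <= T -> w s = w' s) ->
  forall t, 0 <= t <= T -> young f w t = young f' w' t.
Proof.
move=> hf hw ef ew.
have hf' := hold_eq _ _ _ _ _ _ ef hf.
have hw' := hold_eq _ _ _ _ _ _ ew hw.
apply: (young_uniq b g A B T f' w' b0 g0 bg A0 B0 hf' hw' _ (Cyoung b g * A * B)).
- by apply: (young0).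
- by rewrite !mulr_ge0 // Cyoung_ge0.
move=> u v u0 uv vT vu1.
have uT : 0 <= u <= T by apply/andP; lra.
have vT' : 0 <= v <= T by apply/andP; lra.
rewrite -ef //. rewrite -!ew //. exact: (young_est b g A B T).
Qed.

Lemma youngB_l (f1 f2 w : R -> R) : hold b A 0 T f1 -> hold b A 0 T f2 -> hold g B 0 T w ->
  forall t, 0 <= t <= T -> young (fun s => f1 s - f2 s) w t = young f1 w t - young f2 w t.
Proof.
move=> h1 h2 hw t tT; symmetry.
have AA : 0 <= A + A by exact: addr_ge0.
apply: (young_uniq b g (A + A) B T _ w b0 g0 bg AA B0 (holdB _ _ _ _ _ _ _ h1 h2) hw
  (fun t => young f1 w t - young f2 w t) (2 * (Cyoung b g * A * B))) => //.
- by rewrite !young0 subrr.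
- by rewrite !mulr_ge0 // Cyoung_ge0.
move=> u v u0 uv vT vu1.
have -> : young f1 w v - young f2 w v - (young f1 w u - young f2 w u) - (f1 u - f2 u) * (w v - w u)
  = (young f1 w v - young f1 w u - f1 u * (w v - w u)) -
    (young f2 w v - young f2 w u - f2 u * (w v - w u)) by ring.
apply: le_trans (ler_normB _ _) _.
rewrite -mulrA mulrDl mul1r; apply: lerD; exact: (young_est b g A B T).
Qed.

Lemma youngB_r (f w1 w2 : R -> R) : hold b A 0 T f -> hold g B 0 T w1 -> hold g B 0 T w2 ->
  forall t, 0 <= t <= T -> young f (fun s => w1 s - w2 s) t = young f w1 t - young f w2 t.
Proof.
move=> hf h1 h2 t tT; symmetry.
have BB : 0 <= B + B by exact: addr_ge0.
apply: (young_uniq b g A (B + B) T f _ b0 g0 bg A0 BB hf (holdB _ _ _ _ _ _ _ h1 h2)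
  (fun t => young f w1 t - young f w2 t) (2 * (Cyoung b g * A * B))) => //.
- by rewrite !young0 subrr.
- by rewrite !mulr_ge0 // Cyoung_ge0.
move=> u v u0 uv vT vu1.
have -> : young f w1 v - young f w2 v - (young f w1 u - young f w2 u) - f u * (w1 v - w2 v - (w1 u - w2 u))
  = (young f w1 v - young f w1 u - f u * (w1 v - w1 u)) -
    (young f w2 v - young f w2 u - f u * (w2 v - w2 u)) by ring.
apply: le_trans (ler_normB _ _) _.
rewrite -mulrA mulrDl mul1r; apply: lerD; exact: (young_est b g A B T).
Qed.

(** The dyadic grid is not invariant under the shift by S, but the local expansion is, so uniqueness
    replaces a comparison of sums. *)
Lemma young_shift (f w : R -> R) (S : R) : hold b A 0 T f -> hold g B 0 T w -> 0 <= S ->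
  forall t, 0 <= t <= T - S ->
  young (fun s => f (S + s)) (fun s => w (S + s) - w S) t = young f w (S + t) - young f w S.
Proof.
move=> hf hw S0 t tT; symmetry.
have hfs : hold b A 0 (T - S) (fun s => f (S + s)).
  by apply: hold_sub (hold_shift _ _ _ _ S _ hf); lra.
apply: (young_uniq b g A B (T - S) _ _ b0 g0 bg A0 B0 hfs (hold_theta _ _ _ _ _ hw S0)
  (fun t => young f w (S + t) - young f w S) (Cyoung b g * A * B)) => //.
- by rewrite addr0 subrr.
- by rewrite !mulr_ge0 // Cyoung_ge0.
move=> u v u0 uv vT vu1.
have -> : young f w (S + v) - young f w S - (young f w (S + u) - young f w S) -
   f (S + u) * (w (S + v) - w S - (w (S + u) - w S))
  = (young f w (S + v) - young f w (S + u) - f (S + u) * (w (S + v) - w (S + u))) by ring.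
have -> : v - u = (S + v) - (S + u) by ring.
apply: (young_est b g A B T) => //; lra.
Qed.

End Laws.
End Young.

(* Power terms slow lra down and are irrelevant to most side conditions. *)
Ltac lin := repeat match goal with H : context [powR _ _] |- _ => clear H end; lra.

Ltac nneg := repeat first [by [] | apply: mulr_ge0 | apply: addr_ge0
  | apply: powR_ge0 | apply: exprn_ge0 | by rewrite invr_ge0; nneg | by lin].

Lemma ler_normD5 (R : realType) (x1 x2 x3 x4 x5 y1 y2 y3 y4 y5 : R) :
  `|x1| <= y1 -> `|x2| <= y2 -> `|x3| <= y3 -> `|x4| <= y4 -> `|x5| <= y5 ->
  `|x1 + (x2 + x3 + x4 + x5)| <= y1 + (y2 + y3 + y4 + y5).
Proof. rewrite !ler_norml => *; lra. Qed.

(** * Componentwise Hoelder balls *)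

Section HolderVec.
Variables (R : realType) (d : nat) (b : R).
Hypothesis b0 : 0 < b.
Implicit Types (X Y : R -> vec R d) (K : R).

(** A ball of the b-Hoelder norm without suprema: one constant bounds the values and the increments
    of each component. *)
Definition bd (K a c : R) X : Prop := forall i,
  (forall t, a <= t <= c -> `|X t ord0 i| <= K) /\ hold R b K a c (fun t => X t ord0 i).

Lemma bd_le K K' a c X : K <= K' -> bd K a c X -> bd K' a c X.
Proof.
move=> KK H i; have [h1 h2] := H i; split; last exact: hold_le h2.
by move=> t /h1 /le_trans; apply.
Qed.

Lemma bd_sub K a c a' c' X : a <= a' -> c' <= c -> bd K a c X -> bd K a' c' X.
Proof.
move=> aa cc H i; have [h1 h2] := H i; split; last exact: hold_sub h2.
move=> t tt; apply: h1; lra.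
Qed.

Lemma bd_eq K a c X Y : (forall t, a <= t <= c -> X t = Y t) -> bd K a c X -> bd K a c Y.
Proof.
move=> E H i; have [h1 h2] := H i; split; first by move=> t tt; rewrite -E // h1.
by apply: hold_eq h2 => t tt; rewrite E.
Qed.

Lemma bdB K K' a c X Y : bd K a c X -> bd K' a c Y -> bd (K + K') a c (fun t => X t - Y t).
Proof.
move=> H H' i; have [h1 h2] := H i; have [h1' h2'] := H' i; split.
  by move=> t tt; rewrite !mxE; apply: le_trans (ler_normB _ _) _; rewrite lerD // ?h1 ?h1'.
by apply: (hold_eq _ _ _ _ _ _ _ _ (holdB _ _ _ _ _ _ _ _ h2 h2')) => t _; rewrite !mxE.
Qed.

Lemma bd_sym K a c X Y : bd K a c (fun t => X t - Y t) -> bd K a c (fun t => Y t - X t).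
Proof.
move=> H i; have [h1 h2] := H i; split.
  by move=> t tt; have := h1 t tt; rewrite !mxE distrC.
move=> s t as_ st tc; have := h2 s t as_ st tc; rewrite !mxE => /(le_trans _); apply.
by rewrite -normrN le_eqVlt; apply/orP; left; apply/eqP; congr (Num.norm _); ring.
Qed.

Lemma bd_seg K a c S X : bd K a c X -> bd K (a - S) (c - S) (seg R X S).
Proof.
move=> H i; have [h1 h2] := H i; split; last exact: (hold_shift _ _ _ _ _ S _ h2).
by move=> t tt; apply: h1; lra.
Qed.

Lemma bd_lim K M q a c X : 0 <= q -> q < 1 -> (forall n, bd (K + M * q ^+ n) a c X) -> bd K a c X.
Proof.
move=> q0 q1 H i; split.
  move=> t tt; apply: (ler_geo R q M) => // n; have [h1 _] := H n i; exact: h1.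
move=> s t as_ st tc; apply: (ler_geo R q (M * (t - s) `^ b)) => // n.
by have [_ h2] := H n i; apply: le_trans (h2 _ _ as_ st tc) _; rewrite mulrDl mulrAC.
Qed.

Lemma hold_glue K1 K2 a m c (f : R -> R) : a <= m -> m <= c -> 0 <= K1 -> 0 <= K2 ->
  hold R b K1 a m f -> hold R b K2 m c f -> hold R b (K1 + K2) a c f.
Proof.
move=> am mc k1 k2 h1 h2 s t as_ st tc; have b0' := b0; rewrite mulrDl.
have p0 : 0 <= (t - s) `^ b := powR_ge0 _ _.
have q1 := mulr_ge0 k1 p0; have q2 := mulr_ge0 k2 p0.
have [tm|mt] := leP t m; first by have := h1 s t as_ st tm; lra.
have [ms|sm] := leP m s; first by have := h2 s t ms st tc; lra.
have := h1 s m as_ (ltW sm) (lexx _); have := h2 m t (lexx _) (ltW mt) tc => e2 e1.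
have -> : f t - f s = (f m - f s) + (f t - f m) by ring.
apply: le_trans (ler_normD _ _) _; apply: lerD.
  by apply: le_trans e1 _; rewrite ler_wpM2l // ler_powRr //; lra.
by apply: le_trans e2 _; rewrite ler_wpM2l // ler_powRr //; lra.
Qed.

Lemma bd_glue K1 K2 a m c X : a <= m -> m <= c -> 0 <= K1 -> 0 <= K2 ->
  bd K1 a m X -> bd K2 m c X -> bd (K1 + K2) a c X.
Proof.
move=> am mc k1 k2 H1 H2 i.
have [h1 h2] := H1 i; have [h1' h2'] := H2 i; split; last exact: hold_glue h2 h2'.
move=> t /andP[at_ tc]; have [tm|mt] := leP t m.
  by apply: le_trans (h1 t _) _; rewrite ?at_ // lerDl.
by apply: le_trans (h1' t _) _; rewrite ?(ltW mt) // lerDr.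
Qed.

End HolderVec.

(** * The delay equation driven by one fixed path *)

Section System.
Variables (R : realType) (d : nat) (r b g L : R) (F G : (R -> vec R d) -> vec R d).
Local Notation bd := (bd R d b).
Local Notation hold := (hold R).
Local Notation seg := (seg R).
Local Notation young := (young R).
Implicit Types (X Y xi eta : R -> vec R d) (w : R -> R).

(** [F] and [G] take total functions but are evaluated only on segments of Hoelder functions, so the
    conditions below are asked on these. *)
Definition reg xi := exists K, bd K (- r) 0 xi.

Definition lip_growth (Phi : (R -> vec R d) -> vec R d) : Prop :=
  (forall xi K, reg xi -> (forall th i, - r <= th <= 0 -> `|xi th ord0 i| <= K) ->
     forall i, `|Phi xi ord0 i| <= L * (1 + K)) /\
  (forall xi eta c, reg xi -> reg eta ->
     (forall th i, - r <= th <= 0 -> `|xi th ord0 i - eta th ord0 i| <= c) ->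
     forall i, `|Phi xi ord0 i - Phi eta ord0 i| <= L * c).

(* For a Frechet derivative that is bounded by L and L-Lipschitz this is the mean value
   bound on a second difference; it is what makes X |-> G (X_s) Lipschitz for Hoelder norms. *)
Definition second_diff (Phi : (R -> vec R d) -> vec R d) : Prop :=
  forall x1 x2 y1 y2 c1 c2 c3, reg x1 -> reg x2 -> reg y1 -> reg y2 ->
    (forall th i, - r <= th <= 0 ->
       `|x2 th ord0 i - x1 th ord0 i - (y2 th ord0 i - y1 th ord0 i)| <= c1) ->
    (forall th i, - r <= th <= 0 -> `|x1 th ord0 i - y1 th ord0 i| <= c2) ->
    (forall th i, - r <= th <= 0 -> `|x2 th ord0 i - y2 th ord0 i| <= c2) ->
    (forall th i, - r <= th <= 0 -> `|y2 th ord0 i - y1 th ord0 i| <= c3) ->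
    forall i, `|Phi x2 ord0 i - Phi x1 ord0 i - (Phi y2 ord0 i - Phi y1 ord0 i)|
      <= L * (c1 + c2 * c3).

Hypotheses (r0 : 0 < r) (b0 : 0 < b) (bg : b < g) (g1 : g < 1) (bg1 : 1 < b + g) (L0 : 0 <= L).
Hypotheses (HF : lip_growth F) (HG : lip_growth G) (HG2 : second_diff G).

Ltac hyps := have ? := r0; have ? := b0; have ? := bg; have ? := g1; have ? := bg1; have ? := L0.

(** The index rules out d = 0, where [bd] puts no constraint on K. *)
Lemma bd_ge0 (i : 'I_d) K a c X : a <= c -> bd K a c X -> 0 <= K.
Proof.
move=> ac H; have [h1 _] := H i; apply: le_trans (normr_ge0 _) (h1 a _).
by rewrite lexx.
Qed.

Lemma bd_seg0 K T s X : bd K (- r) T X -> 0 <= s <= T -> bd K (- r) 0 (seg X s).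
Proof.
move=> H sT; apply: bd_sub (bd_seg _ _ _ _ _ _ s _ H); lra.
Qed.

Lemma reg_seg K T s X : bd K (- r) T X -> 0 <= s <= T -> reg (seg X s).
Proof. by move=> H sT; exists K; apply: bd_seg0 H sT. Qed.

Lemma seg_diff K T X s t : bd K (- r) T X -> 0 <= s -> s <= t -> t <= T ->
  forall th i, - r <= th <= 0 -> `|seg X t th ord0 i - seg X s th ord0 i| <= K * (t - s) `^ b.
Proof.
move=> H s0 st tT th i thr; have [_ h2] := H i.
rewrite /Defs.seg (_ : t - s = t + th - (s + th)); last by ring.
by apply: h2; lra.
Qed.

Lemma int_bound Phi K T X s i : lip_growth Phi -> bd K (- r) T X -> 0 <= s <= T ->
  `|Phi (seg X s) ord0 i| <= L * (1 + K).
Proof.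
move=> [H1 _] H sT; apply: H1; first exact: reg_seg H sT.
by move=> th j thr; have [h _] := bd_seg0 _ _ _ _ H sT j; apply: h.
Qed.

Lemma int_hold Phi K T X i : lip_growth Phi -> bd K (- r) T X ->
  hold b (L * K) 0 T (fun s => Phi (seg X s) ord0 i).
Proof.
move=> [_ H2] H s t s0 st tT; rewrite -mulrA; apply: H2.
- by apply: reg_seg H _; lra.
- by apply: reg_seg H _; lra.
- exact: seg_diff.
Qed.

Lemma int_bound_diff Phi K D T X X' s i : lip_growth Phi -> bd K (- r) T X -> bd K (- r) T X' ->
  bd D (- r) T (fun t => X t - X' t) -> 0 <= s <= T ->
  `|Phi (seg X s) ord0 i - Phi (seg X' s) ord0 i| <= L * D.
Proof.
move=> [_ H2] H H' HD sT; apply: H2; [exact: reg_seg H sT|exact: reg_seg H' sT|].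
move=> th j thr; have [h _] := bd_seg0 _ _ _ _ HD sT j.
by have := h th thr; rewrite /Defs.seg !mxE.
Qed.

(** [second_diff] with c1 = D (t - s)^b, c2 = D and c3 = K (t - s)^b. The product of D and K is the
    reason why the contraction needs a bound on the solutions. *)
Lemma int_hold_diff K D T X X' i : bd K (- r) T X -> bd K (- r) T X' ->
  bd D (- r) T (fun t => X t - X' t) ->
  hold b (L * (D * (1 + K))) 0 T (fun s => G (seg X s) ord0 i - G (seg X' s) ord0 i).
Proof.
move=> H H' HD s t s0 st tT.
have sT : 0 <= s <= T by lra.
have tT' : 0 <= t <= T by lra.
have -> : L * (D * (1 + K)) * (t - s) `^ b = L * (D * (t - s) `^ b + D * (K * (t - s) `^ b)) by ring.
rewrite (_ : _ - _ - _ = G (seg X t) ord0 i - G (seg X s) ord0 i -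
   (G (seg X' t) ord0 i - G (seg X' s) ord0 i)); last by ring.
apply: HG2; try by [apply: reg_seg H _ | apply: reg_seg H' _].
- move=> th j thr.
  have := seg_diff _ _ _ _ _ HD s0 st tT th j thr.
  rewrite /Defs.seg !mxE => /(le_trans _); apply.
  by rewrite le_eqVlt; apply/orP; left; apply/eqP; congr (Num.norm _); ring.
- move=> th j thr; have [h _] := bd_seg0 _ _ _ _ HD sT j.
  by have := h th thr; rewrite /Defs.seg !mxE.
- move=> th j thr; have [h _] := bd_seg0 _ _ _ _ HD tT' j.
  by have := h th thr; rewrite /Defs.seg !mxE.
- exact: seg_diff.
Qed.

Definition inc w X t (i : 'I_d) : R :=
  young (fun s => F (seg X s) ord0 i) id t + young (fun s => G (seg X s) ord0 i) w t.

(** 3 comes from the drift, [Cyoung] from the Young remainder and 1 from the term frozen at the left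
    end. *)
Definition C0 : R := (4 + Cyoung R b g) * L.

Lemma Cy0 : 0 <= Cyoung R b g.
Proof. exact: Cyoung_ge0. Qed.

Lemma C0_ge0 : 0 <= C0.
Proof. by have := Cy0 => c0; hyps; rewrite mulr_ge0 //; lra. Qed.

Lemma hold_id T : hold 1 1 0 T id.
Proof. by move=> s t _ st _; rewrite mul1r powRr1 ?ger0_norm ?subr_ge0. Qed.

Lemma inc0 w X i : inc w X 0 i = 0.
Proof. by rewrite /inc !young0 addr0. Qed.

(** The bound is affine in K, which excludes blow-up; T <= 1 lets the exponents 1 and b + g be
    replaced by g. *)
Lemma inc_bd K W T w X i u v : bd K (- r) T X -> hold g W 0 T w -> T <= 1 -> 0 <= W ->
  0 <= u -> u <= v -> v <= T ->
  `|inc w X v i - inc w X u i| <= C0 * (1 + K) * (1 + W) * (v - u) `^ g.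
Proof.
move=> H hw T1 W0 u0 uv vT; hyps.
have c0 := Cy0.
have K0 : 0 <= K by apply: bd_ge0 H => //; lra.
have g0 : 0 < g by lra.
have LK : 0 <= L * K by rewrite mulr_ge0.
have LK1 : 0 <= L * (1 + K) by rewrite mulr_ge0 // addr_ge0.
have e1 := young_lip R b (L * K) T (L * (1 + K)) _ b0 LK (int_hold F K T X i HF H) LK1
  (fun s => int_bound F K T X s i HF H) u v u0 uv vT.
have e2 := young_est R b g (L * K) W T _ w b0 g0 bg1 LK W0 (int_hold G K T X i HG H) hw
  u u v u0 (lexx _) uv vT ltac:(lra).
have e3 : `|G (seg X u) ord0 i * (w v - w u)| <= L * (1 + K) * (W * (v - u) `^ g).
  rewrite normrM; apply: ler_pM => //; last exact: hw.
  by apply: int_bound => //; lra.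
set Pg := (v - u) `^ g in e3 *.
have vu : 0 <= v - u <= 1 by lin.
have p1 : v - u <= Pg.
  rewrite -{1}(powRr1 (_ : 0 <= v - u)); last lin.
  by apply: powR_le_exp => //; lin.
have p2 : (v - u) `^ (b + g) <= Pg by apply: powR_le_exp => //; lin.
have Pg0 : 0 <= Pg by exact: powR_ge0.
rewrite /inc.
set a1 := young _ _ _ in e1 *; set a2 := young _ _ _ in e1 *.
set a3 := young _ _ _ in e2 *; set a4 := young _ _ _ in e2 *.
have -> : a1 + a3 - (a2 + a4) = (a1 - a2) + ((a3 - a4 - G (seg X u) ord0 i * (w v - w u)) +
   G (seg X u) ord0 i * (w v - w u)) by ring.
apply: le_trans (ler_normD _ _) _; apply: le_trans (lerD (lexx _) (ler_normD _ _)) _.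
apply: le_trans (lerD e1 (lerD e2 e3)) _.
apply: (@le_trans _ _ (3 * (L * (1 + K)) * Pg + (Cyoung R b g * (L * (1 + K)) * W * Pg + L * (1 + K) * (W * Pg)))).
  apply: lerD; first by rewrite ler_wpM2l // mulr_ge0.
  apply: lerD => //.
  apply: ler_pM => //; try by nneg.
  rewrite ler_wpM2r // ler_wpM2l // ler_wpM2l //; lra.
rewrite /C0 -subr_ge0.
rewrite (_ : _ - _ = L * (1 + K) * Pg * (1 + Cyoung R b g + 3 * W)); last by ring.
nneg.
Qed.

(** The noise part splits into the difference of integrands against w and the integrand of X'
    against w - w'; each of the two is a Young remainder plus a frozen term. *)
Lemma inc_diff K W D e T w w' X X' i u v : bd K (- r) T X -> bd K (- r) T X' ->
  bd D (- r) T (fun t => X t - X' t) ->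
  hold g W 0 T w -> hold g W 0 T w' -> hold g e 0 T (fun t => w t - w' t) ->
  T <= 1 -> 0 <= W -> 0 <= e ->
  0 <= u -> u <= v -> v <= T ->
  `|inc w X v i - inc w' X' v i - (inc w X u i - inc w' X' u i)|
  <= C0 * (1 + K) * ((1 + W) * D + e) * (v - u) `^ g.
Proof.
move=> H H' HD hw hw' he T1 W0 e0 u0 uv vT; hyps.
have c0 := Cy0.
have T0 : - r <= T by lra.
have K0 := bd_ge0 i _ _ _ _ T0 H.
have D0 := bd_ge0 i _ _ _ _ T0 HD.
have g0 : 0 < g by lra.
have LK : 0 <= L * K by rewrite mulr_ge0.
have uT : 0 <= u <= T by lra.
have vT' : 0 <= v <= T by lra.
have hF := int_hold F K T X i HF H; have hF' := int_hold F K T X' i HF H'.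
have hG := int_hold G K T X i HG H; have hG' := int_hold G K T X' i HG H'.
have hGd := int_hold_diff K D T X X' i H H' HD.
have LK2 : 0 <= L * K + L * K by rewrite addr_ge0.
have LD0 : 0 <= L * D by rewrite mulr_ge0.
have LD : 0 <= L * (D * (1 + K)) by rewrite !mulr_ge0 // addr_ge0.
have e1 := young_lip R b _ T (L * D) _ b0 LK2 (holdB _ _ _ _ _ _ _ _ hF hF') LD0
  (fun s => int_bound_diff F K D T X X' s i HF H H' HD) u v u0 uv vT.
have e2 := young_est R b g (L * (D * (1 + K))) W T _ w b0 g0 bg1 LD W0 hGd hw
  u u v u0 (lexx _) uv vT ltac:(lra).
have e3 := young_est R b g (L * K) e T _ _ b0 g0 bg1 LK e0 hG' he
  u u v u0 (lexx _) uv vT ltac:(lra).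
rewrite !(youngB_l R b 1 (L * K) 1 T) // in e1; try by [lin | exact: hold_id].
rewrite !(youngB_l R b g (L * K) W T) // in e2.
rewrite !(youngB_r R b g (L * K) W T) // in e3.
set Pg := (v - u) `^ g.
have vu : 0 <= v - u <= 1 by lin.
have p1 : v - u <= Pg.
  rewrite -{1}(powRr1 (_ : 0 <= v - u)); last lin.
  by apply: powR_le_exp => //; lin.
have p2 : (v - u) `^ (b + g) <= Pg by apply: powR_le_exp => //; lin.
have Pg0 : 0 <= Pg by exact: powR_ge0.
have e4 : `|(G (seg X u) ord0 i - G (seg X' u) ord0 i) * (w v - w u)| <= L * D * (W * Pg).
  rewrite normrM; apply: ler_pM => //; last exact: hw.
  by apply: (int_bound_diff G K D T) => //; lra.
have e5 : `|G (seg X' u) ord0 i * ((w v - w' v) - (w u - w' u))| <= L * (1 + K) * (e * Pg).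
  rewrite normrM; apply: ler_pM => //; last exact: he.
  by apply: (int_bound G K T) => //; lra.
move: e1 e2 e3 e4 e5; rewrite /inc.
set a1 := young _ _ _; set a2 := young _ _ _; set a3 := young _ _ _; set a4 := young _ _ _.
set a5 := young _ _ _; set a6 := young _ _ _; set a7 := young _ _ _; set a8 := young _ _ _.
set a9 := young _ _ _; set a10 := young _ _ _.
set q1 := _ * (w v - w u); set q2 := _ * (_ - _ - (_ - _)).
move=> e1 e2 e3 e4 e5.
have -> : a1 + a5 - (a2 + a9) - (a3 + a7 - (a4 + a10)) =
  (a1 - a2 - (a3 - a4)) + ((a5 - a6 - (a7 - a8) - q1) + (a6 - a9 - (a8 - a10) - q2) + q1 + q2).
  by ring.
apply: le_trans (ler_normD5 _ _ _ _ _ _ _ _ _ _ _ e1 e2 e3 e4 e5) _.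
apply: (@le_trans _ _ (3 * (L * D) * Pg + (Cyoung R b g * (L * (D * (1 + K))) * W * Pg +
   Cyoung R b g * (L * (1 + K)) * e * Pg + L * D * (W * Pg) + L * (1 + K) * (e * Pg)))).
  apply: lerD; first by rewrite ler_wpM2l // mulr_ge0.
  apply: lerD => //; apply: lerD => //; apply: lerD.
    by rewrite ler_wpM2l //; nneg.
  apply: ler_pM => //; try by nneg.
  rewrite ler_wpM2r // ler_wpM2l // ler_wpM2l //; lra.
rewrite /C0 -subr_ge0.
rewrite (_ : _ - _ = L * Pg * (D * ((1 + Cyoung R b g) + K * (4 + Cyoung R b g) + 3 * W + 4 * K * W)
    + 3 * (1 + K) * e)); last by ring.
have := mulr_ge0 K0 W0 => KW.
nneg.
Qed.

Definition Gam w eta X (t : R) : vec R d :=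
  if t <= 0 then eta t else eta 0 + \row_i inc w X t i.

Lemma GamE w eta X t i : 0 <= t -> Gam w eta X t ord0 i = eta 0 ord0 i + inc w X t i.
Proof.
rewrite /Gam le_eqVlt => /orP[/eqP <-|t0]; first by rewrite lexx inc0 addr0.
by rewrite leNgt t0 /= !mxE.
Qed.

Lemma Gam_neg w eta X t : t <= 0 -> Gam w eta X t = eta t.
Proof. by rewrite /Gam => ->. Qed.

(** Common to the Picard map, to differences of two Picard maps and to the starting point of the
    iteration: an initial segment continued by an increment that vanishes at 0. *)
Lemma glue0 (T e kap : R) (zeta Z : R -> vec R d) (I : R -> 'I_d -> R) : 0 <= T <= 1 -> 0 <= kap ->
  bd e (- r) 0 zeta -> (forall t, t <= 0 -> Z t = zeta t) ->
  (forall t i, 0 <= t -> Z t ord0 i = zeta 0 ord0 i + I t i) -> (forall i, I 0 i = 0) ->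
  (forall u v i, 0 <= u -> u <= v -> v <= T -> `|I v i - I u i| <= kap * (v - u) `^ b) ->
  bd (e + kap) (- r) T Z.
Proof.
move=> T01 kap0 He Zn Zp I0 HI i; hyps.
have e0 : 0 <= e by apply: (bd_ge0 i _ (- r) 0 _ _ He); lra.
have [h1 h2] := He i.
split.
  move=> t /andP[t1 t2]; have [tn|tp] := leP t 0.
    rewrite Zn //; apply: le_trans (h1 t _) _; lra.
  rewrite Zp ?(ltW tp) //; apply: le_trans (ler_normD _ _) _; apply: lerD.
    by apply: h1; lra.
  have := HI 0 t i (lexx _) (ltW tp) t2; rewrite I0 !subr0 => /le_trans; apply.
  rewrite ler_piMr // (_ : 1 = 1 `^ b); last by rewrite powR1.
  by rewrite ler_powRr //; lra.
apply: (hold_glue R b b0 e kap (- r) 0 T) => //; try lra.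
  by apply: hold_eq h2 => t tt; rewrite Zn //; lra.
move=> s t s0 st tT; rewrite !Zp //; last lra.
rewrite (_ : _ - _ = I t i - I s i); last by ring.
exact: HI.
Qed.

Lemma powR_g_split T u v : 0 <= u -> u <= v -> v <= T ->
  (v - u) `^ g <= T `^ (g - b) * (v - u) `^ b.
Proof. by move=> u0 uv vT; hyps; apply: powR_split => //; lra. Qed.

Lemma Gam_bd K K0 W T w eta X : bd K (- r) T X -> bd K0 (- r) 0 eta -> hold g W 0 T w ->
  0 <= T <= 1 -> 0 <= W -> 0 <= K ->
  bd (K0 + C0 * (1 + W) * T `^ (g - b) * (1 + K)) (- r) T (Gam w eta X).
Proof.
move=> H H0 hw T01 W0 K00; hyps; have c0 := C0_ge0.
have kap0 : 0 <= C0 * (1 + W) * T `^ (g - b) * (1 + K) by nneg.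
apply: (glue0 T K0 _ eta _ (inc w X)) => //.
- by move=> t; apply: Gam_neg.
- by move=> t i; apply: GamE.
- by move=> i; apply: inc0.
move=> u v i u0 uv vT.
apply: le_trans (inc_bd K W T w X i u v H hw _ W0 u0 uv vT) _; first lra.
apply: (@le_trans _ _ (C0 * (1 + K) * (1 + W) * (T `^ (g - b) * (v - u) `^ b))).
  by rewrite ler_wpM2l ?powR_g_split //; nneg.
by rewrite le_eqVlt; apply/orP; left; apply/eqP; ring.
Qed.

Lemma Gam_diff K W D e e' T w w' eta eta' X X' : bd K (- r) T X -> bd K (- r) T X' ->
  bd D (- r) T (fun t => X t - X' t) -> bd e' (- r) 0 (fun t => eta t - eta' t) ->
  hold g W 0 T w -> hold g W 0 T w' -> hold g e 0 T (fun t => w t - w' t) ->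
  0 <= T <= 1 -> 0 <= W -> 0 <= e -> 0 <= K -> 0 <= D ->
  bd (e' + C0 * (1 + K) * ((1 + W) * D + e) * T `^ (g - b)) (- r) T
    (fun t => Gam w eta X t - Gam w' eta' X' t).
Proof.
move=> H H' HD He' hw hw' he T01 W0 e0 K0 D0; hyps; have c0 := C0_ge0.
have kap0 : 0 <= C0 * (1 + K) * ((1 + W) * D + e) * T `^ (g - b) by nneg.
apply: (glue0 T e' _ (fun t => eta t - eta' t) _ (fun t i => inc w X t i - inc w' X' t i)) => //.
- by move=> t t0; rewrite !Gam_neg.
- move=> t i t0; have := GamE w eta X t i t0; have := GamE w' eta' X' t i t0.
  rewrite !mxE => -> ->; ring.
- by move=> i; rewrite !inc0 subrr.
move=> u v i u0 uv vT.
apply: le_trans (inc_diff K W D e T w w' X X' i u v H H' HD hw hw' he _ W0 e0 u0 uv vT) _; first lra.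
apply: (@le_trans _ _ (C0 * (1 + K) * ((1 + W) * D + e) * (T `^ (g - b) * (v - u) `^ b))).
  by rewrite ler_wpM2l ?powR_g_split //; nneg.
by rewrite le_eqVlt; apply/orP; left; apply/eqP; ring.
Qed.

(** * Solutions on short intervals *)

Definition sol T w eta X : Prop :=
  (exists K, bd K (- r) T X) /\ forall t, - r <= t <= T -> X t = Gam w eta X t.

Lemma sol_init T w eta X t : sol T w eta X -> 0 <= T -> - r <= t <= 0 -> X t = eta t.
Proof. by move=> [_ H] T0 tr; hyps; rewrite H ?Gam_neg //; lra. Qed.

Lemma solE T w eta X t i : sol T w eta X -> 0 <= t <= T ->
  X t ord0 i = eta 0 ord0 i + inc w X t i.
Proof. by move=> [_ H] tT; hyps; rewrite H ?GamE //; lra. Qed.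

Lemma sol_restrict S T w eta X : S <= T -> sol T w eta X -> sol S w eta X.
Proof.
move=> ST [[K HK] H]; split; first by exists K; apply: bd_sub HK.
by move=> t tS; apply: H; lra.
Qed.

Lemma bd_norm K a c X : bd K a c X -> bd `|K| a c X.
Proof. by apply: bd_le; exact: ler_norm. Qed.

(** Applying [Gam] sends a bound K to K0 + (1 + K) / 2, whose fixed point is 2 * K0 + 1; iterating
    forgets the unknown initial bound. The admissible length depends on W but not on K0. *)
Lemma loc_bd K0 W T w eta X : 0 <= T <= 1 -> 0 <= W -> 0 <= K0 -> hold g W 0 T w ->
  C0 * (1 + W) * T `^ (g - b) <= 2^-1 -> bd K0 (- r) 0 eta -> sol T w eta X ->
  bd (2 * K0 + 1) (- r) T X.
Proof.
move=> T01 W0 K00 hw small H0 [[K1 HK1] H]; hyps; have c0 := C0_ge0.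
set K := `|K1|; have {}HK1 : bd K (- r) T X := bd_norm _ _ _ _ HK1.
have K1' : 0 <= K by exact: normr_ge0.
apply: (bd_lim R d b _ K 2^-1); try lra.
elim=> [|n IH].
  by apply: bd_le HK1; rewrite expr0 mulr1; lra.
have q0 : 0 <= K * 2^-1 ^+ n by nneg.
have KK0 : 0 <= 2 * K0 + 1 + K * 2^-1 ^+ n by nneg.
have := Gam_bd _ K0 W T w eta X IH H0 hw T01 W0 KK0.
move=> /(bd_eq _ _ _ _ _ _ _ _ (fun t tt => esym (H t tt))).
apply: bd_le.
apply: (@le_trans _ _ (K0 + 2^-1 * (1 + (2 * K0 + 1 + K * 2^-1 ^+ n)))).
  by rewrite lerD2l ler_wpM2r //; lra.
by rewrite exprS; lra.
Qed.

(** 3 * e is the fixed point of D |-> e + D / 2 + e / 2, where e measures both the initial segments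
    and the paths. *)
Lemma loc_diff K W e T w w' eta eta' X X' : 0 <= T <= 1 -> 0 <= W -> 0 <= K -> 0 <= e ->
  hold g W 0 T w -> hold g W 0 T w' -> hold g e 0 T (fun t => w t - w' t) ->
  C0 * (1 + K) * (1 + W) * T `^ (g - b) <= 2^-1 ->
  bd e (- r) 0 (fun t => eta t - eta' t) ->
  bd K (- r) T X -> bd K (- r) T X' -> sol T w eta X -> sol T w' eta' X' ->
  bd (3 * e) (- r) T (fun t => X t - X' t).
Proof.
move=> T01 W0 K0 e0 hw hw' he small He HX HX' [_ H] [_ H']; hyps; have c0 := C0_ge0.
apply: (bd_lim R d b _ (2 * K) 2^-1); try lra.
elim=> [|n IH].
  by apply: bd_le (bdB _ _ _ _ _ _ _ _ _ HX HX'); rewrite expr0 mulr1; lra.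
have q0 : 0 <= 2 * K * 2^-1 ^+ n by nneg.
have D0 : 0 <= 3 * e + 2 * K * 2^-1 ^+ n by nneg.
have := Gam_diff K W _ e e T w w' eta eta' X X' HX HX' IH He hw hw' he T01 W0 e0 K0 D0.
have E t : - r <= t <= T -> Gam w eta X t - Gam w' eta' X' t = X t - X' t.
  by move=> tt; rewrite -H // -H'.
move=> /(bd_eq _ _ _ _ _ _ _ _ E).
apply: bd_le; set D := _ + _ in D0 *.
have -> : C0 * (1 + K) * ((1 + W) * D + e) * T `^ (g - b) =
  C0 * (1 + K) * (1 + W) * T `^ (g - b) * D + C0 * (1 + K) * T `^ (g - b) * e by ring.
have s2 : C0 * (1 + K) * T `^ (g - b) <= 2^-1.
  apply: le_trans small; rewrite -subr_ge0.
  rewrite (_ : _ - _ = C0 * (1 + K) * W * T `^ (g - b)); last by ring.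
  by nneg.
have := ler_wpM2r D0 small; have := ler_wpM2r e0 s2.
by rewrite exprS /D; lra.
Qed.

Lemma cvg_row (u : nat -> vec R d) : (forall i, exists l : R, u n ord0 i @[n --> \oo] --> l) ->
  exists l : vec R d, forall i, u n ord0 i @[n --> \oo] --> l ord0 i.
Proof.
move=> /(@choice _ _ (fun i (l : R) => u n ord0 i @[n --> \oo] --> l))[l Hl].
by exists (\row_i l i) => i; rewrite mxE.
Qed.

Lemma loc_exist K0 W T w eta : 0 <= T <= 1 -> 0 <= W -> 0 <= K0 -> hold g W 0 T w ->
  C0 * (1 + (2 * K0 + 1)) * (1 + W) * T `^ (g - b) <= 2^-1 -> bd K0 (- r) 0 eta ->
  exists X, sol T w eta X.
Proof.
move=> T01 W0 K00 hw small H0; hyps; have c0 := C0_ge0.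
set K := 2 * K0 + 1 in small.
have K1 : 0 <= K by rewrite /K; lra.
have smallT : C0 * (1 + W) * T `^ (g - b) <= 2^-1.
  apply: le_trans small; rewrite -subr_ge0.
  rewrite (_ : _ - _ = C0 * K * (1 + W) * T `^ (g - b)); last by ring.
  by nneg.
(* The iteration starts from eta, continued by its value at 0. *)
pose Xn n := iter n (Gam w eta) (fun t => eta (Num.min t 0)).
have Xn_bd n : bd K (- r) T (Xn n).
  elim: n => [|n IH].
    apply: (bd_le _ _ _ (K0 + 0)); first by rewrite /K; lra.
    apply: (glue0 T K0 0 eta _ (fun _ _ => 0)) => //.
    - by move=> t t0; rewrite /Xn /= min_l.
    - by move=> t i t0; rewrite /Xn /= min_r // addr0.
    - by move=> u v i *; rewrite subrr normr0 mul0r.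
  have := Gam_bd _ K0 W T w eta _ IH H0 hw T01 W0 K1.
  apply: bd_le.
  have k1 : 0 <= 1 + K by lra.
  by have := ler_wpM2r k1 smallT; rewrite /K; lra.
have hw0 : hold g 0 0 T (fun t => w t - w t).
  by move=> s t _ _ _; rewrite !subrr normr0 mul0r.
have he0 : bd 0 (- r) 0 (fun t => eta t - eta t).
  move=> i; split; first by move=> t _; rewrite subrr mxE normr0.
  by move=> s t _ _ _; rewrite !subrr normr0 mul0r.
have Gd X X' D : 0 <= D -> bd K (- r) T X -> bd K (- r) T X' -> bd D (- r) T (fun t => X t - X' t) ->
   bd (D * 2^-1) (- r) T (fun t => Gam w eta X t - Gam w eta X' t).
  move=> D0 HX HX' HD.
  have := Gam_diff K W D 0 0 T w w eta eta X X' HX HX' HD he0 hw hw hw0 T01 W0 (lexx _) K1 D0.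
  apply: bd_le.
  have := ler_wpM2r D0 small.
  rewrite add0r addr0 (_ : C0 * (1 + K) * ((1 + W) * D) * T `^ (g - b) =
    C0 * (1 + K) * (1 + W) * T `^ (g - b) * D); [lra | ring].
have Dn n : bd (2 * K * 2^-1 ^+ n) (- r) T (fun t => Xn n.+1 t - Xn n t).
  elim: n => [|n IH].
    by apply: bd_le (bdB _ _ _ _ _ _ _ _ _ (Xn_bd 1%N) (Xn_bd 0%N)); rewrite expr0 mulr1; lra.
  by rewrite exprSr mulrA; apply: (Gd _ _ _ _ (Xn_bd n.+1) (Xn_bd n) IH); nneg.
have h20 : 0 <= 2^-1 :> R by lra.
have h21 : 2^-1 < 1 :> R by lra.
have H21 : 1 - 2^-1 = 2^-1 :> R by lra.
have Dpt n t i : - r <= t <= T -> `|Xn n.+1 t ord0 i - Xn n t ord0 i| <= 2 * K * 2^-1 ^+ n.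
  by move=> tr; have [h1 _] := Dn n i; have /= := h1 t tr; rewrite 2!mxE.
have lim t : exists l : vec R d, (- r <= t <= T) -> forall i, Xn n t ord0 i @[n --> \oo] --> l ord0 i.
  have [tr|/negP ntr] := boolP (- r <= t <= T); last by exists 0.
  have [i|l Hl] := cvg_row (fun n => Xn n t); last by exists l.
  have [[l Hl] _] := geo_cvg R 2^-1 (2 * K) (fun n => Xn n t ord0 i) h20 h21
    (fun n => Dpt n t i tr).
  by exists l.
have [X HX] := choice lim.
have near n : bd (4 * K * 2^-1 ^+ n) (- r) T (fun t => X t - Xn n t).
  move=> i; split.
    move=> t tr; rewrite !mxE.
    have [_ Hl] := geo_cvg R 2^-1 (2 * K) (fun n => Xn n t ord0 i) h20 h21
      (fun n => Dpt n t i tr).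
    have := Hl _ (HX t tr i) n; rewrite H21 => /le_trans; apply.
    by rewrite invrK; lra.
  move=> s t s1 st t1.
  have sr : - r <= s <= T by lra.
  have tr : - r <= t <= T by lra.
  have := geo_cvg R 2^-1 (2 * K * (t - s) `^ b) (fun n => Xn n t ord0 i - Xn n s ord0 i) h20 h21.
  case=> [m|_ Hl].
    have [_ h2] := Dn m i; have := h2 s t s1 st t1; rewrite !mxE.
    rewrite (_ : 2 * K * 2^-1 ^+ m * (t - s) `^ b = 2 * K * (t - s) `^ b * 2^-1 ^+ m); last by ring.
    move=> /(le_trans _); apply.
    by rewrite le_eqVlt; apply/orP; left; apply/eqP; congr (Num.norm _); ring.
  have cl : Xn m t ord0 i - Xn m s ord0 i @[m --> \oo] --> X t ord0 i - X s ord0 i.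
    by apply: cvgB; exact: HX.
  have := Hl _ cl n.
  rewrite !mxE H21 invrK (_ : 4 * K * 2^-1 ^+ n * (t - s) `^ b = 2 * K * (t - s) `^ b * 2 * 2^-1 ^+ n); last by ring.
  move=> /(le_trans _); apply.
  by rewrite le_eqVlt; apply/orP; left; apply/eqP; congr (Num.norm _); ring.
have X_bd : bd K (- r) T X.
  apply: (bd_lim R d b K (4 * K) 2^-1) => // n.
  have := bdB _ _ _ _ _ _ _ _ _ (Xn_bd n) (bd_sym _ _ _ _ _ _ _ _ (near n)).
  by apply: bd_eq => t _; rewrite opprB addrC subrK.
exists X; split; first by exists K.
move=> t tr; apply/rowP => i; apply/eqP; rewrite -subr_eq0 -normr_le0.
(* X and [Gam w eta X] are both within 2 * K * 2^-1 ^+ n of the iterate [Xn n.+1]. *)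
apply: (ler_geo R 2^-1 (4 * K)) => // n; rewrite add0r.
have k4 : 0 <= 4 * K * 2^-1 ^+ n by nneg.
have [e1 _] := Gd X (Xn n) _ k4 X_bd (Xn_bd n) (near n) i.
have [e2 _] := near n.+1 i.
have := e1 t tr; have := e2 t tr.
rewrite !mxE -[Xn n.+1]/(Gam w eta (Xn n)) exprSr mulrA !ler_norml => E1 E2; lra.
Qed.

(** * Shifting and concatenating solutions *)

Definition th (S : R) w : R -> R := fun s => w (S + s) - w S.

(** At distance 0 the Lipschitz bound says that Phi sees a function only through its values on
    [- r, 0]. *)
Lemma lip_ext Phi xi eta : lip_growth Phi -> reg xi -> reg eta ->
  (forall t, - r <= t <= 0 -> xi t = eta t) -> Phi xi = Phi eta.
Proof.
move=> [_ H] hx he E; apply/rowP => i; apply/eqP; rewrite -subr_eq0 -normr_le0.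
have := H xi eta 0 hx he _ i; rewrite mulr0; apply.
by move=> t j tr; rewrite E // subrr normr0.
Qed.

Lemma inc_ext K W T w X Y t i : bd K (- r) T X -> hold g W 0 T w -> 0 <= W ->
  (forall t, - r <= t <= T -> X t = Y t) -> 0 <= t <= T -> inc w X t i = inc w Y t i.
Proof.
move=> H hw W0 E tT; hyps.
have T0 : - r <= T by lra.
have K0 := bd_ge0 i _ _ _ _ T0 H.
have LK : 0 <= L * K by rewrite mulr_ge0.
have HY := bd_eq _ _ _ _ _ _ _ _ E H.
have S s : 0 <= s <= T -> forall t, - r <= t <= 0 -> seg X s t = seg Y s t.
  by move=> sT u ur; apply: E; lra.
rewrite /inc; congr (_ + _).
  apply: (young_ext R b 1 (L * K) 1 T) => //; try by [lra | exact: hold_id].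
    exact: int_hold.
  move=> s sT; rewrite (lip_ext F (seg X s) (seg Y s)) //; [exact: reg_seg H sT|exact: reg_seg HY sT|exact: S].
apply: (young_ext R b g (L * K) W T) => //; try by lra.
  exact: int_hold.
move=> s sT; rewrite (lip_ext G (seg X s) (seg Y s)) //; [exact: reg_seg H sT|exact: reg_seg HY sT|exact: S].
Qed.

Lemma segD X S s : seg (seg X S) s = seg X (S + s).
Proof. by apply/funext => t; rewrite /Defs.seg addrA. Qed.

Lemma inc_shift K W T w X S t i : bd K (- r) T X -> hold g W 0 T w -> 0 <= W ->
  0 <= S -> 0 <= t <= T - S -> inc (th S w) (seg X S) t i = inc w X (S + t) i - inc w X S i.
Proof.
move=> H hw W0 S0 tT; hyps.
have T0 : - r <= T by lra.
have K0 := bd_ge0 i _ _ _ _ T0 H.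
have LK : 0 <= L * K by rewrite mulr_ge0.
rewrite /inc; under eq_fun do rewrite segD.
(* Time, shifted in the manner of a path, is unchanged; this puts the drift integral into the form
   of [young_shift]. *)
have -> : id = (fun s => S + s - S) :> (R -> R) by apply/funext => s /=; ring.
have b1 : 1 < b + 1 by lra.
have g0 : 0 < g by lra.
rewrite (young_shift R b 1 (L * K) 1 T b0 ltr01 b1 LK ler01 _ id S
  (int_hold F K T X i HF H) (hold_id T) S0 t tT).
under [X in _ + young X _ _ = _]eq_fun do rewrite segD.
rewrite (young_shift R b g (L * K) W T b0 g0 bg1 LK W0 _ w S
  (int_hold G K T X i HG H) hw S0 t tT).
have -> : (fun s => S + s - S) = id :> (R -> R) by apply/funext => s /=; ring.
ring.
Qed.

Lemma sol_bd T w eta X : 0 <= T -> sol T w eta X -> exists2 K, 0 <= K & bd K (- r) T X.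
Proof. by move=> T0 [[K HK] _]; exists `|K|; [exact: normr_ge0|exact: bd_norm]. Qed.

Lemma sol_shift W T w eta X S : hold g W 0 T w -> 0 <= W -> 0 <= S <= T -> sol T w eta X ->
  sol (T - S) (th S w) (seg X S) (seg X S).
Proof.
move=> hw W0 ST HX; hyps.
have [K K0 HK] := sol_bd T w eta X ltac:(lra) HX.
split; first by exists K; apply: bd_sub (bd_seg _ _ _ _ _ _ S _ HK); lra.
move=> t tr; have [t0|t0] := leP t 0; first by rewrite Gam_neg.
apply/rowP => i; rewrite GamE ?(ltW t0) //.
rewrite (inc_shift K W T) //; try lra.
rewrite /Defs.seg addr0 !(solE T w eta X) //; try lra.
Qed.

Lemma bd_unseg K S c X : bd K (- r) c (seg X S) -> bd K (S - r) (S + c) X.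
Proof.
move=> H; have := bd_seg _ _ _ _ _ _ (- S) _ H.
have -> : seg (seg X S) (- S) = X by rewrite segD subrr; apply/funext => t; rewrite /Defs.seg add0r.
by apply: bd_sub; lra.
Qed.

Lemma sol_concat W S1 S2 w eta X Y : hold g W 0 (S1 + S2) w -> 0 <= W -> 0 <= S1 -> 0 <= S2 ->
  sol S1 w eta X -> sol S2 (th S1 w) (seg X S1) Y ->
  sol (S1 + S2) w eta (fun t => if t <= S1 then X t else Y (t - S1)).
Proof.
move=> hw W0 S10 S20 HX HY; hyps; set Z := fun t => _.
have [K1 K10 HK1] := sol_bd _ _ _ _ S10 HX.
have [K2 K20 HK2] := sol_bd _ _ _ _ S20 HY.
have ZX t : t <= S1 -> Z t = X t by rewrite /Z => ->.
(* On [- r, 0] the piece Y repeats the last segment of X, so from time S1 on the segments of Z are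
   those of Y. *)
have ZY t : - r <= t <= S2 -> Y t = seg Z S1 t.
  move=> tr; rewrite /Defs.seg /Z; have [t1|t1] := leP (S1 + t) S1.
    by rewrite (sol_init S2 (th S1 w) (seg X S1) Y) //; lra.
  by congr Y; ring.
have HZ1 : bd K1 (- r) S1 Z by apply: bd_eq HK1 => t tr; rewrite ZX //; lra.
have HZ2 : bd K2 (S1 - r) (S1 + S2) Z by apply: bd_unseg; apply: bd_eq HK2.
have HZ : bd (K1 + K2) (- r) (S1 + S2) Z.
  by apply: (bd_glue R d b b0 K1 K2 (- r) S1) => //; try lra; apply: bd_sub HZ2; lra.
have hw1 : hold g W 0 S1 w by apply: hold_sub hw; lra.
have hw2 : hold g W 0 S2 (th S1 w).
  by have := hold_theta _ _ _ _ _ _ hw S10; apply: hold_sub; lra.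
have iX t i : 0 <= t <= S1 -> inc w X t i = inc w Z t i.
  by move=> tr; apply: (inc_ext K1 W S1) => // s sr; rewrite ZX //; lra.
split; first by exists (K1 + K2).
move=> t tr; have [tS|tS] := leP t S1.
  rewrite ZX //; have [t0|t0] := leP t 0.
    by rewrite Gam_neg // (sol_init S1 w eta X) //; lra.
  apply/rowP => i; rewrite GamE ?(ltW t0) // (solE S1 w eta X) //; last lra.
  by rewrite iX //; lra.
apply/rowP => i; rewrite GamE; last lra.
have -> : Z t = Y (t - S1) by rewrite /Z leNgt tS.
rewrite (solE S2 (th S1 w) (seg X S1) Y) //; last lra.
rewrite (inc_ext K2 W S2 _ _ (seg Z S1)) //; last lra.
rewrite (inc_shift (K1 + K2) W (S1 + S2)) //; last lra.
rewrite {1}/Defs.seg addr0 (solE S1 w eta X) // ?S10 ?lexx // iX ?S10 ?lexx //.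
rewrite (_ : S1 + (t - S1) = t); ring.
Qed.

(** * From short steps to arbitrary time intervals *)

Lemma small_step (C : R) : 0 <= C -> exists2 tau : R, 0 < tau <= 1 &
  forall T, 0 <= T <= tau -> C * T `^ (g - b) <= 2^-1.
Proof.
move=> C00; hyps.
(* C + 1 instead of C allows C = 0. *)
have e0 : 0 < 2^-1 / (C + 1) by rewrite divr_gt0 //; lra.
have [tau tau1 Ht] := powR_small R (g - b) _ ltac:(lra) e0.
exists tau => // T Tt.
have h : T `^ (g - b) <= 2^-1 / (C + 1).
  by apply: le_trans Ht; apply: ler_powRr; lra.
apply: le_trans (ler_wpM2l C00 h) _.
rewrite mulrCA ler_piMr //.
by rewrite ler_pdivrMr; lra.
Qed.

Lemma steps_cover (tau T : R) : 0 < tau -> 0 <= T -> exists n : nat, T <= n%:R * tau.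
Proof.
move=> t0 T0; exists (cell R tau T).+1.
by have /andP[_ /ltW] := cellP R tau T t0 T0.
Qed.

(** Among the data tau depends on W alone, and not on the size of the initial segment, which grows
    from step to step; hence one number of steps serves all w, eta and X. *)
Lemma glob_bd W T K0 : 0 <= W -> 0 <= T -> 0 <= K0 -> exists2 K, 0 <= K &
  forall w eta X S, 0 <= S <= T -> hold g W 0 S w -> bd K0 (- r) 0 eta -> sol S w eta X ->
    bd K (- r) S X.
Proof.
move=> W0 T0 K00; hyps; have c0 := C0_ge0.
have [tau tau1 small] := small_step (C0 * (1 + W)) ltac:(by nneg).
have [n Tn] := steps_cover tau T ltac:(lra) T0.
suff [K Kp H] : exists2 K, 0 <= K &
  forall w eta X S, 0 <= S <= n%:R * tau -> hold g W 0 S w -> bd K0 (- r) 0 eta -> sol S w eta X ->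
    bd K (- r) S X.
  by exists K => // w eta X S ST; apply: H; lra.
elim: n {Tn} => [|n [K Kp IH]].
  exists K0 => // w eta X S; rewrite mul0r => S0 _ Heta HX.
  have SE : S = 0 by lra.
  rewrite SE in HX *.
  by apply: bd_eq Heta => t tr; rewrite (sol_init 0 w eta X).
(* K bounds the old part and 2 * K + 1 the new step; gluing adds them. *)
exists (K + (2 * K + 1)); first lra.
move=> w eta X S Sn hw Heta HX.
have [Sn'|Sn'] := leP S (n%:R * tau).
  by apply: (bd_le _ _ _ K); [lra | apply: IH hw Heta HX; lra].
set S1 := n%:R * tau in Sn' IH *.
have S10 : 0 <= S1 by rewrite mulr_ge0 //; lra.
have SS : S - S1 <= tau by move: Sn; rewrite -natr1 mulrDl mul1r -/S1 => ?; lra.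
have H1 : bd K (- r) S1 X.
  apply: (IH w eta); [lra|by apply: hold_sub hw; lra|by []|apply: sol_restrict HX; exact: ltW].
have HS := sol_shift W S w eta X S1 hw W0 ltac:(lra) HX.
have SS1 : 0 <= S - S1 <= 1 by lra.
have SS2 : 0 <= S - S1 <= tau by lra.
have H1s : bd K (- r) 0 (seg X S1) by apply: (bd_seg0 K S1); rewrite ?S10 ?lexx.
have H2 := loc_bd K W (S - S1) (th S1 w) (seg X S1) (seg X S1) SS1 W0 Kp
  (hold_theta _ _ _ _ _ _ hw S10) (small _ SS2) H1s HS.
apply: (bd_glue R d b b0 K (2 * K + 1) (- r) S1) => //; try lra.
by apply: bd_sub (bd_unseg _ _ _ _ H2); lra.
Qed.

(** K bounds both solutions on the whole interval, so one step length serves throughout. *)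
Lemma glob_diff W T K : 0 <= W -> 0 <= T -> 0 <= K -> exists2 C, 0 <= C &
  forall w w' eta eta' X X' e S, 0 <= e -> 0 <= S <= T ->
    hold g W 0 S w -> hold g W 0 S w' -> hold g e 0 S (fun t => w t - w' t) ->
    bd e (- r) 0 (fun t => eta t - eta' t) ->
    bd K (- r) S X -> bd K (- r) S X' -> sol S w eta X -> sol S w' eta' X' ->
    bd (C * e) (- r) S (fun t => X t - X' t).
Proof.
move=> W0 T0 K0; hyps; have c0 := C0_ge0.
have [tau tau1 small] := small_step (C0 * (1 + K) * (1 + W)) ltac:(by nneg).
have [n Tn] := steps_cover tau T ltac:(lra) T0.
suff [C Cp H] : exists2 C, 0 <= C &
  forall w w' eta eta' X X' e S, 0 <= e -> 0 <= S <= n%:R * tau ->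
    hold g W 0 S w -> hold g W 0 S w' -> hold g e 0 S (fun t => w t - w' t) ->
    bd e (- r) 0 (fun t => eta t - eta' t) ->
    bd K (- r) S X -> bd K (- r) S X' -> sol S w eta X -> sol S w' eta' X' ->
    bd (C * e) (- r) S (fun t => X t - X' t).
  by exists C => // w w' eta eta' X X' e S e0 ST; apply: H => //; lra.
elim: n {Tn} => [|n [C Cp IH]].
  exists 1 => // w w' eta eta' X X' e S e0; rewrite mul0r => S0 _ _ _ Heta _ _ HX HX'.
  have SE : S = 0 by lra.
  rewrite SE in HX HX' *; rewrite mul1r.
  by apply: bd_eq Heta => t tr; rewrite (sol_init 0 w eta X) // (sol_init 0 w' eta' X').
(* When the last step begins, the segments differ by C * e and the paths by e, both at most (C + 1)
   * e; [loc_diff] triples this and gluing adds C * e. *)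
exists (C + 3 * (C + 1)); first lra.
move=> w w' eta eta' X X' e S e0 Sn hw hw' he Heta HK HK' HX HX'.
have Ce := mulr_ge0 Cp e0.
have [Sn'|Sn'] := leP S (n%:R * tau).
  apply: (bd_le _ _ _ (C * e)); last by apply: (IH w w' eta eta') => //; lra.
  by rewrite mulrDl lerDl; nneg.
set S1 := n%:R * tau in Sn' IH *.
have S10 : 0 <= S1 by rewrite mulr_ge0 //; lra.
have SS : S - S1 <= tau by move: Sn; rewrite -natr1 mulrDl mul1r -/S1 => ?; lra.
have S1S := ltW Sn'.
have H1 : bd (C * e) (- r) S1 (fun t => X t - X' t).
  apply: (IH w w' eta eta') => //; try by [lin | exact: hold_sub hw | exact: hold_sub hw' |
    exact: hold_sub he | exact: bd_sub HK | exact: bd_sub HK' | exact: sol_restrict HX |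
    exact: sol_restrict HX'].
have HS := sol_shift W S w eta X S1 hw W0 ltac:(lra) HX.
have HS' := sol_shift W S w' eta' X' S1 hw' W0 ltac:(lra) HX'.
have e1 : 0 <= (C + 1) * e by nneg.
have he' : hold g ((C + 1) * e) 0 (S - S1) (fun t => th S1 w t - th S1 w' t).
  apply: (hold_le _ _ e); first by rewrite mulrDl mul1r; lra.
  apply: hold_eq (hold_theta _ _ _ _ _ _ he S10) => t _.
  by rewrite /th; ring.
have SS1 : 0 <= S - S1 <= 1 by lra.
have SS2 : 0 <= S - S1 <= tau by lra.
have H2 := loc_diff K W ((C + 1) * e) (S - S1) (th S1 w) (th S1 w') (seg X S1) (seg X' S1)
  (seg X S1) (seg X' S1) SS1 W0 K0 e1
  (hold_theta _ _ _ _ _ _ hw S10) (hold_theta _ _ _ _ _ _ hw' S10) he' (small _ SS2).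
have {}H2 : bd (3 * ((C + 1) * e)) (- r) (S - S1) (seg (fun t => X t - X' t) S1).
  apply: H2 => //.
  - apply: (bd_le _ _ _ (C * e)); first by rewrite mulrDl mul1r; lra.
    by apply: (bd_seg0 _ _ S1 _ H1); rewrite S10 lexx.
  - by apply: bd_sub (bd_seg _ _ _ _ _ _ S1 _ HK); lra.
  - by apply: bd_sub (bd_seg _ _ _ _ _ _ S1 _ HK'); lra.
rewrite mulrDl -[3 * (C + 1) * e]mulrA.
apply: (bd_glue R d b b0 (C * e) _ (- r) S1) => //; try by [lin | nneg].
by apply: bd_sub (bd_unseg _ _ _ _ H2); lra.
Qed.

Lemma sol_uniq W T w eta eta' X X' : 0 <= W -> 0 <= T -> hold g W 0 T w ->
  (forall t, - r <= t <= 0 -> eta t = eta' t) ->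
  sol T w eta X -> sol T w eta' X' -> forall t, - r <= t <= T -> X t = X' t.
Proof.
move=> W0 T0 hw E HX HX' t tr.
have [K1 K10 HK1] := sol_bd _ _ _ _ T0 HX.
have [K2 K20 HK2] := sol_bd _ _ _ _ T0 HX'.
have K0 : 0 <= K1 + K2 by exact: addr_ge0.
have [C _ H] := glob_diff W T _ W0 T0 K0.
have HD : bd (C * 0) (- r) T (fun t => X t - X' t).
  apply: (H w w eta eta') => //.
  - by rewrite T0 lexx.
  - by move=> s u _ _ _; rewrite !subrr normr0 mul0r.
  - move=> i; split; first by move=> u ur; rewrite E // subrr mxE normr0.
    by move=> s u s1 su u1; rewrite !E ?subrr ?normr0 ?mul0r //; lra.
  - by apply: bd_le HK1; lra.
  - by apply: bd_le HK2; lra.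
apply/rowP => i; apply/eqP; rewrite -subr_eq0 -normr_le0.
by have [h1 _] := HD i; have := h1 t tr; rewrite !mxE mulr0.
Qed.

(** The a priori bound is available before the solution is, so the length of the local construction
    can be fixed in advance and finitely many steps reach T. *)
Lemma glob_exist W T w eta : 0 <= W -> 0 <= T -> hold g W 0 T w -> reg eta ->
  exists X, sol T w eta X.
Proof.
move=> W0 T0 hw [K0' Heta']; hyps; have c0 := C0_ge0.
have Heta := bd_norm _ _ _ _ Heta'; set K0 := `|K0'| in Heta.
have K00 : 0 <= K0 by exact: normr_ge0.
have [K1 K10 HK] := glob_bd W T K0 W0 T0 K00.
pose K := K0 + K1.
have Kp : 0 <= K by exact: addr_ge0.
have [tau tau1 small] := small_step (C0 * (1 + (2 * K + 1)) * (1 + W)) ltac:(by nneg).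
have [n Tn] := steps_cover tau T ltac:(lra) T0.
suff H : forall S, 0 <= S <= T -> S <= n%:R * tau -> exists X, sol S w eta X.
  by apply: (H T); rewrite ?T0 ?lexx.
elim: n {Tn} => [|n IH] S ST Sn.
  apply: (loc_exist K W) => //; try lra.
  - by apply: hold_sub hw; lra.
  - by apply: small; lra.
  - by apply: bd_le Heta; rewrite /K; lra.
have [Sn'|Sn'] := leP S (n%:R * tau); first exact: IH.
set S1 := n%:R * tau in Sn' IH.
have S10 : 0 <= S1 by rewrite mulr_ge0 //; lra.
have SS : S - S1 <= tau by move: Sn; rewrite -natr1 mulrDl mul1r -/S1 => ?; lra.
have [X HX] := IH S1 ltac:(lra) (lexx _).
have hw1 : hold g W 0 S1 w by apply: hold_sub hw; lra.
have hwS : hold g W 0 S w by apply: hold_sub hw; lra.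
have HX1 : bd K (- r) S1 X.
  by apply: (bd_le _ _ _ K1); [rewrite /K; lra | apply: HK hw1 Heta HX; lra].
have SS1 : 0 <= S - S1 <= 1 by lra.
have SS2 : 0 <= S - S1 <= tau by lra.
have [|Y HY] := loc_exist K W (S - S1) (th S1 w) (seg X S1) SS1 W0 Kp
  (hold_theta _ _ _ _ _ _ hwS S10) (small _ SS2).
  by apply: (bd_seg0 _ S1); rewrite ?S10 ?lexx.
exists (fun t => if t <= S1 then X t else Y (t - S1)).
rewrite (_ : S = S1 + (S - S1)); last by ring.
apply: (sol_concat W) => //; try lra.
by rewrite addrC subrK.
Qed.

Lemma sol_eq W T w eta X Y : hold g W 0 T w -> 0 <= W -> 0 <= T ->
  (forall t, - r <= t <= T -> X t = Y t) -> sol T w eta X -> sol T w eta Y.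
Proof.
move=> hw W0 T0 E HX; hyps; have [K K0 HK] := sol_bd _ _ _ _ T0 HX.
split; first by exists K; apply: bd_eq HK.
move=> t tr; rewrite -E //; have [t0|t0] := leP t 0.
  by rewrite Gam_neg // (sol_init T w eta X) //; lra.
apply/rowP => i; rewrite GamE ?(ltW t0) // (solE T w eta X) //; last lra.
by rewrite (inc_ext K W T _ _ Y) //; lra.
Qed.

Definition good w : Prop := forall T, exists2 W, 0 <= W & hold g W 0 T w.

Lemma sol_global w eta : good w -> reg eta ->
  exists X, forall T, 0 <= T -> sol T w eta X.
Proof.
move=> gw He; hyps.
have E (n : nat) : exists X, sol n%:R w eta X.
  have [W W0 hw] := gw n%:R; apply: (glob_exist W) => //.
have [Xn HXn] := choice E.
have Xeq (m n : nat) t : (m <= n)%N -> - r <= t <= m%:R -> Xn m t = Xn n t.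
  move=> mn tm; have [W W0 hw] := gw m%:R.
  apply: (sol_uniq W m%:R w eta eta) => //.
  by apply: sol_restrict (HXn n); rewrite ler_nat.
(* The value at t is read from the solution up to the first positive integer beyond t; by uniqueness
   any longer solution gives the same value. *)
exists (fun t => Xn (Num.truncn t).+1 t) => T T0.
pose N := (Num.truncn T).+1.
have TN : T <= N%:R by apply: ltW; exact: truncnS_gt.
apply: (sol_restrict _ N%:R) => //.
have [W W0 hw] := gw N%:R.
apply: (sol_eq W _ _ _ _ _ _ _ _ _ (HXn N)) => // t tr.
have tt : - r <= t <= (Num.truncn t).+1%:R.
  by case/andP: tr => -> _ /=; apply: ltW; exact: truncnS_gt.
have [h|h] := leqP (Num.truncn t).+1 N; first by rewrite (Xeq _ N).
by rewrite (Xeq N (Num.truncn t).+1) // ltnW.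
Qed.

(** * Little Hoelder regularity and continuous dependence *)

Definition lil a c X := forall e, 0 < e -> exists2 del, 0 < del &
  forall s t i, a <= s -> s <= t -> t <= c -> t - s < del ->
    `|X t ord0 i - X s ord0 i| <= e * (t - s) `^ b.

(** [inc_bd] requires a horizon of at most 1; restarting the equation at s reduces the increment
    over [s, t] to that case. *)
Lemma inc_g K W T w eta X s t i : 0 <= W -> hold g W 0 T w -> bd K (- r) T X -> sol T w eta X ->
  0 <= s -> s <= t -> t <= T -> t - s <= 1 ->
  `|X t ord0 i - X s ord0 i| <= C0 * (1 + K) * (1 + W) * (t - s) `^ g.
Proof.
move=> W0 hw HK HX s0 st tT ts1; hyps.
have HS := sol_shift W T w eta X s hw W0 ltac:(lra) HX.
have hs : hold g W 0 (t - s) (th s w).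
  by have := hold_theta _ _ _ _ _ _ hw s0; apply: hold_sub; lra.
have Hb : bd K (- r) (t - s) (seg X s).
  by apply: bd_sub (bd_seg _ _ _ _ _ _ s _ HK); lra.
have := inc_bd K W (t - s) (th s w) (seg X s) i 0 (t - s) Hb hs ts1 W0 (lexx _) ltac:(lra) (lexx _).
rewrite subr0 inc0 subr0.
have := solE _ _ _ _ (t - s) i HS ltac:(lra).
rewrite /Defs.seg addr0 (_ : s + (t - s) = t); last by ring.
by move=> ->; rewrite [X in _ -> `|X| <= _](_ : _ = inc (th s w) (seg X s) (t - s) i) //; ring.
Qed.

(** After time 0 the solution is g-Hoelder with g > b, before it eta is little Hoelder; an increment
    across 0 gets e / 2 from each side. *)
Lemma sol_lil W T w eta X : 0 <= W -> 0 <= T -> hold g W 0 T w -> lil (- r) 0 eta -> sol T w eta X ->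
  lil (- r) T X.
Proof.
move=> W0 T0 hw He HX e e0; hyps; have c0 := C0_ge0.
have [K K0 HK] := sol_bd _ _ _ _ T0 HX.
have e2 : 0 < e / 2 by lra.
have [d1 d10 H1] := He _ e2.
pose M := C0 * (1 + K) * (1 + W) + 1.
have M0 : 0 < M.
  have : 0 <= C0 * (1 + K) * (1 + W) by nneg.
  by rewrite /M; lra.
have [d2 /andP[d20 d21] H2] := powR_small R (g - b) (e / 2 / M) ltac:(lra) ltac:(by rewrite divr_gt0).
exists (Num.min d1 d2); first by rewrite lt_min d10.
have pos s t i : 0 <= s -> s <= t -> t <= T -> t - s < d2 ->
   `|X t ord0 i - X s ord0 i| <= e / 2 * (t - s) `^ b.
  move=> s0 st tT ts.
  apply: le_trans (inc_g K W T w eta X s t i W0 hw HK HX s0 st tT _) _; first lra.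
  have p : (t - s) `^ g <= d2 `^ (g - b) * (t - s) `^ b by apply: powR_split; lin.
  have pb := powR_ge0 (t - s) b.
  apply: (@le_trans _ _ (M * (e / 2 / M * (t - s) `^ b))).
    apply: ler_pM; try by [nneg | apply: powR_ge0 | rewrite /M; lra].
    by apply: le_trans p _; rewrite ler_wpM2r.
  rewrite mulrA (mulrC M) divfK // gt_eqF //.
move=> s t i s1 st tT; rewrite lt_min => /andP[ts1 ts2].
have pb := powR_ge0 (t - s) b.
have eb : e / 2 * (t - s) `^ b <= e * (t - s) `^ b by rewrite ler_wpM2r //; lra.
have [s0|s0] := leP 0 s; first by apply: le_trans (pos s t i s0 st tT ts2) _.
have [t0|t0] := leP t 0.
  rewrite !(sol_init T w eta X) //; try lin.
  by apply: le_trans (H1 s t i s1 st t0 ts1) _.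
rewrite (_ : _ - _ = (X t ord0 i - X 0 ord0 i) + (X 0 ord0 i - X s ord0 i)); last by ring.
apply: le_trans (ler_normD _ _) _.
rewrite (_ : e * _ = e / 2 * (t - s) `^ b + e / 2 * (t - s) `^ b); last by field.
apply: lerD.
  apply: le_trans (pos 0 t i (lexx _) (ltW t0) tT _) _; first lra.
  by rewrite ler_wpM2l ?ler_powRr //; lin.
rewrite !(sol_init T w eta X) //; try lin.
apply: le_trans (H1 s 0 i s1 (ltW s0) (lexx _) _) _; first lra.
by rewrite ler_wpM2l ?ler_powRr //; lin.
Qed.

Lemma lil_seg a c S X : lil a c X -> lil (a - S) (c - S) (seg X S).
Proof.
move=> H e e0; have [del d0 Hd] := H e e0; exists del => // s t i s1 st t1 ts.
have -> : t - s = (S + t) - (S + s) by ring.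
apply: Hd; lra.
Qed.

Lemma lil_sub a c a' c' X : a <= a' -> c' <= c -> lil a c X -> lil a' c' X.
Proof.
move=> aa cc H e e0; have [del d0 Hd] := H e e0; exists del => // s t i s1 st t1 ts.
apply: Hd => //; lra.
Qed.

Lemma transl_cont K T X : 0 <= K -> bd K (- r) T X -> lil (- r) T X ->
  forall e, 0 < e -> exists2 del, 0 < del & forall t t', 0 <= t <= T -> 0 <= t' <= T -> `|t - t'| < del ->
    bd e (- r) 0 (fun x => seg X t x - seg X t' x).
Proof.
move=> K0 HK HL e e0; hyps.
have [d1 d10 H1] := HL (e / 2) ltac:(lra).
have d1b : 0 < d1 `^ b by rewrite powR_gt0.
have [d2 /andP[d20 _] H2] := powR_small R b (e / (2 * K + 1) * Num.min 1 (d1 `^ b)) b0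
  ltac:(by rewrite mulr_gt0 ?lt_min ?ltr01 ?divr_gt0 //; lra).
have A : 2 * K * (e / (2 * K + 1) * Num.min 1 (d1 `^ b)) <= e * Num.min 1 (d1 `^ b).
  have m0 : 0 <= Num.min 1 (d1 `^ b) by rewrite le_min ler01 ltW.
  rewrite mulrA ler_wpM2r // mulrCA ler_piMr ?(ltW e0) //.
  rewrite ler_pdivrMr; lra.
exists d2 => // t t' tT tT' tt i.
have close x : - r <= x <= 0 -> `|X (t + x) ord0 i - X (t' + x) ord0 i| <= K * d2 `^ b.
  move=> xr; have [_ h2] := HK i.
  apply: le_trans (hold_abs _ _ _ _ _ _ (t' + x) (t + x) h2 _ _) _; try lin.
  rewrite ler_wpM2l // ler_powRr //; try lin.
  by rewrite (_ : t + x - _ = t - t'); [exact: ltW|ring].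
have kd : K * d2 `^ b <= 2 * K * (e / (2 * K + 1) * Num.min 1 (d1 `^ b)).
  apply: (@le_trans _ _ (2 * K * d2 `^ b)).
    by rewrite ler_wpM2r ?powR_ge0 //; lra.
  by rewrite ler_wpM2l //; lra.
have kd2 : 2 * K * d2 `^ b <= 2 * K * (e / (2 * K + 1) * Num.min 1 (d1 `^ b)).
  by rewrite ler_wpM2l //; lra.
have m1 : e * Num.min 1 (d1 `^ b) <= e by rewrite ler_piMr ?(ltW e0) // ge_min lexx.
have m2 : e * Num.min 1 (d1 `^ b) <= e * d1 `^ b.
  by rewrite ler_wpM2l ?(ltW e0) // ge_min lexx orbT.
split.
  by move=> x xr; rewrite !mxE /Defs.seg; apply: le_trans (close x xr) _; lra.
move=> u v u1 uv v1; rewrite !mxE /Defs.seg.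
have [vu|vu] := ltP (v - u) d1.
  have := H1 (t + u) (t + v) i ltac:(lin) ltac:(lin) ltac:(lin).
  have := H1 (t' + u) (t' + v) i ltac:(lin) ltac:(lin) ltac:(lin).
  rewrite (_ : t + v - (t + u) = v - u); last by ring.
  rewrite (_ : t' + v - (t' + u) = v - u); last by ring.
  move=> /(_ vu) e1 /(_ vu) e2.
  by move: e1 e2; rewrite !ler_norml => e1 e2; lra.
have cu := close u ltac:(lin); have cv := close v ltac:(lin).
have : d1 `^ b <= (v - u) `^ b by apply: ler_powRr; lin.
move=> /(ler_wpM2l (ltW e0)) m3.
by move: cu cv; rewrite !ler_norml => cu cv; lra.
Qed.

(** The change of time is made on the unperturbed solution by [transl_cont], the change of data at
    the fixed time t' by [glob_diff]. *)
Lemma flow_cont w eta X t : good w -> reg eta -> lil (- r) 0 eta ->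
  (forall T, 0 <= T -> sol T w eta X) -> 0 <= t ->
  forall e, 0 < e -> exists2 del, 0 < del &
  forall w' eta' X' t', (forall T, 0 <= T -> sol T w' eta' X') ->
    0 <= t' -> `|t - t'| < del -> hold g del 0 (t + 1) (fun s => w s - w' s) ->
    bd del (- r) 0 (fun s => eta s - eta' s) ->
    bd e (- r) 0 (fun s => seg X t s - seg X' t' s).
Proof.
move=> gw [K0' He'] Hl HX t0 e e0; hyps.
have He := bd_norm _ _ _ _ He'; set K0 := `|K0'| in He.
have K00 : 0 <= K0 by exact: normr_ge0.
pose T := t + 1.
have T0 : 0 <= T by rewrite /T; lra.
have [W W0 hw] := gw T.
have W1 : 0 <= W + 1 by lra.
have K01 : 0 <= K0 + 1 by lra.
(* Data within distance 1 obey the constants W + 1 and K0 + 1, and times within distance 1 stay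
   below t + 1; one a priori bound covers all neighbours. *)
have [K Kp HK] := glob_bd (W + 1) T (K0 + 1) W1 T0 K01.
have [C Cp HC] := glob_diff (W + 1) T K W1 T0 Kp.
have TT : 0 <= T <= T by lra.
have hw1 : hold g (W + 1) 0 T w by apply: hold_le hw; lra.
have HKX : bd K (- r) T X.
  apply: (HK w eta) => //; [by apply: bd_le He; lra | exact: HX].
have LX := sol_lil W T w eta X W0 T0 hw Hl (HX T T0).
have [d1 d10 H1] := transl_cont K T X Kp HKX LX (e / 2) ltac:(lra).
pose del := Num.min (Num.min 1 d1) (e / 2 / (C + 1)).
have del0 : 0 < del by rewrite /del !lt_min ltr01 d10 divr_gt0 //; lra.
have del1 : del <= 1 by rewrite /del !ge_min lexx.
have del2 : del <= d1 by rewrite /del !ge_min lexx orbT.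
have del3 : C * del <= e / 2.
  have : del <= e / 2 / (C + 1) by rewrite /del ge_min lexx orbT.
  rewrite ler_pdivlMr; last lra.
  by move=> ?; lra.
exists del => // w' eta' X' t' HX' t'0 tt hd hb.
have hw' : hold g (W + 1) 0 T w'.
  have := holdB _ _ _ _ _ _ _ _ hw hd.
  have E x : 0 <= x <= T -> w x - (w x - w' x) = w' x by move=> _; ring.
  by move=> /(hold_eq _ _ _ _ _ _ _ E); apply: hold_le; lra.
have He2 : bd (K0 + 1) (- r) 0 eta'.
  have := bdB _ _ _ _ _ _ _ _ _ He hb.
  have E x : - r <= x <= 0 -> eta x - (eta x - eta' x) = eta' x.
    by move=> _; rewrite opprB addrC subrK.
  by move=> /(bd_eq _ _ _ _ _ _ _ _ E); apply: bd_le; lra.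
have HKX' : bd K (- r) T X' by apply: (HK w' eta') => //; exact: HX'.
have D := HC w w' eta eta' X X' del T (ltW del0) TT hw1 hw' hd hb HKX HKX' (HX T T0) (HX' T T0).
have t'T : 0 <= t' <= T by move: tt; rewrite ltr_norml /T => ?; lra.
have tT : 0 <= t <= T by rewrite /T; lra.
have B1 := H1 t t' tT t'T (lt_le_trans tt del2).
have B2 := bd_seg0 _ _ _ _ D t'T.
have := bdB _ _ _ _ _ _ _ _ _ B1 (bd_sym _ _ _ _ _ _ _ _ B2).
have E x : - r <= x <= 0 -> seg X t x - seg X t' x - (seg X' t' x - seg X t' x) =
  seg X t x - seg X' t' x by move=> _; rewrite opprB addrA subrK.
by move=> /(bd_eq _ _ _ _ _ _ _ _ E); apply: bd_le; lra.
Qed.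

End System.

(** * Iterated second differences *)

Section SecondDifferences.
Variable R : realType.
Implicit Types (f : R -> R) (h x : R).

(** Minus the usual second difference: on x |-> cos (x y) it acts as multiplication by 2 - 2 cos (h
    y), which is nonnegative. *)
Definition sdiff h f x : R := 2 * f x - f (x + h) - f (x - h).

Lemma MVT_all f df a b : a <= b -> (forall x : R, is_derive x 1 f (df x)) ->
  exists2 c, a <= c <= b & f b - f a = df c * (b - a).
Proof.
move=> ab H; have cf : {within `[a, b], continuous f}.
  apply: continuous_subspaceT => x.
  apply: differentiable_continuous; apply/derivable1_diffP.
  by have [] := H x.
have [c] := @MVT_segment R f df a b ab (fun x _ => H x) cf.
by rewrite in_itv /= => ca E; exists c.
Qed.

Lemma sdiff_bound f f1 f2 (M : R) h x : 0 <= h -> (forall y : R, is_derive y 1 f (f1 y)) ->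
  (forall y : R, is_derive y 1 f1 (f2 y)) -> (forall y : R, `|f2 y| <= M) ->
  `|sdiff h f x| <= 2 * h ^+ 2 * M.
Proof.
move=> h0 d1 d2 HM.
have [c1 c1r e1] := MVT_all f f1 (x - h) x ltac:(lra) d1.
have [c2 c2r e2] := MVT_all f f1 x (x + h) ltac:(lra) d1.
have c12 : c1 <= c2 by lra.
have [c3 _ e3] := MVT_all f1 f2 c1 c2 c12 d2.
have -> : sdiff h f x = - (f2 c3 * (c2 - c1) * h).
  rewrite -e3 /sdiff.
  have -> : 2 * f x - f (x + h) - f (x - h) = (f x - f (x - h)) - (f (x + h) - f x) by ring.
  by rewrite e1 e2; ring.
rewrite normrN !normrM (ger0_norm h0) (ger0_norm (_ : 0 <= c2 - c1)); last lra.
have M0 : 0 <= M by apply: le_trans (HM 0).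
have -> : 2 * h ^+ 2 * M = M * (2 * h) * h by ring.
rewrite ler_wpM2r // ler_pM //; lra.
Qed.

Lemma sdiff_derive f f1 h x : (forall y : R, is_derive y 1 f (f1 y)) ->
  is_derive x 1 (sdiff h f) (sdiff h f1 x).
Proof.
move=> d1.
have a1 : is_derive x 1 (fun y => f (y + h)) (f1 (x + h)).
  have := @is_derive1_comp R f (shift h) x _ _ (d1 (x + h)) (is_derive_shift x 1 h).
  by rewrite mulr1.
have a2 : is_derive x 1 (fun y => f (y - h)) (f1 (x - h)).
  have := @is_derive1_comp R f (shift (- h)) x _ _ (d1 (x - h)) (is_derive_shift x 1 (- h)).
  by rewrite mulr1.
have -> : sdiff h f = (2 \*: f) - (fun y => f (y + h)) - (fun y => f (y - h)) by apply/funext.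
exact: (is_deriveB (is_deriveB (is_deriveZ 2 (d1 x)) a1) a2).
Qed.

Variables (gs : nat -> R -> R) (M : nat -> R).
Hypothesis dgs : forall k (x : R), is_derive x 1 (gs k) (gs k.+1 x).
Hypothesis Mgs : forall k x, `|gs k x| <= M k.

Lemma iter_sdiff_derive h m k x : is_derive x 1 (iter m (sdiff h) (gs k)) (iter m (sdiff h) (gs k.+1) x).
Proof. by elim: m k x => [|m IH] k x //=; apply: sdiff_derive. Qed.

(** Each application costs two derivatives and gains a factor 2 * h ^+ 2. *)
Lemma iter_sdiff_bound h m k x : 0 <= h ->
  `|iter m (sdiff h) (gs k) x| <= (2 * h ^+ 2) ^+ m * M (k + m.*2)%N.
Proof.
move=> h0; elim: m k x => [|m IH] k x; first by rewrite expr0 mul1r addn0 Mgs.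
rewrite iterS exprS -mulrA doubleS !addnS -!addSn.
apply: (sdiff_bound _ (iter m (sdiff h) (gs k.+1)) (iter m (sdiff h) (gs k.+2))) => //.
- by move=> y; exact: iter_sdiff_derive.
- by move=> y; exact: iter_sdiff_derive.
Qed.

End SecondDifferences.

(** * Derivatives of the Gaussian are bounded *)

Section Hermite.
Variable R : realType.

(** Hermite polynomials up to the sign (-1)^k, by the recursion that makes [hg k] the k-th
    derivative of [gauss]. *)
Fixpoint herm (k : nat) : {poly R} := if k is k'.+1 then (herm k')^`() - 'X * herm k' else 1.

Definition gauss (x : R) := expR (- (2^-1 * x ^+ 2)).

Definition hg k x := (herm k).[x] * gauss x.

Lemma gauss_derive (x : R) : is_derive x 1 gauss (- x * gauss x).
Proof.
rewrite /gauss.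
have d : is_derive x 1 (fun x : R => - (2^-1 * x ^+ 2)) (- x).
  have -> : (fun x : R => - (2^-1 * x ^+ 2)) = (- 2^-1) \*: ((id : R -> R) * id).
    by apply/funext => y; rewrite -[RHS]/(- 2^-1 * (y * y)); ring.
  apply: is_derive_eq (is_deriveZ _ (is_deriveM (is_derive_id x 1) (is_derive_id x 1))) _.
  by rewrite /GRing.scale /=; field.
have := @is_derive1_comp R expR _ x _ _ (is_derive_expR _) d.
by rewrite mulrC.
Qed.

Lemma hg_derive k (x : R) : is_derive x 1 (hg k) (hg k.+1 x).
Proof.
have d1 := gauss_derive x; have d2 := is_derive_poly (herm k) x.
rewrite /hg /=.
have -> : (fun y => (herm k).[y] * gauss y) = (horner (herm k)) * gauss by [].
apply: is_derive_eq (is_deriveM d2 d1) _.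
rewrite /GRing.scale /= hornerD hornerN hornerM hornerX; ring.
Qed.

Lemma expn_le_exp (x : R) n : 0 <= x -> x ^+ n <= n`!%:R * expR x.
Proof.
move=> x0; case: n => [|n].
  by rewrite expr0 fact0 mul1r -expR0 ler_expR.
have := expR_ge1Dxn n x0.
have f0 : 0 < (n.+1)`!%:R :> R by rewrite ltr0n fact_gt0.
move=> H; have {}H : x ^+ n.+1 / (n.+1)`!%:R <= expR x by apply: le_trans H; rewrite lerDr.
by rewrite mulrC -ler_pdivrMr.
Qed.

Lemma hg_bounded k : exists M, forall x, `|hg k x| <= M.
Proof.
(* Powers are dominated by factorials times exp |x|; then |x| - x^2 / 2 <= 1 accounts for
   [expR 1]. *)
exists (\sum_(i < size (herm k)) `|(herm k)`_i| * i`!%:R * expR 1) => x.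
rewrite /hg horner_coef normrM.
rewrite (ger0_norm (expR_ge0 _)).
apply: (@le_trans _ _ ((\sum_(i < size (herm k)) `|(herm k)`_i| * i`!%:R * expR `|x|) * gauss x)).
  rewrite ler_wpM2r ?expR_ge0 //.
  apply: le_trans (ler_norm_sum _ _ _) _; apply: ler_sum => i _.
  rewrite normrM normrX -mulrA ler_wpM2l //; exact: expn_le_exp.
rewrite mulr_suml; apply: ler_sum => i _.
rewrite -mulrA ler_wpM2l ?mulr_ge0 //.
rewrite /gauss -expRD ler_expR.
have : 0 <= (`|x| - 1) ^+ 2 by exact: sqr_ge0.
rewrite -(real_normK (num_real x)); have := normr_ge0 x => ? ?; lra.
Qed.

End Hermite.

(** * A quadratic lower bound for 2 - 2 cos *)

Section CosBound.
Variable R : realType.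

Lemma sin_le_id (x : R) : 0 <= x -> `|sin x| <= x.
Proof.
move=> x0; have [c _ e] := MVT_all R sin cos 0 x x0 (fun x => is_derive_sin x).
move: e; rewrite sin0 !subr0 => ->.
by rewrite normrM (ger0_norm x0) ler_piMl // cos_max.
Qed.

Lemma cos_half (x : R) : cos x = 1 - 2 * sin (x / 2) ^+ 2.
Proof.
have {1}-> : x = (x / 2) *+ 2 by rewrite -mulr_natr divfK.
rewrite cos_mulr2n cos2sin2; ring.
Qed.

Lemma sin_ge_half (x : R) : 0 <= x <= 1 -> x / 2 <= sin x.
Proof.
move=> x01; have x0 : 0 <= x by lra.
have [c cr e] := MVT_all R sin cos 0 x x0 (fun x => is_derive_sin x).
move: e; rewrite sin0 !subr0 => ->; rewrite mulrC ler_wpM2r // cos_half.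
have c2 : 0 <= c / 2 by lra.
have : sin (c / 2) ^+ 2 <= (c / 2) ^+ 2.
  by rewrite -(real_normK (num_real (sin _))) ler_sqr ?nnegrE //; exact: sin_le_id.
have : (c / 2) ^+ 2 <= 2^-1 ^+ 2 by rewrite ler_sqr ?nnegrE //; lra.
move=> ? ?; lra.
Qed.

(** The restriction to |u| <= 1 is the reason why tails are first estimated on a bounded window. *)
Lemma cos_quad (u : R) : `|u| <= 1 -> u ^+ 2 / 4 <= 2 - 2 * cos u.
Proof.
move=> u1.
have -> : cos u = cos `|u| by have [|] := ler0P u; rewrite ?cosN.
rewrite -(real_normK (num_real u)); have := normr_ge0 u.
set v := `|u| in u1 * => v0.
rewrite cos_half.
have v2 : 0 <= v / 2 <= 1 by lra.
have H0 := sin_ge_half (v / 2) v2.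
have H : (v / 2 / 2) ^+ 2 <= sin (v / 2) ^+ 2 by rewrite ler_sqr ?nnegrE //; lra.
have -> : v ^+ 2 / 4 = 4 * (v / 2 / 2) ^+ 2 by field.
lra.
Qed.

End CosBound.

(** * Tail bounds from the characteristic function *)

Section Tail.
Variables (R : realType) (dd : measure_display) (T : measurableType dd) (P : probability T R).

Lemma bounded_integrable (f : T -> R) (M : R) : measurable_fun setT f -> (forall x, `|f x| <= M) ->
  P.-integrable setT (EFin \o f).
Proof.
move=> mf fM; apply: measurable_bounded_integrable => //; first by rewrite (le_lt_trans (probability_le1 P _)) // ltry.
exists M; split; first by rewrite num_real.
move=> y My x _ /=; apply: le_trans (fM x) _; exact: ltW.
Qed.

Lemma indic_le_int (f : T -> R) (M c : R) (A : set T) : measurable A -> measurable_fun setT f ->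
  (forall x, `|f x| <= M) -> (forall x, 0 <= f x) -> (forall x, A x -> c <= f x) -> 0 <= c ->
  (c%:E * P A <= (\int[P]_x f x)%:E)%E.
Proof.
move=> mA mf fM f0 fc c0.
have intf := bounded_integrable f M mf fM.
rewrite /Rintegral fineK; last exact: integrable_fin_num.
have -> : (c%:E * P A = \int[P]_x (c * \1_A x)%:E)%E.
  under eq_integral do rewrite EFinM.
  by rewrite ge0_integralZl_EFin // ?integral_indic // ?setIT //;
     apply/measurable_EFinP; exact: measurable_indic.
apply: ge0_le_integral => //.
- by move=> x _; rewrite lee_fin mulr_ge0.
- by apply/measurable_EFinP; apply: measurable_funM => //; exact: measurable_indic.
- by case/integrableP: intf.
move=> x _; rewrite lee_fin indicE; have [xA|xA] := boolP (x \in A).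
  by rewrite mulr1; apply: fc; rewrite inE in xA.
by rewrite mulr0.
Qed.

Variable Y : T -> R.
Hypothesis mY : measurable_fun setT Y.
Hypothesis chf : forall l, \int[P]_w cos (l * Y w) = gauss R l.

Let wgt m h w : R := (2 - 2 * cos (h * Y w)) ^+ m.

Lemma wgt_cos_meas m h x : measurable_fun setT (fun w => wgt m h w * cos (x * Y w)).
Proof.
have mc z : measurable_fun setT (fun w => cos (z * Y w)).
  apply: (measurableT_comp (f := cos)).
    by apply: continuous_measurable_fun; exact: continuous_cos.
  exact: measurable_funM.
apply: measurable_funM => //; apply: measurable_funX.
by apply: measurable_funB => //; apply: measurable_funM.
Qed.

Lemma wgt_ge0 m h w : 0 <= wgt m h w.
Proof. by rewrite exprn_ge0 //; have := cos_le1 (h * Y w); lra. Qed.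

Lemma wgt_cos_bnd m h x w : `|wgt m h w * cos (x * Y w)| <= 4 ^+ m.
Proof.
rewrite normrM -[leRHS]mulr1 ler_pM ?cos_max // normrX lerXn2r ?nnegrE //.
by have := cos_max (h * Y w); rewrite !ler_norml => ?; lra.
Qed.

Lemma wgt_cos_int m h x : P.-integrable setT (EFin \o (fun w => wgt m h w * cos (x * Y w))).
Proof. exact: (bounded_integrable _ _ (wgt_cos_meas m h x) (wgt_cos_bnd m h x)). Qed.

(* Weighting by (2 - 2 cos (h Y))^m turns the characteristic function into its iterated second
   difference, so tails of Y are bounded by derivatives of the Gaussian. *)
Lemma moment_sdiff m h x :
  \int[P]_w (wgt m h w * cos (x * Y w)) = iter m (sdiff R h) (gauss R) x.
Proof.
elim: m x => [|m IH] x.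
  by rewrite /= -chf; apply: eq_Rintegral => w _; rewrite /wgt expr0 mul1r.
rewrite iterS /sdiff -!IH.
have i1 := wgt_cos_int m h x; have i2 := wgt_cos_int m h (x + h); have i3 := wgt_cos_int m h (x - h).
have i1' : P.-integrable setT (EFin \o (fun w => 2 * (wgt m h w * cos (x * Y w)))).
  have := integrableZl (measurableT) 2 i1; apply: eq_integrable => // w _.
have i12 : P.-integrable setT (EFin \o (fun w => 2 * (wgt m h w * cos (x * Y w)) -
   wgt m h w * cos ((x + h) * Y w))).
  by have := integrableB (measurableT) i1' i2; apply: eq_integrable.
rewrite -RintegralZl // -RintegralB // -RintegralB //.
apply: eq_Rintegral => w _.
rewrite /wgt exprSr [(x + h) * _]mulrDl cosD [(x - h) * _]mulrBl cosB; ring.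
Qed.

(** On the event the weight with h = 1 / (N + 1) is at least ((h a)^2 / 4)^m, while its mean is at
    most (2 h^2)^m M. In the quotient h cancels, so the bound is uniform in N; the freedom in m
    gives decay of every polynomial order in a. *)
Lemma gauss_tail0 m M : (forall x, `|hg R m.*2 x| <= M) -> forall (a : R) (N : nat), 0 < a ->
  (P [set w | (a <= `|Y w| <= N.+1%:R)%R] <= ((8 / a ^+ 2) ^+ m * M)%:E)%E.
Proof.
move=> HM a N a0.
set A := [set w | _].
have mA : measurable A.
  have mn : measurable_fun setT (fun w => `|Y w|) by apply: measurableT_comp.
  have -> : A = setT `&` (fun w => `|Y w|) @^-1` `[a, N.+1%:R]%classic.
    by rewrite setTI; apply/seteqP; split => w; rewrite /A /= in_itv.
  exact: mn.
pose h : R := N.+1%:R^-1.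
have h0 : 0 < h by rewrite invr_gt0.
pose c : R := (((h * a) ^+ 2) / 4) ^+ m.
have c0 : 0 < c by rewrite exprn_gt0 // divr_gt0 // exprn_gt0 // mulr_gt0.
have H1 : (c%:E * P A <= (\int[P]_w (wgt m h w * cos (0 * Y w)))%:E)%E.
  apply: (indic_le_int _ _ _ _ mA (wgt_cos_meas m h 0) (wgt_cos_bnd m h 0)).
  - by move=> w; rewrite mul0r cos0 mulr1 wgt_ge0.
  - move=> w /andP[aw wN]; rewrite mul0r cos0 mulr1.
    have hY : `|h * Y w| <= 1.
      by rewrite normrM (ger0_norm (ltW h0)) mulrC ler_pdivrMr // mul1r.
    have := cos_quad R _ hY => q.
    have p1 : 0 <= (h * a) ^+ 2 / 4 by rewrite divr_ge0 // exprn_ge0 // mulr_ge0 // ltW.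
    have p2 : 0 <= 2 - 2 * cos (h * Y w) by have := cos_le1 (h * Y w); lra.
    rewrite /c /wgt lerXn2r ?nnegrE //.
    apply: le_trans q; rewrite ler_wpM2r ?invr_ge0 //.
    rewrite -(real_normK (num_real (h * Y w))) ler_sqr ?nnegrE ?mulr_ge0 ?(ltW h0) ?(ltW a0) //.
    by rewrite normrM (ger0_norm (ltW h0)) ler_wpM2l // ltW.
  - exact: ltW.
have H2 : \int[P]_w (wgt m h w * cos (0 * Y w)) <= (2 * h ^+ 2) ^+ m * M.
  rewrite moment_sdiff; apply: le_trans (ler_norm _) _.
  have -> : gauss R = hg R 0 by apply/funext => x; rewrite /hg /= hornerE mul1r.
  (* [iter_sdiff_bound] takes bounds for all derivatives; the one of order 2 m has to be the given
     M. *)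
  pose Ms k := if k == m.*2 then M else projT1 (cid (hg_bounded R k)).
  have HMs k x : `|hg R k x| <= Ms k.
    by rewrite /Ms; case: eqP => [->|_] //; case: cid.
  have := iter_sdiff_bound R (hg R) Ms (hg_derive R) HMs h m 0 0 (ltW h0).
  by rewrite add0n /Ms eqxx.
have finP : P A \is a fin_num by rewrite fin_num_measure.
move: H1; rewrite -(fineK finP) -EFinM !lee_fin => H1.
have {H1}H2 := le_trans H1 H2.
have : fine (P A) <= ((2 * h ^+ 2) ^+ m * M) / c by rewrite ler_pdivlMr // mulrC.
move=> /le_trans; apply; rewrite mulrAC.
rewrite le_eqVlt; apply/orP; left; apply/eqP; congr (_ * _).
rewrite /c -expr_div_n; congr (_ ^+ _).
field; by rewrite (gt_eqF a0) /= gt_eqF.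
Qed.

Lemma gauss_tail m M : (forall x, `|hg R m.*2 x| <= M) -> forall a : R, 0 < a ->
  (P [set w | (a <= `|Y w|)%R] <= ((8 / a ^+ 2) ^+ m * M)%:E)%E.
Proof.
move=> HM a a0.
pose A (N : nat) := [set w | a <= `|Y w| <= N.+1%:R].
have mA N : measurable (A N).
  have mn : measurable_fun setT (fun w => `|Y w|) by apply: measurableT_comp.
  have -> : A N = setT `&` (fun w => `|Y w|) @^-1` `[a, N.+1%:R]%classic.
    by rewrite setTI; apply/seteqP; split => w; rewrite /A /= in_itv.
  exact: mn.
have UA : \bigcup_N A N = [set w | a <= `|Y w|].
  apply/seteqP; split => w; first by case=> N _ /andP[].
  move=> aw; exists (Num.truncn `|Y w|) => //.
  by apply/andP; split => //; apply: ltW; exact: truncnS_gt.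
rewrite -UA.
have cv : (P \o A) n @[n --> \oo] --> P (\bigcup_N A N).
  apply: nondecreasing_cvg_mu => //; first exact: bigcupT_measurable.
  move=> n k nk; apply/subsetPset => w /andP[aw wn]; apply/andP; split => //.
  by apply: le_trans wn _; rewrite ler_nat.
rewrite -(cvg_lim _ cv) //.
apply: lime_le; first by apply/cvg_ex; eexists; exact: cv.
by apply: nearW => N; exact: gauss_tail0.
Qed.

End Tail.

(** * Dyadic increments of fractional Brownian motion *)

Section Fbm.
Variables (R : realType) (beta H : R) (P : probability (OmegaM R beta) R).
Hypotheses (fbm : is_fbm_law R beta H P) (H0 : 0 < H).

Lemma eval_meas (t : R) : measurable_fun setT (fun w : OmegaM R beta => oval w t).
Proof.
move=> _ B mB; rewrite setTI.
by apply: sub_gen_smallest; exists t, B.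
Qed.

Lemma incr_meas (s t : R) : measurable_fun setT (fun w : OmegaM R beta => oval w t - oval w s).
Proof. by apply: measurable_funB; exact: eval_meas. Qed.

Lemma fbm_incr_chf (s t l : R) :
  \int[P]_w cos (l * (oval w t - oval w s)) = expR (- (2^-1 * (l ^+ 2 * `|t - s| `^ (2 * H)))).
Proof.
(* The increment is the linear combination with coefficients - l at s and l at t. *)
pose tt (i : 'I_2) := if i == ord0 then s else t.
pose ll (i : 'I_2) := if i == ord0 then - l else l.
have [e _] := fbm 2 tt ll.
(* A nonzero exponent makes the power of 0 equal to 0 and not 1, so the covariance terms at
   coincident times lose their |t - s| part. *)
have h0 : (2 * H != 0)%R by rewrite mulf_neq0 // gt_eqF.
move: e; rewrite /Rintegral => e.
have -> : (fun w : OmegaM R beta => (cos (l * (oval w t - oval w s)))%:E) =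
  (fun w : OmegaM R beta => (cos (\sum_(k < 2) ll k * oval w (tt k)))%:E).
  apply/funext => w; congr (cos _)%:E; rewrite !big_ord_recl big_ord0 /ll /tt /=; ring.
rewrite e /=; congr expR; congr (- (_ * _)).
rewrite !big_ord_recl !big_ord0 /ll /tt /= /fbm_cov !subrr !normr0 powR0 //.
by rewrite (distrC s t); field.
Qed.

Lemma fbm_tail (s t a : R) m M : s != t -> (forall x, `|hg R m.*2 x| <= M) -> 0 < a ->
  (P [set w : OmegaM R beta | (a <= `|oval w t - oval w s|)%R] <=
   ((8 * `|t - s| `^ (2 * H) / a ^+ 2) ^+ m * M)%R%:E)%E.
Proof.
move=> st HM a0.
have ts : 0 < `|t - s| by rewrite normr_gt0 subr_eq0 eq_sym.
pose sg := `|t - s| `^ H.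
have sg0 : 0 < sg by rewrite powR_gt0.
have sg2 : `|t - s| `^ (2 * H) = sg ^+ 2.
  by rewrite /sg mulrC powRrM powR_mulrn // powR_ge0.
pose Y (w : OmegaM R beta) := (oval w t - oval w s) / sg.
have mY : measurable_fun setT Y by apply: measurable_funM => //; exact: incr_meas.
have chf l : \int[P]_w cos (l * Y w) = gauss R l.
  have := fbm_incr_chf s t (l / sg); rewrite sg2.
  have -> : 2^-1 * ((l / sg) ^+ 2 * sg ^+ 2) = 2^-1 * l ^+ 2 by field; rewrite gt_eqF.
  rewrite /gauss => <-; apply: eq_Rintegral => w _; congr cos.
  by rewrite /Y; ring.
have as0 : 0 < a / sg by rewrite divr_gt0.
have := gauss_tail R _ _ P Y mY chf m M HM (a / sg) as0.
have -> : [set w | a / sg <= `|Y w|] = [set w : OmegaM R beta | a <= `|oval w t - oval w s|].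
  apply/seteqP; split => w /=; rewrite /Y normrM (gtr0_norm (_ : 0 < sg^-1)) ?invr_gt0 //;
    by rewrite ler_pM2r ?invr_gt0.
have -> : 8 / (a / sg) ^+ 2 = 8 * `|t - s| `^ (2 * H) / a ^+ 2 => //.
rewrite sg2; field; by rewrite !gt_eqF.
Qed.

Variable g : R.
Hypotheses (g0 : 0 < g) (gH : g < H).

Definition jump (n : nat) (k : int) : set (OmegaM R beta) :=
  [set w | dy R n `^ g <= `|oval w ((k + 1)%:~R * dy R n) - oval w (k%:~R * dy R n)|].

(** Integers |k| <= 4^n times the mesh 2^-n cover [- 2^n, 2^n]: the window grows with n, so one
    sequence of events serves all compact intervals. Subtracting 4^n lets naturals index it. *)
Definition bad (n : nat) : set (OmegaM R beta) :=
  \big[setU/set0]_(j < (2 * 4 ^ n).+1) jump n (j%:Z - (4 ^ n)%:Z).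

Lemma jump_meas n k : measurable (jump n k).
Proof.
have mn : measurable_fun setT (fun w : OmegaM R beta =>
  `|oval w ((k + 1)%:~R * dy R n) - oval w (k%:~R * dy R n)|).
  by apply: measurableT_comp => //; exact: incr_meas.
have -> : jump n k = setT `&` (fun w : OmegaM R beta =>
  `|oval w ((k + 1)%:~R * dy R n) - oval w (k%:~R * dy R n)|) @^-1` `[dy R n `^ g, +oo[%classic.
  by rewrite setTI; apply/seteqP; split => w; rewrite /jump /= in_itv /= andbT.
exact: mn.
Qed.

Lemma bad_meas n : measurable (bad n).
Proof. by apply: bigsetU_measurable => j _; exact: jump_meas. Qed.

Lemma notin_bad n w (k : int) : ~ bad n w -> `|k%:~R| <= (4 ^ n)%:R :> R -> ~ jump n k w.
Proof.
move=> nb kn J; apply: nb.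
rewrite /bad -(bigcup_mkord _ (fun j : nat => jump n (j%:Z - (4 ^ n)%:Z))).
have k0 : 0 <= k + (4 ^ n)%:Z.
  by move: kn; rewrite ler_norml => /andP[]; rewrite -[(4 ^ n)%:R]/((4 ^ n)%:Z%:~R) -mulrNz ler_int => ? _; lia.
have k1 : k <= (4 ^ n)%:Z.
  by move: kn; rewrite ler_norml => /andP[_]; rewrite -[(4 ^ n)%:R]/((4 ^ n)%:Z%:~R) ler_int.
exists (absz (k + (4 ^ n)%:Z)); first by rewrite /=; lia.
by rewrite (_ : _%:Z - _ = k) //; lia.
Qed.

Lemma bad_small : exists C : R, 0 <= C /\ forall n, (P (bad n) <= (C * 2^-1 ^+ n)%:E)%E.
Proof.
pose rho : R := 2^-1 `^ (2 * (H - g)).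
have rho1 : rho < 1.
  have -> : 1 = 1 `^ (2 * (H - g)) :> R by rewrite powR1.
  by apply: gt0_ltr_powR; rewrite ?nnegrE //; have := gH; lra.
have rho0 : 0 <= rho by exact: powR_ge0.
(* At most 3 * 4^n increments are tested, each failing with probability at most (8 rho^n)^m M; rho^m
   < 1/8 makes the product of order 2^-n. *)
have [m Hm] := geo_small R rho 1 8^-1 rho0 rho1 ltac:(lra).
rewrite mul1r in Hm.
have [M HM] := hg_bounded R m.*2.
have M0 : 0 <= M by apply: le_trans (HM 0).
pose C := 3 * (8 ^+ m * M).
exists C; split; first by rewrite !mulr_ge0 // exprn_ge0.
move=> n.
have d0 := dy_gt0 R n.
have J k : (P (jump n k) <= ((8 * rho ^+ n) ^+ m * M)%:E)%E.
  have a0 : 0 < dy R n `^ g by rewrite powR_gt0.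
  have ne : k%:~R * dy R n != (k + 1)%:~R * dy R n.
    by rewrite intrD mulrDl mul1r lt_eqF // ltrDl.
  have := fbm_tail (k%:~R * dy R n) ((k + 1)%:~R * dy R n) _ m M ne HM a0.
  have -> : (k + 1)%:~R * dy R n - k%:~R * dy R n = dy R n by rewrite intrD; ring.
  rewrite (gtr0_norm d0).
  have -> : 8 * dy R n `^ (2 * H) / (dy R n `^ g) ^+ 2 = 8 * rho ^+ n => //.
  have -> : (dy R n `^ g) ^+ 2 = dy R n `^ (2 * g).
    by rewrite (mulrC 2) powRrM powR_mulrn // powR_ge0.
  rewrite -mulrA -powRB; last by rewrite (gt_eqF d0) implybT.
  rewrite /rho -powR_exprn ?invr_ge0 //; congr (_ * _ `^ _); ring.
apply: le_trans (@Boole_inequality _ R _ P (fun j : nat => jump n (j%:Z - (4 ^ n)%:Z)) _ _) _.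
  by move=> j _; exact: jump_meas.
apply: (@le_trans _ _ (\sum_(j < (2 * 4 ^ n).+1) ((8 * rho ^+ n) ^+ m * M)%:E)%E).
  by apply: lee_sum => j _; exact: J.
rewrite sumEFin lee_fin sumr_const card_ord -[leLHS]mulr_natl.
have e1 : (2 * 4 ^ n).+1%:R <= 3 * 4 ^+ n :> R.
  rewrite -natrX -natrM ler_nat; have : (0 < 4 ^ n)%N by rewrite expn_gt0.
  lia.
have p0 : 0 <= (8 * rho ^+ n) ^+ m * M by rewrite mulr_ge0 // exprn_ge0 // mulr_ge0 // exprn_ge0.
apply: le_trans (ler_wpM2r p0 e1) _.
have -> : (8 * rho ^+ n) ^+ m = 8 ^+ m * (rho ^+ m) ^+ n by rewrite exprMn -!exprM mulnC.
have -> : 3 * 4 ^+ n * (8 ^+ m * (rho ^+ m) ^+ n * M) = C * (4 * rho ^+ m) ^+ n.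
  by rewrite /C [in RHS]exprMn; ring.
rewrite ler_wpM2l //; first by rewrite !mulr_ge0 // exprn_ge0.
rewrite lerXn2r ?nnegrE ?invr_ge0 ?mulr_ge0 ?exprn_ge0 //; lra.
Qed.

Lemma bad_eventually : exists N0 : set (OmegaM R beta), [/\ measurable N0, P N0 = 0%E &
  forall w, ~ N0 w -> exists n0, forall n, (n0 <= n)%N -> ~ bad n w].
Proof.
have [C [C0 HC]] := bad_small.
exists (lim_sup_set bad); split.
- apply: bigcap_measurable => // n _; apply: bigcup_measurable => k _; exact: bad_meas.
- apply: lim_sup_set_cvg0; first exact: bad_meas.
  apply: (@le_lt_trans _ _ (2 * C)%:E); last by rewrite ltry.
  (* The series of C / 2^n is read as that of 2 C / 2^(n + 1), whose sum is 2 C. *)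
  apply: le_trans _ (epsilon_trick0 xpredT (_ : 0 <= 2 * C)); last by rewrite mulr_ge0.
  apply: lee_nneseries => [n _ _|n _]; first exact: measure_ge0.
  apply: le_trans (HC n) _; rewrite lee_fin le_eqVlt; apply/orP; left; apply/eqP.
  rewrite natrX exprS exprVn; field.
  by rewrite expf_neq0.
move=> w; rewrite /lim_sup_set => nw.
have [//|nex] := pselect (exists n0, forall n, (n0 <= n)%N -> ~ bad n w).
exfalso; apply: nw => n _.
have [//|nb] := pselect ((\bigcup_(j in [set k | (n <= k)%N]) bad j) w).
exfalso; apply: nex; exists n => k nk bk; apply: nb.
by exists k.
Qed.

End Fbm.

Lemma int_between (a c : int) : a <= c -> c < a + 2 -> c = a \/ c = a + 1.
Proof. lia. Qed.

(** * Chaining from dyadic grids to a Hoelder bound *)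

Section Chaining.
Variables (R : realType) (g : R) (w : R -> R) (n0 : nat).
Hypotheses (g0 : 0 < g) (cw : continuous w).
Hypothesis small : forall n, (n0 <= n)%N -> forall k : int, `|k%:~R| <= (4 ^ n)%:R :> R ->
  `|w ((k + 1)%:~R * dy R n) - w (k%:~R * dy R n)| <= dy R n `^ g.

Definition dfl (n : nat) (t : R) : int := Num.floor (t / dy R n).
Definition dpt (n : nat) (t : R) : R := (dfl n t)%:~R * dy R n.

Lemma dptP n t : dpt n t <= t /\ t < dpt n t + dy R n.
Proof.
have d0 := dy_gt0 R n; rewrite /dpt /dfl.
have /andP[h1 h2] := floor_itv (t / dy R n).
split; first by rewrite -ler_pdivlMr.
by move: h2; rewrite ltr_pdivrMr // intrD mulrDl mul1r.
Qed.

Let q : R := 2^-1 `^ g.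

Lemma dyg n : dy R n `^ g = q ^+ n.
Proof. by rewrite powR_exprn ?invr_ge0. Qed.

Lemma q_ge0' : 0 <= q. Proof. exact: powR_ge0. Qed.
Lemma q_lt1' : q < 1.
Proof.
have -> : 1 = 1 `^ g :> R by rewrite powR1.
apply: gt0_ltr_powR; rewrite ?nnegrE //; lra.
Qed.

(** Keeps the grid points below t within the tested window at every level n >= m. *)
Lemma dfl_bound n m (t : R) : (m <= n)%N -> `|t| + 1 <= 2 ^+ m -> `|(dfl n t)%:~R| <= (4 ^ n)%:R :> R.
Proof.
move=> mn tm; have d0 := dy_gt0 R n.
have [h1 h2] := dptP n t.
have d1 : dy R n <= 1 by rewrite exprn_ile1 //; lra.
have tn : `|t| + 1 <= 2 ^+ n.
  by apply: le_trans tm _; apply: ler_weXn2l => //; lra.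
have E : (4 ^ n)%:R * dy R n = 2 ^+ n.
  by rewrite natrX /dy -exprMn; congr (_ ^+ _); field.
suff : `|(dfl n t)%:~R| * dy R n <= (4 ^ n)%:R * dy R n by rewrite ler_pM2r.
rewrite E -{1}(gtr0_norm d0) -normrM.
change (`|dpt n t| <= 2 ^+ n).
by move: tn h1 h2; rewrite ler_norml; have := ler_norm t; have := ler_norm (- t); rewrite normrN => *; lra.
Qed.

Lemma dfl_succ n t : dfl n.+1 t = 2 * dfl n t \/ dfl n.+1 t = 2 * dfl n t + 1.
Proof.
have d0 := dy_gt0 R n.
have /andP[h1 h2] := floor_itv (t / dy R n).
have /andP[h3 h4] := floor_itv (t / dy R n.+1).
have E : t / dy R n.+1 = 2 * (t / dy R n) by rewrite dyS; field; rewrite gt_eqF.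
rewrite E in h3 h4.
set a := Num.floor _ in h1 h2; set b := Num.floor _ in h3 h4.
have -> : dfl n t = a by []. have -> : dfl n.+1 t = b by rewrite /b -E.
have l1 : 2 * a < b + 1.
  rewrite -(ltr_int R) intrM; apply: le_lt_trans h4; by rewrite ler_pM2l.
have l2 : b < 2 * (a + 1).
  rewrite -(ltr_int R) intrM; apply: le_lt_trans h3 _; by rewrite ltr_pM2l.
by apply: int_between; clear -l1 l2; lia.
Qed.

Lemma dpt_step n m t : (n0 <= n)%N -> (m <= n)%N -> `|t| + 1 <= 2 ^+ m ->
  `|w (dpt n.+1 t) - w (dpt n t)| <= q * q ^+ n.
Proof.
move=> nn mn tm.
have q0 := q_ge0'.
have E : (2 * dfl n t)%:~R * dy R n.+1 = dpt n t.
  by rewrite dyS /dpt intrM; field.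
have [e|e] := dfl_succ n t; rewrite {1}/dpt e.
  by rewrite E subrr normr0 mulr_ge0 // exprn_ge0.
rewrite -E -exprS -dyg; apply: small; first exact: leqW.
rewrite intrM.
have := dfl_bound n m t mn tm.
rewrite normrM (ger0_norm (_ : 0 <= 2%:~R)) // expnS natrM => h.
have p4 : 0 <= (4 ^ n)%:R :> R by [].
have : 2 * `|(dfl n t)%:~R| <= 2 * (4 ^ n)%:R :> R by rewrite ler_pM2l.
move=> /le_trans; apply; lra.
Qed.

Lemma dpt_cvg t : dpt n t @[n --> \oo] --> t.
Proof.
apply/cvgrPdist_le => e e0.
have [N HN] := geo_small R 2^-1 1 e ltac:(lra) ltac:(lra) e0.
exists N => // n /= Nn.
have [h1 h2] := dptP n t.
rewrite ger0_norm; last lra.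
have : dy R n <= dy R N by rewrite /dy ler_wiXn2l //; lra.
move: HN; rewrite mul1r -/(dy R N) => ? ?; lra.
Qed.

(** The steps from level n onwards form a geometric series; continuity of w identifies its limit. *)
Lemma dpt_close n m t : (n0 <= n)%N -> (m <= n)%N -> `|t| + 1 <= 2 ^+ m ->
  `|w t - w (dpt n t)| <= q / (1 - q) * dy R n `^ g.
Proof.
move=> nn mn tm.
have cv : w (dpt (n + k)%N t) @[k --> \oo] --> w t.
  apply: cvg_addl (fun k => w (dpt k t)) _ _ _.
  by apply: continuous_cvg; [exact: cw | exact: dpt_cvg].
have [k|_ H] := geo_cvg R q (q * q ^+ n) (fun k => w (dpt (n + k)%N t)) q_ge0' q_lt1'.
  rewrite -mulrA -exprD addnS; apply: (dpt_step _ m) => //.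
  - exact: leq_trans nn (leq_addr _ _).
  - exact: leq_trans mn (leq_addr _ _).
have := H _ cv 0%N; rewrite addn0 expr0 mulr1 dyg => /le_trans; apply.
by rewrite le_eqVlt; apply/orP; left; apply/eqP; ring.
Qed.

Lemma chain_close m (s t : R) : (n0 <= m)%N -> `|s| + 1 <= 2 ^+ m -> `|t| + 1 <= 2 ^+ m ->
  s <= t -> t - s < dy R m ->
  `|w t - w s| <= (2 * (q / (1 - q)) + 1) * 2 `^ g * (t - s) `^ g.
Proof.
move=> nm sm tm; rewrite le_eqVlt => /orP[/eqP <- _|st ts].
  by rewrite !subrr normr0 powR0 ?mulr0 // gt_eqF.
have ts0 : 0 < t - s by lra.
have dm1 : dy R m <= 1 by rewrite exprn_ile1 //; lra.
have [n h1 h2] := dy_between R (t - s) ltac:(lra).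
have mn : (m < n)%N.
  rewrite ltnNge; apply/negP => nm'.
  have : dy R m <= dy R n by rewrite /dy ler_wiXn2l //; lra.
  move=> ?; lra.
(* The level found has mesh at most t - s; its predecessor, still at least m, has mesh at least t -
   s. *)
case: n mn h1 h2 => // n; rewrite ltnS => mn h1 h2.
have dE : 2 * dy R n.+1 = dy R n by rewrite dyS; field.
have d0 := dy_gt0 R n.
have nn : (n0 <= n)%N by exact: leq_trans mn.
have c1 := dpt_close n m t nn mn tm.
have c2 := dpt_close n m s nn mn sm.
have [s1 s2] := dptP n s; have [t1 t2] := dptP n t.
have c3 : `|w (dpt n t) - w (dpt n s)| <= dy R n `^ g.
  have a1 : dfl n s <= dfl n t.
    by apply: le_floor; rewrite ler_pM2r ?invr_gt0 // ltW.
  have a2 : dfl n t < dfl n s + 2.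
    rewrite -(ltr_int R) intrD -(ltr_pM2r d0) mulrDl -/(dpt n t) -/(dpt n s).
    apply: le_lt_trans t1 _; rewrite dE in h2.
    have -> : 2%:~R * dy R n = dy R n + dy R n by rewrite -[2%:~R]/(2 : R); ring.
    lra.
  have := int_between _ _ a1 a2.
  rewrite /dpt => -[->|->]; first by rewrite subrr normr0 powR_ge0.
  apply: small => //; exact: dfl_bound mn sm.
have -> : w t - w s = (w t - w (dpt n t)) + (w (dpt n t) - w (dpt n s)) - (w s - w (dpt n s)) by ring.
apply: le_trans (ler_normB _ _) _; apply: le_trans (lerD (ler_normD _ _) (lexx _)) _.
apply: le_trans (lerD (lerD c1 c3) c2) _.
have -> : q / (1 - q) * dy R n `^ g + dy R n `^ g + q / (1 - q) * dy R n `^ g =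
  (2 * (q / (1 - q)) + 1) * dy R n `^ g by ring.
rewrite -[leRHS]mulrA ler_wpM2l //.
  have := q_ge0'; have := q_lt1' => ? ?.
  by rewrite addr_ge0 // mulr_ge0 // divr_ge0 //; lra.
rewrite -powRM //; last exact: ltW.
apply: ler_powRr; [exact: ltW|exact: ltW|rewrite -dE; lra].
Qed.

End Chaining.

(** * Almost sure Hoelder regularity *)

Section FbmHolder.
Variables (R : realType) (beta H : R) (P : probability (OmegaM R beta) R) (g : R).
Hypotheses (fbm : is_fbm_law R beta H P) (H0 : 0 < H) (g0 : 0 < g) (gH : g < H).

Lemma omega_holder (w : OmegaM R beta) (n0 : nat) : 0 < beta ->
  (forall n, (n0 <= n)%N -> ~ bad R beta g n w) ->
  forall N : nat, exists2 C, 0 <= C & hold R g C (- N%:R) N%:R (oval w).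
Proof.
move=> beta0 nb N.
have [w0 [cw hw]] := oprop R beta w.
have small n : (n0 <= n)%N -> forall k : int, `|k%:~R| <= (4 ^ n)%:R :> R ->
  `|oval w ((k + 1)%:~R * dy R n) - oval w (k%:~R * dy R n)| <= dy R n `^ g.
  move=> nn k kn; have := notin_bad R beta H H0 g g0 gH n w k (nb n nn) kn.
  by move=> /negP; rewrite /jump /= -ltNge => /ltW.
pose m := (n0 + N.+1)%N.
have m1 x : - N%:R <= x <= N%:R -> `|x| + 1 <= 2 ^+ m :> R.
  move=> xN; apply: (@le_trans _ _ (N.+1%:R)).
    by rewrite -natr1 lerD2r ler_norml.
  rewrite -natrX ler_nat; apply: leq_trans (ltnW (ltn_expl N.+1 (ltnSn 1))) _.
  by rewrite leq_exp2l // leq_addl.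
have [C HC] := hw (- N%:R) N%:R.
have q1 := q_lt1' R g g0; have q0 := q_ge0' R g.
set q := 2^-1 `^ g in q0 q1.
pose C1 := (2 * (q / (1 - q)) + 1) * 2 `^ g.
have C10 : 0 <= C1.
  rewrite mulr_ge0 ?powR_ge0 // addr_ge0 // mulr_ge0 // divr_ge0 //; lra.
pose C2 := `|C| * (2 * N%:R) `^ beta / dy R m `^ g.
have dg0 : 0 < dy R m `^ g by rewrite powR_gt0 // dy_gt0.
have C20 : 0 <= C2 by rewrite divr_ge0 ?(ltW dg0) // mulr_ge0 // powR_ge0.
exists (C1 + C2); first exact: addr_ge0.
move=> s t s1 st t1.
have pg : 0 <= (t - s) `^ g by exact: powR_ge0.
have [ts|ts] := ltP (t - s) (dy R m).
  apply: (@le_trans _ _ (C1 * (t - s) `^ g)); last by rewrite ler_wpM2r // lerDl.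
  apply: (chain_close R g (oval w) n0 g0 cw small m) => //; [exact: leq_addr|apply: m1; lra..].
apply: (@le_trans _ _ (C2 * (t - s) `^ g)); last by rewrite ler_wpM2r // lerDr.
have sN : - N%:R <= s <= N%:R by lra.
have tN : - N%:R <= t <= N%:R by lra.
apply: le_trans (HC s t sN tN) _.
have st0 : 0 <= t - s by lra.
rewrite (ger0_norm st0).
apply: (@le_trans _ _ (`|C| * (2 * N%:R) `^ beta)).
  apply: (@le_trans _ _ (`|C| * (t - s) `^ beta)).
    by rewrite ler_wpM2r ?powR_ge0 // ler_norm.
  by rewrite ler_wpM2l // ler_powRr ?(ltW beta0) //; lra.
have a0 : 0 <= `|C| * (2 * N%:R) `^ beta by rewrite mulr_ge0 // powR_ge0.
rewrite [leRHS](_ : _ = `|C| * (2 * N%:R) `^ beta * ((t - s) `^ g / dy R m `^ g)); last by rewrite /C2; ring.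
rewrite ler_peMr // ler_pdivlMr // mul1r; apply: ler_powRr => //; [exact: ltW | exact/ltW/dy_gt0].
Qed.

Lemma fbm_ae_holder : 0 < beta -> exists N0 : set (OmegaM R beta), [/\ measurable N0, P N0 = 0%E &
  forall w, ~ N0 w -> forall N : nat, exists2 C, 0 <= C & hold R g C (- N%:R) N%:R (oval w)].
Proof.
move=> beta0; have [N0 [m0 p0 HN]] := bad_eventually R beta H P fbm H0 g g0 gH.
exists N0; split => // w /HN [n0 Hn0]; exact: omega_holder Hn0.
Qed.

End FbmHolder.

(** * Euclidean and supremum norms against componentwise bounds *)

Section Norms.
Variables (R : realType) (d : nat).
Implicit Types (v : vec R d) (f : R -> vec R d).

(** d + 1 instead of d, so that it is at least 1 also for d = 0. *)
Definition kap : R := d.+1%:R.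

Lemma kap_ge1 : 1 <= kap. Proof. by rewrite /kap ler1n. Qed.
Lemma kap_gt0 : 0 < kap. Proof. by rewrite /kap ltr0n. Qed.

Lemma enorm_ge0 v : 0 <= enorm R v. Proof. exact: sqrtr_ge0. Qed.

Lemma enorm_comp v i : `|v ord0 i| <= enorm R v.
Proof.
rewrite /enorm -sqrtr_sqr; apply: ler_wsqrtr.
by rewrite (bigD1 i) //= lerDl sumr_ge0 // => j _; exact: sqr_ge0.
Qed.

Lemma enorm_le v (c : R) : 0 <= c -> (forall i, `|v ord0 i| <= c) -> enorm R v <= d%:R * c.
Proof.
move=> c0 H; rewrite /enorm.
have dc : 0 <= d%:R * c by rewrite mulr_ge0.
rewrite -(ger0_norm dc) -sqrtr_sqr; apply: ler_wsqrtr.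
apply: (@le_trans _ _ (\sum_(i < d) c ^+ 2)).
  by apply: ler_sum => i _; rewrite -(real_normK (num_real _)) ler_sqr ?nnegrE.
rewrite sumr_const card_ord -[leLHS]mulr_natl exprMn ler_wpM2r ?sqr_ge0 //.
by rewrite -natrX ler_nat; case: d => // n; rewrite -[leqLHS]muln1 expnS expn1 leq_mul.
Qed.

Lemma enorm_lek v (c : R) : 0 <= c -> (forall i, `|v ord0 i| <= c) -> enorm R v <= kap * c.
Proof.
move=> c0 H; apply: le_trans (enorm_le v c c0 H) _.
by rewrite ler_wpM2r // ler_nat.
Qed.

Variables (r b : R).
Hypotheses (r0 : 0 < r) (b0 : 0 < b).

Lemma zero_itv : - r <= (0 : R) <= 0.
Proof. by have := r0 => ?; lra. Qed.

Lemma supn_ge0 f : 0 <= supn R r f.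
Proof.
rewrite /supn; set A := [set _ | _ in _].
(* Without an upper bound the supremum is 0 by convention. *)
have [sA|nA] := pselect (has_sup A); last by rewrite sup_out.
have A0 : A (enorm R (f 0)) by exists 0 => //=; rewrite in_itv /= zero_itv.
apply: le_trans (enorm_ge0 (f 0)) _; apply: ub_le_sup => //.
by case: sA.
Qed.

Lemma supn_le f (c : R) : 0 <= c -> (forall th i, - r <= th <= 0 -> `|f th ord0 i| <= c) ->
  supn R r f <= kap * c.
Proof.
move=> c0 H; apply: ge_sup.
  by exists (enorm R (f 0)), 0 => //=; rewrite in_itv /= zero_itv.
move=> _ [x /= xr <-]; rewrite in_itv /= in xr.
by apply: enorm_lek => // i; apply: H.
Qed.

Lemma reg_in_Cr f : reg R d r b f -> in_Cr R r f.
Proof.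
move=> [K' /bd_norm HK]; set K := `|K'| in HK.
apply/subspace_continuousP => x /=; rewrite in_itv /= => xr.
apply/cvg_ballP => e e0.
have K0 : 0 <= K by exact: normr_ge0.
have [del /andP[d0 _] Hd] := powR_small R b (e / (K + 1)) b0 ltac:(by rewrite divr_gt0 // ltr_wpDl).
near=> y.
have yr : - r <= y <= 0.
  have : y \in `[- r, 0] by near: y; apply: withinT.
  by rewrite in_itv.
have yx : `|y - x| < del.
  near: y; apply: cvg_within; apply/nbhs_ballP; exists del => //= z.
  by rewrite /ball /= distrC.
split=> // i j; rewrite [i]ord1.
change (`|f x ord0 j - f y ord0 j| < e).
have [_ h] := HK j.
have := hold_abs R b K (- r) 0 _ y x h yr xr.
move=> /le_lt_trans; apply.
have : K * `|x - y| `^ b <= K * (e / (K + 1)).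
  rewrite ler_wpM2l //; apply: le_trans Hd; apply: ler_powRr; [exact: ltW| by []|].
  by rewrite distrC ltW.
move=> /le_lt_trans; apply.
by rewrite mulrCA -[ltRHS]mulr1 ltr_pM2l // ltr_pdivrMr ?mul1r ?ltrDl // ltr_wpDl.
Unshelve. all: by end_near.
Qed.

End Norms.

(** * From Frechet derivatives to second differences *)

Section Frechet.
Variables (R : realType) (d : nat) (r b : R).
Hypotheses (r0 : 0 < r) (b0 : 0 < b).
Local Notation reg := (reg R d r b).
Local Notation kap := (kap R d).
Implicit Types (x y v h : R -> vec R d).

Lemma bdD K K' a c x y : bd R d b K a c x -> bd R d b K' a c y ->
  bd R d b (K + K') a c (fun t => x t + y t).
Proof.
move=> H H' i; have [h1 h2] := H i; have [h1' h2'] := H' i; split.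
  by move=> t tt; rewrite !mxE; apply: le_trans (ler_normD _ _) _; rewrite lerD // ?h1 ?h1'.
move=> s t s1 st t1; rewrite !mxE mulrDl.
rewrite (_ : _ - _ = (x t ord0 i - x s ord0 i) + (y t ord0 i - y s ord0 i)); last by ring.
by apply: le_trans (ler_normD _ _) _; rewrite lerD // ?h2 ?h2'.
Qed.

Lemma bdZ K a c (l : R) x : bd R d b K a c x -> bd R d b (`|l| * K) a c (fun t => l *: x t).
Proof.
move=> H i; have [h1 h2] := H i; split.
  by move=> t tt; rewrite !mxE normrM ler_wpM2l // h1.
by move=> s t s1 st t1; rewrite !mxE -mulrBr normrM -mulrA ler_wpM2l // h2.
Qed.

Lemma regD x y : reg x -> reg y -> reg (fun t => x t + y t).
Proof. by move=> [K HK] [K' HK']; exists (K + K'); exact: bdD. Qed.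

Lemma regB x y : reg x -> reg y -> reg (fun t => x t - y t).
Proof. by move=> [K HK] [K' HK']; exists (K + K'); exact: bdB. Qed.

Lemma regZ (l : R) x : reg x -> reg (fun t => l *: x t).
Proof. by move=> [K HK]; exists (`|l| * K); exact: bdZ. Qed.

Lemma reg0 : reg (fun _ => 0).
Proof.
exists 0 => i; split; first by move=> t _; rewrite mxE normr0.
by move=> s t _ _ _; rewrite subrr normr0 mul0r.
Qed.

Lemma enormZ (l : R) (v : vec R d) : enorm R (l *: v) <= `|l| * enorm R v.
Proof.
rewrite /enorm -sqrtr_sqr -sqrtrM ?sqr_ge0 // le_eqVlt; apply/orP; left; apply/eqP.
congr Num.sqrt; rewrite mulr_sumr; apply: eq_bigr => i _.
by rewrite mxE exprMn.
Qed.

(** [opnorm] is a supremum and meaningful once it is finite, which is what M shows. The argument is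
    normalised with some c' > 0 that then decreases to c, because c may be 0. *)
Lemma op_bound (Lm : (R -> vec R d) -> vec R d) (M : R) :
  (forall (c : R) h, in_Cr R r h -> Lm (fun t => c *: h t) = c *: Lm h) ->
  (forall h, in_Cr R r h -> enorm R (Lm h) <= M * supn R r h) ->
  forall h c, reg h -> 0 <= c -> (forall th i, - r <= th <= 0 -> `|h th ord0 i| <= c) ->
  enorm R (Lm h) <= opnorm R r Lm * (kap * c).
Proof.
move=> LZ LM h c rh c0 hc.
have k0 := kap_gt0 R d.
have P c' : 0 < c' -> c <= c' -> enorm R (Lm h) <= opnorm R r Lm * (kap * c').
  move=> c'0 cc'.
  have kc : 0 < kap * c' by rewrite mulr_gt0.
  pose h' := (fun t => (kap * c')^-1 *: h t).
  have rh' : reg h' := regZ _ _ rh.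
  have s1 : supn R r h' <= 1.
    have -> : 1 = kap * kap^-1 :> R by rewrite divff // gt_eqF.
    apply: supn_le => //; first by rewrite invr_ge0 ltW.
    move=> th i thr; rewrite mxE normrM ger0_norm ?invr_ge0 ?(ltW kc) //.
    rewrite invfM -mulrA ler_piMr ?invr_ge0 ?(ltW k0) //.
    by rewrite mulrC ler_pdivrMr // mul1r (le_trans (hc _ _ thr)).
  have e1 : enorm R (Lm h') <= opnorm R r Lm.
    apply: ub_le_sup; last by exists h' => //; split => //; apply: reg_in_Cr rh'.
    exists `|M| => _ [k [ck sk] <-]; apply: le_trans (LM k ck) _.
    apply: le_trans (ler_norm _) _; rewrite normrM ler_piMr //.
    by rewrite ger0_norm // supn_ge0.
  have -> : Lm h = (kap * c') *: Lm h'.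
    rewrite -LZ; last exact: reg_in_Cr rh'.
    by congr Lm; apply/funext => x; rewrite /h' scalerA divff ?scale1r // gt_eqF.
  apply: le_trans (enormZ _ _) _.
  by rewrite (ger0_norm (ltW kc)) mulrC ler_wpM2r // ltW.
have op0 : 0 <= opnorm R r Lm.
  have c1 : 0 < c + 1 by lra.
  have := P (c + 1) c1 ltac:(lra).
  move=> /(le_trans (enorm_ge0 _ _ _)); rewrite pmulr_lge0 // mulr_gt0 //.
apply/ler_addgt0Pr => e e0.
have ok : 0 <= opnorm R r Lm * kap by rewrite mulr_ge0 // ltW.
have e'0 : 0 < e / (opnorm R r Lm * kap + 1) by rewrite divr_gt0 //; lra.
apply: le_trans (P (c + e / (opnorm R r Lm * kap + 1)) _ _) _; try lra.
rewrite mulrDr mulrDr lerD2l mulrA mulrCA ler_piMr ?(ltW e0) //.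
rewrite ler_pdivrMr; lra.
Qed.

Variables (G : (R -> vec R d) -> vec R d) (DG : (R -> vec R d) -> (R -> vec R d) -> vec R d).
Variables (L3 L4 : R).
Hypotheses (L30 : 0 < L3) (L40 : 0 < L4).
Hypothesis HD : is_frechet_deriv R r G DG.
Hypothesis HB : forall xi eta, in_Cr R r xi -> in_Cr R r eta ->
  opnorm R r (DG xi) <= L3 /\
  opnorm R r (fun h => DG xi h - DG eta h) <= L4 * supn R r (xi \- eta).

Lemma DG_bound x h c i : reg x -> reg h -> 0 <= c ->
  (forall th i, - r <= th <= 0 -> `|h th ord0 i| <= c) -> `|DG x h ord0 i| <= L3 * (kap * c).
Proof.
move=> rx rh c0 hc; have k0 := kap_gt0 R d.
have cx := reg_in_Cr _ _ _ _ b0 _ rx.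
have [_ [DZ [[M DM] _]]] := HD x cx.
apply: le_trans (enorm_comp _ _ _ i) _.
apply: le_trans (op_bound _ M DZ DM h c rh c0 hc) _.
by rewrite ler_wpM2r ?mulr_ge0 ?(ltW k0) //; have [] := HB x x cx cx.
Qed.

Lemma DG_diff x y h c2 c3 i : reg x -> reg y -> reg h -> 0 <= c2 -> 0 <= c3 ->
  (forall th i, - r <= th <= 0 -> `|x th ord0 i - y th ord0 i| <= c2) ->
  (forall th i, - r <= th <= 0 -> `|h th ord0 i| <= c3) ->
  `|DG x h ord0 i - DG y h ord0 i| <= L4 * (kap * c2) * (kap * c3).
Proof.
move=> rx ry rh c20 c30 xy hc; have k0 := kap_gt0 R d.
have cx := reg_in_Cr _ _ _ _ b0 _ rx; have cy := reg_in_Cr _ _ _ _ b0 _ ry.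
have [_ [DZ [[M DM] _]]] := HD x cx.
have [_ [DZ' [[M' DM'] _]]] := HD y cy.
pose Lm h := DG x h - DG y h.
have LZ (c : R) k : in_Cr R r k -> Lm (fun t => c *: k t) = c *: Lm k.
  by move=> ck; rewrite /Lm DZ // DZ' // scalerBr.
(* The difference of the two derivatives needs a finite bound of its own before its operator norm
   can be used. *)
have LM k : in_Cr R r k -> enorm R (Lm k) <= (kap * (`|M| + `|M'|)) * supn R r k.
  move=> ck; rewrite -mulrA; apply: enorm_lek.
    by rewrite mulr_ge0 ?supn_ge0 // addr_ge0.
  move=> j; rewrite /Lm !mxE; apply: le_trans (ler_normB _ _) _; rewrite mulrDl; apply: lerD.
    apply: le_trans (enorm_comp _ _ _ j) _; apply: le_trans (DM k ck) _.
    by rewrite ler_wpM2r ?supn_ge0 // ler_norm.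
  apply: le_trans (enorm_comp _ _ _ j) _; apply: le_trans (DM' k ck) _.
  by rewrite ler_wpM2r ?supn_ge0 // ler_norm.
have := enorm_comp _ _ (Lm h) i; rewrite /Lm !mxE => /le_trans; apply.
apply: le_trans (op_bound Lm _ LZ LM h c3 rh c30 hc) _.
rewrite ler_wpM2r ?mulr_ge0 ?(ltW k0) //.
have [_ /le_trans] := HB x y cx cy; apply.
rewrite ler_wpM2l ?(ltW L40) //; apply: supn_le => // th j thr.
by have := xy th j thr; rewrite /= !mxE.
Qed.

Lemma is_derive_eps (phi : R -> R) (u l : R) :
  (forall e, 0 < e -> exists2 del, 0 < del & forall s, `|s| < del ->
     `|phi (u + s) - phi u - s * l| <= e * `|s|) -> is_derive u 1 phi l.
Proof.
move=> H.
have cv : h^-1 *: ((phi \o shift u) (h *: (1 : R)) - phi u) @[h --> 0^'] --> l.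
  apply/cvgrPdist_le => e e0; have [del d0 Hd] := H e e0.
  near=> h.
  have h0 : h != 0 by near: h; exact: nbhs_dnbhs_neq.
  have hd : `|h| < del.
    near: h; apply: dnbhs0_lt => //.
  have := Hd h hd; rewrite /= /GRing.scale /= mulr1 (addrC h u) => E.
  have -> : l - h^-1 * (phi (u + h) - phi u) = - (h^-1 * (phi (u + h) - phi u - h * l)).
    by field.
  rewrite normrN normrM normfV mulrC ler_pdivrMr ?normr_gt0 //.
split; first by apply/cvg_ex; exists l.
by apply/cvg_lim.
Unshelve. all: by end_near.
Qed.

Let ray x v (u : R) : R -> vec R d := fun t => x t + u *: v t.

Lemma reg_ray x v (u : R) : reg x -> reg v -> reg (ray x v u).
Proof. by move=> rx rv; apply: regD => //; apply: regZ. Qed.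

Lemma ray_derive x v (u : R) i : reg x -> reg v ->
  is_derive u 1 (fun u => G (ray x v u) ord0 i) (DG (ray x v u) v ord0 i).
Proof.
move=> rx [K' Hv']; have Hv := bd_norm _ _ _ _ _ _ _ Hv'; set K := `|K'| in Hv.
have K0 : 0 <= K by exact: normr_ge0.
have rv : reg v by exists K.
have k0 := kap_gt0 R d.
have cx := reg_in_Cr _ _ _ _ b0 _ (reg_ray x v u rx rv).
have [_ [DZ [_ DE]]] := HD _ cx.
apply: is_derive_eps => e e0.
have kK : 0 <= kap * K by rewrite mulr_ge0 // ltW.
have e1 : 0 < e / (kap * K + 1) by rewrite divr_gt0 //; lra.
have [del [d0 Hd]] := DE _ e1.
exists (del / (kap * K + 1)); first by rewrite divr_gt0 //; lra.
move=> s sd.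
pose h := fun t => s *: v t.
have rh : reg h := regZ _ _ rv.
have sh : supn R r h <= kap * (`|s| * K).
  apply: supn_le => //; first by rewrite mulr_ge0.
  move=> th j thr; rewrite mxE normrM ler_wpM2l //.
  by have [h1 _] := Hv j; apply: h1.
have sh2 : supn R r h <= `|s| * (kap * K + 1).
  by apply: le_trans sh _; rewrite mulrCA ler_wpM2l // lerDl.
have sd' : supn R r h < del.
  by apply: le_lt_trans sh2 _; rewrite -ltr_pdivlMr //; lra.
have := Hd h (reg_in_Cr _ _ _ _ b0 _ rh) sd'.
have -> : (ray x v u \+ h) = ray x v (u + s).
  by apply/funext => t; rewrite /ray /h /= scalerDl addrA.
rewrite (DZ s v (reg_in_Cr _ _ _ _ b0 _ rv)) => E.
have := le_trans (enorm_comp _ _ _ i) E; rewrite !mxE => /le_trans; apply.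
apply: le_trans (ler_wpM2l (ltW e1) sh2) _.
rewrite le_eqVlt; apply/orP; left; apply/eqP; field; lra.
Qed.

(** Mean value theorem for the difference of G along the segments from x1 to x2 and from y1 to y2.
    The derivative is DG(x)(dx - dy) + (DG(x) - DG(y)) dy: the first term gives c1, the second c2 *
    c3. *)
Lemma frechet_second_diff L : L3 * kap + L4 * kap * kap <= L -> second_diff R d r b L G.
Proof.
move=> HL x1 x2 y1 y2 c1 c2 c3 rx1 rx2 ry1 ry2 H1 H2 H2' H3 i.
have k0 := kap_gt0 R d; have z0 := zero_itv R r r0.
have c10 : 0 <= c1 by apply: le_trans (H1 0 i z0).
have c20 : 0 <= c2 by apply: le_trans (H2 0 i z0).
have c30 : 0 <= c3 by apply: le_trans (H3 0 i z0).
pose dx t := x2 t - x1 t; pose dy t := y2 t - y1 t.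
have rdx : reg dx := regB _ _ rx2 rx1; have rdy : reg dy := regB _ _ ry2 ry1.
pose phi u := G (ray x1 dx u) ord0 i - G (ray y1 dy u) ord0 i.
pose dphi u := DG (ray x1 dx u) dx ord0 i - DG (ray y1 dy u) dy ord0 i.
have D (u : R) : is_derive u 1 phi (dphi u).
  by apply: is_deriveB; exact: ray_derive.
have [u u01 E] := MVT_all R phi dphi 0 1 ler01 D.
have r1 : ray x1 dx 1 = x2 by apply/funext => t; rewrite /ray /dx scale1r addrC subrK.
have r2 : ray y1 dy 1 = y2 by apply/funext => t; rewrite /ray /dy scale1r addrC subrK.
have r3 : ray x1 dx 0 = x1 by apply/funext => t; rewrite /ray scale0r addr0.
have r4 : ray y1 dy 0 = y1 by apply/funext => t; rewrite /ray scale0r addr0.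
rewrite (_ : _ - _ = phi 1 - phi 0); last by rewrite /phi r1 r2 r3 r4; ring.
rewrite E subr0 mulr1 /dphi.
pose dd t := dx t - dy t.
have rdd : reg dd := regB _ _ rdx rdy.
have cx := reg_in_Cr _ _ _ _ b0 _ (reg_ray _ _ u rx1 rdx).
have [DA _] := HD _ cx.
have -> : DG (ray x1 dx u) dx = DG (ray x1 dx u) dd + DG (ray x1 dx u) dy.
  rewrite -DA; [|exact: reg_in_Cr rdd|exact: reg_in_Cr rdy].
  by congr (DG _ _); apply/funext => t; rewrite /dd /= subrK.
rewrite mxE.
have e1 : `|DG (ray x1 dx u) dd ord0 i| <= L3 * (kap * c1).
  apply: DG_bound => //; first exact: reg_ray.
  by move=> th j thr; have := H1 th j thr; rewrite !mxE.
have e2 : `|DG (ray x1 dx u) dy ord0 i - DG (ray y1 dy u) dy ord0 i| <= L4 * (kap * c2) * (kap * c3).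
  apply: DG_diff => //; try exact: reg_ray.
    move=> th j thr; have := H2 th j thr; have := H2' th j thr; rewrite !mxE.
    set a := x1 _ _ _; set b' := x2 _ _ _; set a' := y1 _ _ _; set b'' := y2 _ _ _ => h1 h2.
    (* The distance of the two rays at parameter u is a convex combination of the distances at the
       ends. *)
    rewrite (_ : _ - _ = (1 - u) * (a - a') + u * (b' - b'')); last by ring.
    apply: le_trans (ler_normD _ _) _; rewrite !normrM.
    rewrite (ger0_norm (_ : 0 <= 1 - u)); last lra.
    rewrite (ger0_norm (_ : 0 <= u)); last lra.
    have u1 : 0 <= 1 - u by lra. have u0 : 0 <= u by lra.
    by have := ler_wpM2l u1 h2; have := ler_wpM2l u0 h1; lra.
  by move=> th j thr; have := H3 th j thr; rewrite !mxE.
rewrite (_ : _ + _ - _ = DG (ray x1 dx u) dd ord0 i + (DG (ray x1 dx u) dy ord0 i - DG (ray y1 dy u) dy ord0 i)); last by ring.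
apply: le_trans (ler_normD _ _) _; apply: le_trans (lerD e1 e2) _.
have c23 : 0 <= c2 * c3 by rewrite mulr_ge0.
have l3 : 0 <= L3 * kap by rewrite mulr_ge0 ?ltW.
have l4 : 0 <= L4 * kap * kap by rewrite !mulr_ge0 ?ltW.
rewrite mulrDr; apply: lerD.
  by rewrite mulrA ler_wpM2r //; lra.
rewrite (_ : _ * _ * _ = L4 * kap * kap * (c2 * c3)); last by ring.
by rewrite ler_wpM2r //; lra.
Qed.

Lemma second_diff_lip_growth L L' : 0 <= L -> second_diff R d r b L G -> L + enorm R (G (fun _ => 0)) <= L' ->
  lip_growth R d r b L' G.
Proof.
move=> L0 HG HL.
have z0 := zero_itv R r r0.
have e0 := enorm_ge0 R d (G (fun _ => 0)).
have lip xi eta c : reg xi -> reg eta ->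
     (forall th i, - r <= th <= 0 -> `|xi th ord0 i - eta th ord0 i| <= c) ->
     forall i, `|G xi ord0 i - G eta ord0 i| <= L * c.
  move=> rx re H i.
  have c0 : 0 <= c by apply: le_trans (H 0 i z0).
  (* With both y arguments equal, the second difference is an ordinary difference and c3 = 0. *)
  have := HG eta xi eta eta c c 0 re rx re re.
  rewrite mulr0 addr0 => /(_ _ _ _ _ i).
  rewrite [X in `|_ - X|]subrr subr0; apply => th j thr; rewrite ?subrr ?subr0 ?normr0 //; exact: H.
split.
  move=> xi K rx H i.
  have K0 : 0 <= K by apply: le_trans (H 0 i z0).
  have := lip xi (fun _ => 0) K rx reg0 (fun th i thr => ltac:(rewrite mxE subr0; exact: H)) i.
  have := enorm_comp _ _ (G (fun _ => 0)) i.
  have LK := mulr_ge0 L0 K0.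
  have eK := mulr_ge0 e0 K0.
  move=> h1 h2.
  rewrite -(subrK (G (fun=> 0) ord0 i) (G xi ord0 i)).
  apply: le_trans (ler_normD _ _) _; apply: le_trans (lerD h2 h1) _.
  apply: (@le_trans _ _ ((L + enorm R (G (fun=> 0))) * (1 + K))); last first.
    by rewrite ler_wpM2r // addr_ge0.
  lra.
move=> xi eta c rx re H i.
have c0 : 0 <= c by apply: le_trans (H 0 i z0).
by apply: le_trans (lip xi eta c rx re H i) _; rewrite ler_wpM2r //; lra.
Qed.

End Frechet.

(** * Componentwise bounds for the drift *)

Section DriftLip.
Variables (R : realType) (d : nat) (r b L1 L2 : R) (F : (R -> vec R d) -> vec R d).
Hypotheses (r0 : 0 < r) (b0 : 0 < b) (L10 : 0 < L1) (L20 : 0 < L2).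
Hypothesis HF : forall xi eta, in_Cr R r xi -> in_Cr R r eta ->
  enorm R (F xi - F eta) <= L1 * supn R r (xi \- eta) /\
  enorm R (F xi) <= L2 * (1 + supn R r xi).

Lemma drift_lip_growth L' : (L1 + L2) * kap R d <= L' -> lip_growth R d r b L' F.
Proof.
move=> HL; have z0 := zero_itv R r r0; have k0 := kap_gt0 R d; have k1 := kap_ge1 R d.
have l1 : 0 <= L1 * kap R d by rewrite mulr_ge0 ?ltW.
have l2 : 0 <= L2 * kap R d by rewrite mulr_ge0 ?ltW.
split.
  move=> xi K rx H i.
  have K0 : 0 <= K by apply: le_trans (H 0 i z0).
  have cx := reg_in_Cr _ _ _ _ b0 _ rx.
  have [_ h] := HF xi xi cx cx.
  apply: le_trans (enorm_comp _ _ _ i) _; apply: le_trans h _.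
  have s := supn_le R d r r0 xi K K0 H.
  apply: (@le_trans _ _ (L2 * kap R d * (1 + K))); last by rewrite ler_wpM2r; lra.
  by rewrite -mulrA ler_wpM2l ?(ltW L20) // mulrDr mulr1 lerD.
move=> xi eta c rx re H i.
have c0 : 0 <= c by apply: le_trans (H 0 i z0).
have cx := reg_in_Cr _ _ _ _ b0 _ rx; have ce := reg_in_Cr _ _ _ _ b0 _ re.
have [h _] := HF xi eta cx ce.
have := enorm_comp _ _ (F xi - F eta) i; rewrite !mxE => /le_trans; apply; apply: le_trans h _.
have s : supn R r (xi \- eta) <= kap R d * c.
  by apply: supn_le => // th j thr; have := H th j thr; rewrite /= !mxE.
apply: le_trans (ler_wpM2l (ltW L10) s) _.
by rewrite mulrA ler_wpM2r //; lra.
Qed.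

End DriftLip.

(** * The space C^{0,b} and its norm *)

Section HolderNorm.
Variables (R : realType) (d : nat) (b a c : R).
Hypotheses (b0 : 0 < b) (ac : a <= c).
Implicit Types (u f : R -> vec R d).
Local Notation bd K := (bd R d b K a c).
Local Notation lil := (lil R d b a c).
Local Notation in_C0H := (in_C0H R b a c).
Local Notation holnorm := (holnorm R b a c).
Local Notation kap := (kap R d).

Lemma in_C0H_bd f : in_C0H f -> exists2 K, 0 <= K & bd K f.
Proof.
move=> [[C HC] _].
pose K1 := `|C| * (c - a) `^ b; pose K := enorm R (f a) + K1 + `|C|.
have K10 : 0 <= K1 by rewrite mulr_ge0 ?powR_ge0.
have e0 := enorm_ge0 R d (f a); have C0 := normr_ge0 C.
have aa : a <= a <= c by rewrite lexx ac.
have H s t i : a <= s -> s <= t -> t <= c -> `|f t ord0 i - f s ord0 i| <= `|C| * (t - s) `^ b.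
  move=> s1 st t1.
  have sr : a <= s <= c by have := ac; lra.
  have tr : a <= t <= c by have := ac; lra.
  have := le_trans (enorm_comp _ _ (f t - f s) i) (HC s t sr tr); rewrite !mxE => /le_trans; apply.
  rewrite (ger0_norm (_ : 0 <= t - s)) ?subr_ge0 //.
  by rewrite ler_wpM2r ?powR_ge0 // ler_norm.
exists K; first by rewrite /K; lra.
move=> i; split.
  move=> t /andP[t1 t2].
  have h := H a t i (lexx _) t1 t2.
  have : `|C| * (t - a) `^ b <= K1.
    by rewrite ler_wpM2l //; apply: ler_powRr; [exact: ltW | lra | lra].
  have := enorm_comp _ _ (f a) i => h1 h2.
  rewrite -(subrK (f a ord0 i) (f t ord0 i)).
  by apply: le_trans (ler_normD _ _) _; rewrite /K; lra.
move=> s t s1 st t1; apply: le_trans (H s t i s1 st t1) _.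
by rewrite ler_wpM2r ?powR_ge0 // /K; lra.
Qed.

Lemma in_C0H_lil f : in_C0H f -> lil f.
Proof.
move=> [_ H] e e0; have [del [d0 Hd]] := H e e0; exists del => // s t i s1 st t1 ts.
have ac' := ac.
have ts0 : 0 <= t - s by lra.
have := le_trans (enorm_comp _ _ (f t - f s) i) (Hd s t ltac:(lra) ltac:(lra)
  ltac:(by rewrite ger0_norm)).
by rewrite !mxE [`|t - s|]ger0_norm.
Qed.

Lemma bd_in_C0H K f : 0 <= K -> bd K f -> lil f -> in_C0H f.
Proof.
move=> K0 HK HL; have k0 := kap_gt0 R d; split.
  exists (kap * K) => s t sr tr; rewrite -mulrA; apply: enorm_lek.
    by rewrite mulr_ge0 ?powR_ge0.
  by move=> i; rewrite !mxE; have [_ h] := HK i; apply: (hold_abs _ _ _ _ _ _ _ _ h).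
move=> e e0; have ek : 0 < e / kap by rewrite divr_gt0.
have [del d0 Hd] := HL _ ek; exists del; split => // s t sr tr ts.
have -> : e * `|t - s| `^ b = kap * (e / kap * `|t - s| `^ b) by field; rewrite gt_eqF.
apply: enorm_lek; first by rewrite mulr_ge0 ?powR_ge0 // ltW.
move=> i; rewrite !mxE; have [st|st] := leP s t.
  have ts0 : 0 <= t - s by lra.
  by move: ts; rewrite (ger0_norm ts0) => ts; apply: Hd => //; lra.
have ts0 : 0 <= s - t by lra.
move: ts; rewrite (distrC t s) (ger0_norm ts0) => ts.
by rewrite distrC; apply: Hd => //; lra.
Qed.

Lemma holnorm_le K u : 0 <= K -> bd K u -> holnorm u <= 2 * (kap * K).
Proof.
move=> K0 HK; have k0 := kap_gt0 R d; have kK : 0 <= kap * K by rewrite mulr_ge0 // ltW.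
rewrite /Defs.holnorm (_ : 2 * (kap * K) = kap * K + kap * K); last by ring.
apply: lerD.
  apply: ge_sup.
    by exists (enorm R (u a)), a => //=; rewrite in_itv /= lexx ac.
  move=> _ [x /= xr <-]; rewrite in_itv /= in xr.
  by apply: enorm_lek => // i; have [h _] := HK i; apply: h.
set A := [set z | _].
(* For a = c there are no pairs s < t; the supremum of the empty set is 0. *)
have [[z0 Az0]|nA] := pselect (A !=set0); last first.
  by rewrite (_ : A = set0) ?sup0 //; apply/seteqP; split => // z Az; case: nA; exists z.
apply: ge_sup; first by exists z0.
move=> z [s [t [s1 [st [t1 ->]]]]].
have p : 0 < (t - s) `^ b by rewrite powR_gt0 // subr_gt0.
rewrite ler_pdivrMr // -mulrA; apply: enorm_lek; first by rewrite mulr_ge0 // ltW.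
by move=> i; rewrite !mxE; have [_ h] := HK i; apply: h => //; exact: ltW.
Qed.

Lemma holnorm_bd u : in_C0H u -> bd (holnorm u) u.
Proof.
move=> /in_C0H_bd [K K0 HK]; have k0 := kap_gt0 R d.
pose A := [set enorm R (u x) | x in `[a, c]].
pose B := [set z | exists s t : R, a <= s /\ s < t /\ t <= c /\
                    z = enorm R (u t - u s) / ((t - s) `^ b)].
have uA : has_ubound A.
  exists (kap * K) => _ [x /= xr <-]; rewrite in_itv /= in xr.
  by apply: enorm_lek => // i; have [h _] := HK i; apply: h.
have uB : has_ubound B.
  exists (kap * K) => z [s [t [s1 [st [t1 ->]]]]].
  have p : 0 < (t - s) `^ b by rewrite powR_gt0 // subr_gt0.
  rewrite ler_pdivrMr // -mulrA; apply: enorm_lek; first by rewrite mulr_ge0 // ltW.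
  by move=> i; rewrite !mxE; have [_ h] := HK i; apply: h => //; exact: ltW.
have A0 : 0 <= sup A.
  apply: le_trans (enorm_ge0 R d (u a)) _; apply: ub_le_sup => //.
  by exists a => //=; rewrite in_itv /= lexx ac.
have B0 : 0 <= sup B.
  have [[z0 Az0]|nA] := pselect (B !=set0); last first.
    by rewrite (_ : B = set0) ?sup0 //; apply/seteqP; split => // z Az; case: nA; exists z.
  apply: (@le_trans _ _ z0); last exact: ub_le_sup.
  by case: Az0 => s [t [_ [_ [_ ->]]]]; rewrite divr_ge0 ?powR_ge0 // enorm_ge0.
have E : holnorm u = sup A + sup B by [].
move=> i; split.
  move=> t tr; apply: le_trans (enorm_comp _ _ _ i) _; rewrite E.
  apply: (@le_trans _ _ (sup A)); last by rewrite lerDl.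
  by apply: ub_le_sup => //; exists t => //=; rewrite in_itv.
move=> s t s1; rewrite le_eqVlt => /orP[/eqP <- _|st t1].
  by rewrite !subrr normr0 powR0 ?mulr0 // gt_eqF.
have p : 0 < (t - s) `^ b by rewrite powR_gt0 // subr_gt0.
have h : enorm R (u t - u s) / (t - s) `^ b <= sup B by apply: ub_le_sup => //; exists s, t.
have := enorm_comp _ _ (u t - u s) i; rewrite !mxE => /le_trans; apply.
by rewrite -ler_pdivrMr // E; apply: le_trans h _; rewrite lerDr.
Qed.

End HolderNorm.

(** * Riemann-Stieltjes integrals of vector functions *)

Section RiemannStieltjes.
Variables (R : realType) (d : nat).

Lemma fin_delta (Q : 'I_d -> R -> Prop) : (forall i, exists del, 0 < del /\ Q i del) ->
  (forall i del del', 0 < del' -> del' <= del -> Q i del -> Q i del') ->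
  exists del, 0 < del /\ forall i, Q i del.
Proof.
move=> /choice[f Hf] mono.
have S0 : 0 <= \sum_i (f i)^-1 by apply: sumr_ge0 => i _; rewrite invr_ge0; have [/ltW] := Hf i.
have S1 : 0 < 1 + \sum_i (f i)^-1 by lra.
(* This number is below every f i and makes sense also when d = 0. *)
exists (1 + \sum_i (f i)^-1)^-1; split; first by rewrite invr_gt0.
move=> i; have [fi Qi] := Hf i; apply: mono Qi; first by rewrite invr_gt0.
rewrite -[leRHS]invrK lef_pV2 ?posrE ?invr_gt0 //.
rewrite (bigD1 i) //= addrCA lerDl addr_ge0 // sumr_ge0 // => j _.
by rewrite invr_ge0; have [/ltW] := Hf j.
Qed.

(** A uniform partition fine enough for both limits gives one sum that is close to both. *)
Lemma is_RS_uniq (f : R -> vec R d) (w : R -> R) (t : R) I I' : 0 <= t ->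
  is_RS R f w 0 t I -> is_RS R f w 0 t I' -> I = I'.
Proof.
move=> t0 H H'; apply/rowP => i; apply/eqP; rewrite -subr_eq0 -normr_le0.
apply/ler_addgt0Pr => e e0; rewrite add0r.
have e2 : 0 < e / 2 by lra.
have [d1 [d10 H1]] := H _ e2; have [d2 [d20 H2]] := H' _ e2.
pose del := Num.min d1 d2.
have del0 : 0 < del by rewrite lt_min d10.
pose n := (cell R del t).+1.
have n0 : 0 < n%:R :> R by rewrite ltr0n.
have tn : t / n%:R < del.
  by rewrite ltr_pdivrMr // mulrC; have /andP[_] := cellP R del t del0 t0.
pose p (k : nat) := k%:R * (t / n%:R).
have part d' : del <= d' -> forall k : nat, (k < n)%N -> p k <= p k <= p k.+1 /\ p k.+1 - p k < d'.
  move=> dd k _; rewrite lexx /= /p -natr1 mulrDl mul1r; split.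
    by rewrite lerDl divr_ge0.
  by rewrite addrC addKr; apply: lt_le_trans dd.
have pn : p n = t by rewrite /p mulrCA divff ?mulr1 // gt_eqF.
have p0 : p 0%N = 0 by rewrite /p mul0r.
have h1 := H1 n p p p0 pn (part d1 ltac:(by rewrite ge_min lexx)).
have h2 := H2 n p p p0 pn (part d2 ltac:(by rewrite ge_min lexx orbT)).
have := le_lt_trans (enorm_comp _ _ _ i) h1; have := le_lt_trans (enorm_comp _ _ _ i) h2.
rewrite !mxE; set S := (\sum_(_ < _) _ : vec R d) ord0 i.
by rewrite !ltr_norml ler_norml => *; lra.
Qed.

Lemma is_RS_row (f : R -> vec R d) (w : R -> R) (b g A B T t : R) :
  0 < b -> 0 < g -> 1 < b + g -> 0 <= A -> 0 <= B ->
  (forall i, hold R b A 0 T (fun s => f s ord0 i)) -> hold R g B 0 T w -> 0 <= t <= T ->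
  is_RS R f w 0 t (\row_i young R (fun s => f s ord0 i) w t).
Proof.
move=> b0 g0 bg A0 B0 hf hw tT e e0; have k0 := kap_gt0 R d.
have e1 : 0 < e / kap R d by rewrite divr_gt0.
have := fin_delta _ (fun i => young_RS R b g A B T _ w b0 g0 bg A0 B0 (hf i) hw t tT _ e1).
case.
  move=> i del del' _ dd H n p xi p0 pn Hp; apply: H => // k kn.
  by have [h1 h2] := Hp k kn; split => //; apply: lt_le_trans dd.
move=> del [d0 Hd]; exists del; split => // n p xi p0 pn Hp.
apply: (@le_lt_trans _ _ (d%:R * (e / kap R d))).
  apply: enorm_le; first exact: ltW.
  move=> i; apply: ltW; have := Hd i n p xi p0 pn Hp.
  by rewrite !mxE summxE; under [X in _ -> `|X - _| < _]eq_bigr do rewrite mxE.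
rewrite mulrCA -[ltRHS]mulr1 ltr_pM2l // ltr_pdivrMr // mul1r /kap ltr_nat //.
Qed.

End RiemannStieltjes.

(** * Fixed points of the Picard map and solutions of the equation *)

Section Solutions.
Variables (R : realType) (d : nat) (r b g L : R) (F G : (R -> vec R d) -> vec R d).
Hypotheses (r0 : 0 < r) (b0 : 0 < b) (bg : b < g) (g1 : g < 1) (bg1 : 1 < b + g) (L0 : 0 <= L).
Hypotheses (HF : lip_growth R d r b L F) (HG : lip_growth R d r b L G)
  (HG2 : second_diff R d r b L G).
Local Notation sol := (sol R d r b F G).

Lemma sol_RS K W T w X t : 0 <= K -> 0 <= W -> bd R d b K (- r) T X -> hold R g W 0 T w -> 0 <= t <= T ->
  is_RS R (fun s => F (seg R X s)) id 0 t
    (\row_i young R (fun s => F (seg R X s) ord0 i) id t) /\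
  is_RS R (fun s => G (seg R X s)) w 0 t
    (\row_i young R (fun s => G (seg R X s) ord0 i) w t).
Proof.
move=> K0 W0 HK hw tT; have LK : 0 <= L * K by rewrite mulr_ge0.
have b0h := b0; have bgh := bg; have bg1h := bg1.
split.
  apply: (is_RS_row _ _ _ _ b 1 (L * K) 1 T) => //; try lra; last exact: hold_id.
  by move=> i; eapply int_hold; eassumption.
apply: (is_RS_row _ _ _ _ b g (L * K) W T) => //; try lra.
by move=> i; eapply int_hold; eassumption.
Qed.

Lemma sol_is_solution W T w eta X : 0 <= W -> 0 <= T -> hold R g W 0 T w -> sol T w eta X ->
  is_solution R r T F G w eta X.
Proof.
move=> W0 T0 hw HX; split.
  by move=> t tr; apply: (sol_init R d r b g L F G r0 b0 bg g1 bg1 L0 T w eta X).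
have [K K0 HK] := sol_bd R d r b F G T w eta X T0 HX.
move=> t tT; have [RF RG] := sol_RS K W T w X t K0 W0 HK hw tT.
exists (\row_i young R (fun s => F (seg R X s) ord0 i) id t),
  (\row_i young R (fun s => G (seg R X s) ord0 i) w t); split; [|split] => //.
apply/rowP => i; rewrite (solE R d r b g L F G r0 b0 bg g1 bg1 L0 T w eta X t i HX tT).
by rewrite /inc !mxE addrA.
Qed.

(** Uniqueness of Riemann-Stieltjes limits turns the integrals of any solution into Young integrals;
    this transfers uniqueness to the stated notion of solution. *)
Lemma is_solution_sol K W T w eta X : 0 <= K -> 0 <= W -> 0 <= T -> bd R d b K (- r) T X ->
  hold R g W 0 T w -> is_solution R r T F G w eta X -> sol T w eta X.
Proof.
move=> K0 W0 T0 HK hw [H1 H2]; split; first by exists K.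
move=> t tr; have [t0|t0] := leP t 0.
  by rewrite Gam_neg // H1 //; case/andP: tr => ->.
have tT : 0 <= t <= T by case/andP: tr => _ ->; rewrite ltW.
have [I1 [I2 [R1 [R2 E]]]] := H2 t tT.
have [RF RG] := sol_RS K W T w X t K0 W0 HK hw tT.
apply/rowP => i; rewrite GamE ?(ltW t0) // E.
rewrite (is_RS_uniq _ _ _ _ _ _ _ (ltW t0) R1 RF) (is_RS_uniq _ _ _ _ _ _ _ (ltW t0) R2 RG).
by rewrite /inc !mxE addrA.
Qed.

End Solutions.

(** * Density of rational polygons *)

Section Polygon.
Variable R : realType.

Definition vertex (q : seq rat) (k : nat) : R := ratr (nth 0 q k).

(** Piecewise linear with rational ordinates at the multiples of 1 / (n + 1), hence a countable
    family. Vertices past the end of q are 0. *)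
Definition pgon (n : nat) (q : seq rat) (x : R) : R :=
  let h := n.+1%:R^-1 in let k := cell R h x in
  vertex q k + (vertex q k.+1 - vertex q k) * (x / h - k%:R).

Definition slil (b a c : R) (f : R -> R) := forall e, 0 < e -> exists2 del, 0 < del &
  forall s t, a <= s -> s <= t -> t <= c -> t - s < del -> `|f t - f s| <= e * (t - s) `^ b.

Lemma pgonE n q (k : nat) x : k%:R * n.+1%:R^-1 <= x <= k.+1%:R * n.+1%:R^-1 ->
  pgon n q x = vertex q k + (vertex q k.+1 - vertex q k) * (x / n.+1%:R^-1 - k%:R).
Proof.
set h := n.+1%:R^-1; have h0 : 0 < h by rewrite invr_gt0.
move=> /andP[kx]; rewrite le_eqVlt => /orP[/eqP ->|xk].
  rewrite /pgon -/h /cell mulfK ?gt_eqF // natrK (_ : k.+1%:R = k%:R + 1) ?natr1 //; ring.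
have ck : cell R h x = k by apply: truncn_def; rewrite ler_pdivlMr // ltr_pdivrMr // kx xk.
by rewrite /pgon -/h ck.
Qed.

Lemma rat_approx (x e : R) : 0 < e -> exists q : rat, `|ratr q - x| <= e.
Proof.
move=> e0; have xe : x - e < x + e by lra.
have [q] := @rat_in_itvoo R (x - e) (x + e) xe.
by rewrite in_itv /= => /andP[h1 h2]; exists q; rewrite ler_norml; lra.
Qed.

(** Within a cell both f and the polygon have small b-quotients, since f is little Hoelder; across
    cells they are compared at the nodes. *)
Lemma pgon_dense (b T e : R) f : 0 < b < 1 -> 0 <= T -> slil b 0 T f -> 0 < e -> exists n q,
  hold R b e 0 T (fun x => f x - pgon n q x) /\ forall x, 0 <= x <= T -> `|f x - pgon n q x| <= e.
Proof.
move=> /andP[b0 b1] T0 Hf e0.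
(* 8 leaves room for the partial cells at both ends, 3 each, and the whole cells between them, 1. *)
pose e' := e / 8; have e'0 : 0 < e' by rewrite divr_gt0.
have [del d0 Hd] := Hf _ e'0.
(* Constant continuation past T, as the last cell may stick out of [0, T]. *)
pose f' x := f (Num.min x T).
have Hd' s t : 0 <= s -> s <= t -> t - s < del -> `|f' t - f' s| <= e' * (t - s) `^ b.
  move=> s0 st ts; rewrite /f'.
  have ms : 0 <= Num.min s T by rewrite le_min s0.
  have mst : Num.min s T <= Num.min t T by rewrite le_min !ge_min st lexx ?orbT.
  have mtT : Num.min t T <= T by rewrite ge_min lexx orbT.
  have mts : Num.min t T - Num.min s T <= t - s.
    have [h|h] := leP s T; last first.
      by rewrite (min_r (_ : T <= t)) ?subrr ?subr_ge0 // (le_trans (ltW h)).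
    by rewrite lerD2r ge_min lexx.
  apply: le_trans (Hd _ _ ms mst mtT (le_lt_trans mts ts)) _.
  by rewrite ler_wpM2l ?(ltW e'0) // ler_powRr ?(ltW b0) ?subr_ge0.
pose n := Num.truncn del^-1; pose h : R := n.+1%:R^-1.
have h0 : 0 < h by rewrite invr_gt0.
have h1 : h <= 1 by rewrite invf_le1 // ler1n.
have hd : h < del by rewrite /h invf_plt ?posrE // truncnS_gt.
pose rho := e' * h `^ b / 2.
have hb0 : 0 < h `^ b by rewrite powR_gt0.
have rho0 : 0 < rho by rewrite divr_gt0 // mulr_gt0.
have [qf Hq] := choice (fun k : nat => rat_approx (f' (k%:R * h)) rho rho0).
pose K := (cell R h T).+2.
pose q := mkseq qf K.+1.
have vq k : (k <= K)%N -> `|vertex q k - f' (k%:R * h)| <= rho.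
  by move=> kK; rewrite /vertex nth_mkseq.
pose E x := f' x - pgon n q x.
have E_cell k x y : (k < K)%N -> k%:R * h <= x -> x <= y -> y <= k.+1%:R * h ->
    `|E y - E x| <= 3 * e' * (y - x) `^ b.
  move=> kK kx xy yk.
  have kh0 : 0 <= k%:R * h by rewrite mulr_ge0 // ltW.
  have kS : k.+1%:R * h = k%:R * h + h by rewrite -natr1 mulrDl mul1r.
  rewrite /E (pgonE n q k x) ?kx ?(le_trans xy) // (pgonE n q k y) ?yk ?(le_trans kx) //.
  rewrite -/h.
  have -> : f' y - (vertex q k + (vertex q k.+1 - vertex q k) * (y / h - k%:R)) -
    (f' x - (vertex q k + (vertex q k.+1 - vertex q k) * (x / h - k%:R))) =
    (f' y - f' x) - (vertex q k.+1 - vertex q k) / h * (y - x) by ring.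
  have yx0 : 0 <= y - x by lra.
  have yxh : y - x <= h by lra.
  have i1 : `|f' y - f' x| <= e' * (y - x) `^ b by apply: Hd' => //; lra.
  have i2 : `|vertex q k.+1 - vertex q k| <= 2 * e' * h `^ b.
    have := vq k (ltnW kK); have := vq k.+1 kK.
    have : `|f' (k.+1%:R * h) - f' (k%:R * h)| <= e' * h `^ b.
      have := Hd' (k%:R * h) (k.+1%:R * h) kh0.
      by rewrite kS addrAC subrr add0r; apply => //; rewrite lerDl ltW.
    rewrite /rho !ler_norml => *; lra.
  have i3 : h `^ b / h * (y - x) <= (y - x) `^ b.
    have -> : h `^ b / h = h `^ (b - 1).
      by rewrite powRB ?powRr1 ?(ltW h0) // (gt_eqF h0) implybT.
    have [->|yxn] := eqVneq (y - x) 0; first by rewrite mulr0 powR_ge0.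
    have yxp : 0 < y - x by rewrite lt_neqAle eq_sym yxn.
    have {2}-> : b = (b - 1) + 1 by ring.
    rewrite (@powRD _ (y - x)) ?yxn ?implybT // powRr1 // ler_wpM2r //.
    have -> : b - 1 = - (1 - b) by ring.
    rewrite !powRN lef_pV2 ?posrE ?powR_gt0 //.
    by apply: ler_powRr => //; lra.
  apply: le_trans (ler_normB _ _) _.
  rewrite normrM normrM (ger0_norm yx0) (gtr0_norm (_ : 0 < h^-1)) ?invr_gt0 //.
  have i4 : `|vertex q k.+1 - vertex q k| / h * (y - x) <= 2 * e' * (h `^ b / h * (y - x)).
    rewrite (_ : 2 * e' * (h `^ b / h * (y - x)) = 2 * e' * h `^ b / h * (y - x)); last by ring.
    by apply: ler_wpM2r => //; apply: ler_wpM2r; [rewrite invr_ge0 ltW | exact: i2].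
  have i5 : 2 * e' * (h `^ b / h * (y - x)) <= 2 * e' * (y - x) `^ b.
    by rewrite ler_wpM2l // mulr_ge0 // ltW.
  by have := lerD i1 (le_trans i4 i5) => /le_trans; apply; lra.
have E_node k : (k <= K)%N -> (0 < k)%N -> `|E (k%:R * h)| <= rho.
  move=> kK k0; rewrite /E distrC; case: k kK k0 => // k kK _.
  rewrite (pgonE n q k); last by rewrite lexx andbT ler_pM2r // ler_nat.
  rewrite -/h mulfK ?gt_eqF //.
  have -> : vertex q k + (vertex q k.+1 - vertex q k) * (k.+1%:R - k%:R) = vertex q k.+1.
    rewrite (_ : k.+1%:R = k%:R + 1) ?natr1 //; ring.
  exact: vq.
have E_node0 : `|E 0| <= rho.
  rewrite /E distrC (pgonE n q 0); last by rewrite mul0r mul1r lexx ltW.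
  have := vq 0%N isT; rewrite !mul0r subrr mulr0 addr0; exact.
have nodes k : (k <= K)%N -> `|E (k%:R * h)| <= rho.
  by case: k => [|k] kK; [rewrite mul0r | apply: E_node].
have cT x : 0 <= x <= T -> exists k : nat,
    [/\ k%:R * h <= x, x < k.+1%:R * h & (k <= cell R h T)%N].
  move=> /andP[x0 xT]; exists (cell R h x).
  have /andP[c1 c2] := cellP R h x h0 x0; split => //.
  by apply: le_truncn; rewrite ler_pM2r ?invr_gt0.
have fE x : 0 <= x <= T -> f x - pgon n q x = E x.
  by move=> /andP[_ xT]; rewrite /E /f' min_l.
exists n, q; split; last first.
  move=> x xT; rewrite fE //.
  have [k [c1 c2 kT]] := cT x xT.
  have kK : (k < K)%N by rewrite /K ltnS (leq_trans kT).
  have := E_cell k (k%:R * h) x kK (lexx _) c1 (ltW c2).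
  have := nodes k (ltnW kK).
  have : (x - k%:R * h) `^ b <= 1.
    rewrite [leRHS](_ : 1 = 1 `^ b); last by rewrite powR1.
    apply: ler_powRr; [exact: ltW | lra |].
    by move: c2; rewrite -natr1 mulrDl mul1r => c2; lra.
  have r1 : rho <= e'.
    have hb1 : h `^ b <= 1.
      rewrite [leRHS](_ : 1 = 1 `^ b); last by rewrite powR1.
      by apply: ler_powRr; [exact: ltW|exact: ltW|].
    have : e' * h `^ b <= e' by rewrite ler_piMr // ltW.
    by rewrite /rho; have := mulr_gt0 e'0 hb0 => *; lra.
  move=> p1 n1 n2.
  have : 3 * e' * (x - k%:R * h) `^ b <= 3 * e' by rewrite ler_piMr //; lra.
  move: n1 n2; rewrite /e' !ler_norml in r1 * => *; lra.
apply: hold_eq (_ : hold R b e 0 T E); first by move=> x xT; rewrite fE.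
move=> x y x0 xy yT.
have xT : 0 <= x <= T by lra.
have yT' : 0 <= y <= T by lra.
have y0 : 0 <= y by lra.
have [kx [c1 c2 kxT]] := cT x xT.
have [ky [c3 c4 kyT]] := cT y yT'.
have kyK : (ky < K)%N by rewrite /K ltnS (leq_trans kyT).
have kxK : (kx < K)%N by rewrite /K ltnS (leq_trans kxT).
have P0 := powR_ge0 (y - x) b.
have kxy : (kx <= ky)%N.
  by rewrite -ltnS -(ltr_nat R) -(ltr_pM2r h0); apply: le_lt_trans c1 _; apply: le_lt_trans c4.
have eE : e = 8 * e' by rewrite /e'; field.
have eP : 0 <= e' * (y - x) `^ b by rewrite mulr_ge0 // ltW.
move: kxy; rewrite leq_eqVlt => /orP[/eqP kk|kxy].
  have := E_cell kx x y kxK c1 xy; rewrite kk => /(_ (ltW c4)) /le_trans; apply.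
  by rewrite eE; lra.
have k1 : kx.+1%:R * h <= ky%:R * h by rewrite ler_pM2r // ler_nat.
have m1 : `|E y - E (ky%:R * h)| <= 3 * e' * (y - x) `^ b.
  apply: le_trans (E_cell ky (ky%:R * h) y kyK (lexx _) c3 (ltW c4)) _.
  rewrite ler_wpM2l; [|lin|]; last by apply: ler_powRr; [exact: ltW|lin|lin].
  by [].
have m2 : `|E (kx.+1%:R * h) - E x| <= 3 * e' * (y - x) `^ b.
  apply: le_trans (E_cell kx x (kx.+1%:R * h) kxK c1 (ltW c2) (lexx _)) _.
  rewrite ler_wpM2l; [|lin|]; last by apply: ler_powRr; [exact: ltW|lin|lin].
  by [].
have m3 : `|E (ky%:R * h) - E (kx.+1%:R * h)| <= e' * (y - x) `^ b.
  move: kxy; rewrite leq_eqVlt => /orP[/eqP kk|kxy].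
    by rewrite kk subrr normr0.
  have hh : h <= y - x.
    have : kx.+2%:R * h <= ky%:R * h by rewrite ler_pM2r // ler_nat.
    by rewrite -natr1 mulrDl mul1r => ?; lra.
  have : e' * h `^ b <= e' * (y - x) `^ b.
    by rewrite ler_wpM2l ?(ltW e'0) // ler_powRr ?(ltW b0) ?(ltW h0).
  have := nodes ky (ltnW kyK); have := nodes kx.+1 kxK.
  by rewrite /rho !ler_norml => *; lra.
move: m1 m2 m3; rewrite eE !ler_norml => *; lra.
Qed.

End Polygon.

(** * Triangle inequalities *)

Section Triangle.
Variables (R : realType) (d : nat).

Lemma enorm_triangle (u v : vec R d) : enorm R (u + v) <= enorm R u + enorm R v.
Proof.
have u0 := enorm_ge0 R d u; have v0 := enorm_ge0 R d v.
have sq (w : vec R d) : enorm R w ^+ 2 = \sum_(i < d) w ord0 i ^+ 2.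
  by rewrite /enorm sqr_sqrtr // sumr_ge0 // => i _; exact: sqr_ge0.
have zero (w : vec R d) : enorm R w = 0 -> w = 0.
  move=> w0; apply/rowP => i; rewrite mxE; apply/eqP; rewrite -normr_le0 -w0.
  exact: enorm_comp.
have [/zero ->|un] := eqVneq (enorm R u) 0; first by rewrite add0r lerDr enorm_ge0.
have [/zero ->|vn] := eqVneq (enorm R v) 0; first by rewrite addr0 lerDl enorm_ge0.
have up : 0 < enorm R u by rewrite lt_neqAle eq_sym un.
have vp : 0 < enorm R v by rewrite lt_neqAle eq_sym vn.
rewrite -ler_sqr ?nnegrE ?enorm_ge0 ?addr_ge0 // sq.
set A := enorm R u in up un u0 *; set B := enorm R v in vp vn v0 *.
have A2 : A ^+ 2 = \sum_(i < d) u ord0 i ^+ 2 by exact: sq.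
have B2 : B ^+ 2 = \sum_(i < d) v ord0 i ^+ 2 by exact: sq.
(* The cross term is split with the weights B / A and A / B, for which the total is exactly (A +
   B)^2. *)
apply: (@le_trans _ _ (\sum_(i < d) ((1 + B / A) * u ord0 i ^+ 2 + (1 + A / B) * v ord0 i ^+ 2))).
  apply: ler_sum => i _; rewrite mxE.
  set x := u ord0 i; set y := v ord0 i.
  have AB : 0 <= (A * B)^-1 by rewrite invr_ge0 mulr_ge0.
  rewrite -subr_ge0 (_ : _ - _ = (A * B)^-1 * (B * x - A * y) ^+ 2).
    by rewrite mulr_ge0 // sqr_ge0.
  by field; rewrite un vn.
rewrite big_split /= -!mulr_sumr -A2 -B2 le_eqVlt; apply/orP; left; apply/eqP.
by field; rewrite un vn.
Qed.

(** Comparison with [bd] loses a factor; for preimages of open balls the constant has to be 1. *)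
Lemma holnorm_triangle (b a c : R) (u v : R -> vec R d) : 0 < b -> a <= c ->
  in_C0H R b a c u -> in_C0H R b a c v ->
  holnorm R b a c (fun t => u t + v t) <= holnorm R b a c u + holnorm R b a c v.
Proof.
move=> b0 ac Hu Hv; rewrite /holnorm.
pose A (u : R -> vec R d) := [set enorm R (u x) | x in `[a, c]].
pose B (u : R -> vec R d) := [set z | exists s t : R, a <= s /\ s < t /\ t <= c /\
                    z = enorm R (u t - u s) / ((t - s) `^ b)].
have ub f : in_C0H R b a c f -> has_ubound (A f) /\ has_ubound (B f).
  move=> /(in_C0H_bd _ _ _ _ _ b0 ac) [K K0 HK]; have k0 := kap_gt0 R d; split.
    exists (kap R d * K) => _ [x /= xr <-]; rewrite in_itv /= in xr.
    by apply: enorm_lek => // i; have [h _] := HK i; apply: h.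
  exists (kap R d * K) => z [s [t [s1 [st [t1 ->]]]]].
  have p : 0 < (t - s) `^ b by rewrite powR_gt0 // subr_gt0.
  rewrite ler_pdivrMr // -mulrA; apply: enorm_lek; first by rewrite mulr_ge0 // ltW.
  by move=> i; rewrite !mxE; have [_ h] := HK i; apply: h => //; exact: ltW.
have [uA uB] := ub _ Hu; have [vA vB] := ub _ Hv.
rewrite addrACA; apply: lerD.
  apply: ge_sup; first by exists (enorm R (u a + v a)), a => //=; rewrite in_itv /= lexx ac.
  move=> _ [x xr <-]; apply: le_trans (enorm_triangle _ _) _; apply: lerD.
    by apply: ub_le_sup => //; exists x.
  by apply: ub_le_sup => //; exists x.
have sB f : has_ubound (B f) -> 0 <= sup (B f).
  move=> fB; have [[z0 Bz0]|nB] := pselect (B f !=set0); last first.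
    by rewrite (_ : B f = set0) ?sup0 //; apply/seteqP; split => // z Bz; case: nB; exists z.
  apply: (@le_trans _ _ z0); last exact: ub_le_sup.
  by case: Bz0 => s [t [_ [_ [_ ->]]]]; rewrite divr_ge0 ?powR_ge0 // enorm_ge0.
rewrite -/(B (fun t => u t + v t)).
have [nB|nB] := pselect (B (fun t => u t + v t) !=set0); last first.
  rewrite (_ : B (fun t => u t + v t) = set0); first by rewrite sup0 addr_ge0 // sB.
  by apply/seteqP; split => // z Bz; case: nB; exists z.
apply: ge_sup => // z [s [t [s1 [st [t1 ->]]]]].
have p : 0 < (t - s) `^ b by rewrite powR_gt0 // subr_gt0.
have h1 : enorm R (u t - u s) / (t - s) `^ b <= sup (B u).
  by apply: ub_le_sup => //; exists s, t.
have h2 : enorm R (v t - v s) / (t - s) `^ b <= sup (B v).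
  by apply: ub_le_sup => //; exists s, t.
apply: le_trans (lerD h1 h2); rewrite -mulrDl ler_pM2r ?invr_gt0 //.
by rewrite opprD addrACA; exact: enorm_triangle.
Qed.

End Triangle.

(** * Countable operations and rational times *)

Section CountableOps.
Variables (dd : measure_display) (T : measurableType dd) (I : countType).

Lemma measurable_imp (Q : Prop) (A : set T) : (Q -> measurable A) -> measurable [set x | Q -> A x].
Proof.
have [q|nq] := pselect Q => mA.
  have -> : [set x | Q -> A x] = A by apply/seteqP; split => x //=; exact.
  exact: mA.
have -> : [set x | Q -> A x] = setT by apply/seteqP; split => x // _ /nq.
exact: measurableT.
Qed.

Lemma bigcap_count (F : I -> set T) : (forall i, measurable (F i)) -> measurable [set x | forall i, F i x].
Proof.
move=> mF.
have -> : [set x | forall i, F i x] = \bigcap_(n : nat) (if unpickle n is Some i then F i else setT).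
  apply/seteqP; split => [x Fx n _|x Fx i]; first by case: unpickle => // i; exact: Fx.
  by have := Fx (pickle i) Logic.I; rewrite pickleK.
by apply: bigcap_measurable => // n _; case: unpickle => [i|]; [exact: mF|exact: measurableT].
Qed.

End CountableOps.

Lemma sigma_set0 (T : Type) (G : set (set T)) : <<s G>> set0.
Proof. by have [] := smallest_sigma_algebra setT G. Qed.

Lemma sigma_bigcup_count (T : Type) (G : set (set T)) (I : countType) (F : I -> set T) :
  (forall i, <<s G>> (F i)) -> <<s G>> [set x | exists i, F i x].
Proof.
move=> mF; have [s0 _ sU] := smallest_sigma_algebra setT G.
have -> : [set x | exists i, F i x] = \bigcup_(n : nat) (if unpickle n is Some i then F i else set0).
  apply/seteqP; split => [x [i Fx]|x [n _]]; first by exists (pickle i) => //; rewrite pickleK.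
  by case: unpickle => // i Fx; exists i.
by apply: sU => n; case: unpickle.
Qed.

(** Reduces a Hoelder condition to countably many inequalities, which makes it measurable. *)
Lemma hold_of_rat (R : realType) (b K a c : R) (w : R -> R) : 0 < b -> 0 <= K -> continuous w ->
  (forall p q : rat, a <= ratr p -> ratr p <= ratr q :> R -> ratr q <= c ->
     `|w (ratr q) - w (ratr p)| <= K * (ratr q - ratr p) `^ b) -> hold R b K a c w.
Proof.
move=> b0 K0 cw H s t as_; rewrite le_eqVlt => /orP[/eqP <- _|st tc].
  by rewrite !subrr normr0 mulr_ge0 ?powR_ge0.
apply/ler_addgt0Pr => e e0; have e2 : 0 < e / 2 by lra.
have cc (x : R) : exists2 del, 0 < del & forall y, `|x - y| < del -> `|w x - w y| < e / 2.
  have /cvgrPdist_lt /(_ _ e2) := cw x; rewrite near_simpl => /nbhs_ballP[del /= d0 Hd].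
  by exists del => // y xy; exact: Hd.
have [d1 d10 H1] := cc s; have [d2 d20 H2] := cc t.
have [p] : exists p : rat, ratr p \in `]s, (Num.min (s + d1) ((s + t) / 2))[.
  have h : s < Num.min (s + d1) ((s + t) / 2) by rewrite lt_min; apply/andP; lra.
  by have [p hp] := rat_in_itvoo h; exists p.
rewrite in_itv /= lt_min => /and3P[p1 p2 p3].
have [q] : exists q : rat, ratr q \in `](Num.max (t - d2) ((s + t) / 2)), t[.
  have h : Num.max (t - d2) ((s + t) / 2) < t by rewrite gt_max; apply/andP; lra.
  by have [q hq] := rat_in_itvoo h; exists q.
rewrite in_itv /= gt_max => /andP[/andP[q1 q2] q3].
have pq : ratr p <= ratr q :> R by lra.
have h0 := H p q ltac:(lra) pq ltac:(lra).
have h1 : `|w s - w (ratr p)| < e / 2 by apply: H1; rewrite ltr_norml; apply/andP; lra.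
have h2 : `|w t - w (ratr q)| < e / 2 by apply: H2; rewrite ltr_norml; apply/andP; lra.
have h3 : K * (ratr q - ratr p) `^ b <= K * (t - s) `^ b.
  by rewrite ler_wpM2l //; apply: ler_powRr; lra.
by move: h0 h1 h2; rewrite !ler_norml !ltr_norml => *; lra.
Qed.

(** * Regular paths *)

Section Paths.
Variables (R : realType) (beta g1 g2 : R).
Hypotheses (g10 : 0 < g1) (g12 : g1 < g2).

(** Rational times and natural constants keep every quantifier countable. *)
Definition regular_paths : set (OmegaM R beta) := [set w | forall N : nat, exists C : nat,
  forall p q : rat, - N%:R <= (ratr p : R) -> ratr p <= ratr q :> R -> (ratr q : R) <= N%:R ->
     `|oval w (ratr q) - oval w (ratr p)| <= C%:R * (ratr q - ratr p) `^ g2].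

Lemma abs_diff_meas (p q c K : R) (h : R -> OmegaM R beta -> R) :
  (forall t, measurable_fun setT (h t)) ->
  measurable [set w | `|h q w - h p w - c| <= K].
Proof.
move=> mh.
have mn : measurable_fun setT (fun w => `|h q w - h p w - c|).
  by apply: measurableT_comp => //; do 2 apply: measurable_funB => //.
have -> : [set w | `|h q w - h p w - c| <= K] =
   setT `&` (fun w => `|h q w - h p w - c|) @^-1` `]-oo, K]%classic.
  by rewrite setTI; apply/seteqP; split => w /=; rewrite in_itv.
exact: mn.
Qed.

Lemma regular_paths_meas : measurable regular_paths.
Proof.
have -> : regular_paths = \bigcap_(N : nat) \bigcup_(C : nat) [set w | forall p q : rat,
   [set w : OmegaM R beta | - N%:R <= (ratr p : R) -> ratr p <= ratr q :> R -> (ratr q : R) <= N%:R ->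
     `|oval w (ratr q) - oval w (ratr p)| <= C%:R * (ratr q - ratr p) `^ g2] w].
  apply/seteqP; split => [w H N _|w H N].
    by have [C HC] := H N; exists C.
  by have [C _ HC] := H N Logic.I; exists C.
apply: bigcap_measurable => // N _; apply: bigcup_measurable => C _.
apply: bigcap_count => p; apply: bigcap_count => q.
do 3 apply: measurable_imp => ?.
have := abs_diff_meas (ratr p) (ratr q) 0 (C%:R * (ratr q - ratr p) `^ g2)
  (fun t w => oval w t) (eval_meas R beta).
set A := (X in measurable X -> _); set B := (X in _ -> measurable X).
suff -> : A = B by [].
by apply/seteqP; split => w; rewrite /A /B /= subr0.
Qed.

Lemma regular_pathsP (w : OmegaM R beta) : regular_paths w <->
  forall N : nat, exists2 C, 0 <= C & hold R g2 C (- N%:R) N%:R (oval w).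
Proof.
have g20 : 0 < g2 by have := g10; have := g12; lra.
split => H N.
  have [C HC] := H N; exists C%:R => //.
  by have [_ [cw _]] := oprop R beta w; apply: hold_of_rat.
have [C C0 HC] := H N; exists (Num.truncn C).+1 => p q h1 h2 h3.
apply: le_trans (HC _ _ h1 h2 h3) _; rewrite ler_wpM2r ?powR_ge0 // ltW //.
exact: truncnS_gt.
Qed.

Lemma regular_shift (s c : R) (w v : OmegaM R beta) : (forall u, oval v u = oval w (s + u) - c) ->
  regular_paths w -> regular_paths v.
Proof.
move=> E /regular_pathsP H; apply/regular_pathsP => N.
have [C C0 HC] := H (N + (Num.truncn `|s|).+1)%N; exists C => //.
move=> x y x1 xy y1; rewrite !E.
have -> : oval w (s + y) - c - (oval w (s + x) - c) = oval w (s + y) - oval w (s + x) by ring.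
have -> : y - x = (s + y) - (s + x) by ring.
have := truncnS_gt `|s|; rewrite ltr_norml => /andP[s1 s2].
by apply: HC; rewrite ?natrD; lra.
Qed.

(** Both directions matter: an irregular path has to stay irregular for [kappa] to commute with the
    shift. *)
Lemma regular_theta (s : R) (w : OmegaM R beta) : regular_paths (theta R beta s w) <-> regular_paths w.
Proof.
split; last by apply: (regular_shift s (oval w s)) => u.
apply: (regular_shift (- s) (- oval w s)) => u /=.
by rewrite [s + (- s + u)]addrA subrr add0r opprK subrK.
Qed.

(* Exceptional paths are replaced by 0, so that the equation can be solved for every w; the set
   of regular paths is measurable and shift-invariant, which keeps the cocycle property. *)
Definition kappa (w : OmegaM R beta) : R -> R :=
  if `[< regular_paths w >] then oval w else fun _ => 0.

Lemma kappa_meas t : measurable_fun setT (fun w => kappa w t).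
Proof.
have -> : (fun w => kappa w t) = (fun w => oval w t * \1_regular_paths w).
  apply/funext => w; rewrite /kappa indicE; case: asboolP => h.
    by rewrite mem_set // mulr1.
  by rewrite memNset // mulr0.
apply: measurable_funM; first exact: eval_meas.
by apply: measurable_indic; exact: regular_paths_meas.
Qed.

Lemma kappa_cont w : continuous (kappa w).
Proof.
rewrite /kappa; case: ifP => _; first by have [_ []] := oprop R beta w.
by move=> x; exact: cvg_cst.
Qed.

Lemma kappa_hold w (N : nat) : exists2 C, 0 <= C & hold R g2 C (- N%:R) N%:R (kappa w).
Proof.
rewrite /kappa; case: asboolP => [/regular_pathsP|_]; first exact.
exists 0 => // s t _ _ _; by rewrite subrr normr0 mul0r.
Qed.

Lemma kappa_theta s w : kappa (theta R beta s w) = th R s (kappa w).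
Proof.
rewrite /kappa; have [h|h] := pselect (regular_paths w).
  by rewrite !asboolT //; apply/regular_theta.
rewrite !asboolF //; first by apply/funext => u; rewrite /th subrr.
by move/regular_theta.
Qed.

Lemma kappa_regular w : regular_paths w -> kappa w = oval w.
Proof. by move=> h; rewrite /kappa asboolT. Qed.

Lemma kappa_good w : good R g1 (kappa w).
Proof.
move=> T; have g10' := g10; have g12' := g12.
pose N := (Num.truncn `|T|).+1.
have TN : T < N%:R by apply: le_lt_trans (ler_norm T) _; exact: truncnS_gt.
have [C C0 HC] := kappa_hold w N.
exists (C * N%:R `^ (g2 - g1)); first by rewrite mulr_ge0 ?powR_ge0.
move=> s t s0 st tT.
have N0 : 0 <= N%:R :> R by [].
apply: le_trans (HC s t _ st _) _; [lra|lra|].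
rewrite -mulrA ler_wpM2l //; apply: powR_split => //; apply/andP; lra.
Qed.

(** The gap g1 < g2 yields the little Hoelder property of order g1 that [pgon_dense] asks for. *)
Lemma kappa_slil w (T : R) : slil R g1 0 T (kappa w).
Proof.
have g10' := g10; have g12' := g12.
have [N TN] : exists N : nat, T <= N%:R.
  exists (Num.truncn `|T|).+1; apply: le_trans (ler_norm T) _; apply: ltW; exact: truncnS_gt.
have [C C0 HC] := kappa_hold w N.
move=> e e0.
have [del /andP[d0 d1] Hd] := powR_small R (g2 - g1) (e / (C + 1)) ltac:(lra)
  ltac:(by rewrite divr_gt0 //; lra).
exists del => // s t s0 st tT ts.
have N0 : 0 <= N%:R :> R by [].
apply: le_trans (HC s t _ st _) _; [lra|lra|].
have p : (t - s) `^ g2 <= del `^ (g2 - g1) * (t - s) `^ g1.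
  by apply: powR_split => //; apply/andP; lra.
apply: le_trans (ler_wpM2l C0 p) _.
rewrite mulrA ler_wpM2r ?powR_ge0 //.
apply: le_trans (ler_wpM2l C0 Hd) _.
by rewrite mulrCA ler_piMr ?(ltW e0) // ler_pdivrMr; lra.
Qed.

(** A single m sets both the radius and the horizon of the neighbourhood. *)
Definition path_ball (c : R -> R) (m : nat) : set (OmegaM R beta) :=
  [set w | forall p q : rat, 0 <= (ratr p : R) -> ratr p <= ratr q :> R -> ratr q <= (m.+1%:R : R) ->
     `|kappa w (ratr q) - kappa w (ratr p) - (c (ratr q) - c (ratr p))|
       <= m.+1%:R^-1 * (ratr q - ratr p) `^ g1].

Lemma path_ball_meas c m : measurable (path_ball c m).
Proof.
apply: bigcap_count => p; apply: bigcap_count => q.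
do 3 apply: measurable_imp => ?.
exact: (abs_diff_meas (ratr p) (ratr q) (c (ratr q) - c (ratr p))
  (m.+1%:R^-1 * (ratr q - ratr p) `^ g1) (fun t w => kappa w t) kappa_meas).
Qed.

Lemma path_ball_hold c m w : continuous c -> path_ball c m w ->
  hold R g1 m.+1%:R^-1 0 m.+1%:R (fun t => kappa w t - c t).
Proof.
move=> cc H; apply: hold_of_rat => //.
  by move=> x; apply: cvgB; [exact: kappa_cont|exact: cc].
move=> p q h1 h2 h3; have := H p q h1 h2 h3.
rewrite (_ : _ - _ - (_ - _) = kappa w (ratr q) - c (ratr q) - (kappa w (ratr p) - c (ratr p))) //.
ring.
Qed.

Lemma hold_path_ball c m w : hold R g1 m.+1%:R^-1 0 m.+1%:R (fun t => kappa w t - c t) -> path_ball c m w.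
Proof.
move=> H p q h1 h2 h3; have := H _ _ h1 h2 h3.
rewrite (_ : kappa w (ratr q) - kappa w (ratr p) - (_ - _) =
  kappa w (ratr q) - c (ratr q) - (kappa w (ratr p) - c (ratr p))) //.
ring.
Qed.

End Paths.

(** * Open sets of the product are measurable *)

Section OpenMeasurable.
Variables (R : realType) (d : nat) (r b beta g1 g2 : R).
Hypotheses (r0 : 0 < r) (b0 : 0 < b) (b1 : b < 1) (g10 : 0 < g1) (g11 : g1 < 1) (g12 : g1 < g2).
Local Notation V := (@in_C0H R d b (- r) 0).
Local Notation SV := (@holder_borel R d b (- r) 0).
Local Notation kappa := (kappa R beta g2).
Local Notation kap := (kap R d).
Implicit Types (eta : R -> vec R d) (w : OmegaM R beta).

Let eps (m : nat) : R := m.+1%:R^-1.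

Lemma eps_gt0 m : 0 < eps m. Proof. by rewrite /eps invr_gt0. Qed.

Lemma r_le0 : - r <= 0. Proof. by have := r0 => ?; lra. Qed.

Lemma V0 : V (fun _ => 0).
Proof.
split; first by exists 0 => s t _ _; rewrite subrr mul0r; apply: le_trans (enorm_le _ _ _ 0 _ _) _ => //;
  rewrite ?mulr0 // => i; rewrite mxE normr0.
move=> e e0; exists 1; split => // s t _ _ _; rewrite subrr.
apply: le_trans (enorm_le _ _ _ 0 _ _) _ => //; last by rewrite mulr0 mulr_ge0 ?powR_ge0 // ltW.
by move=> i; rewrite mxE normr0.
Qed.

Lemma V_sub eta eta' : V eta -> V eta' -> V (fun t => eta t - eta' t).
Proof.
have rr := r_le0.
move=> H H'; have [K K0 HK] := in_C0H_bd _ _ _ _ _ b0 rr _ H.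
have [K' K'0 HK'] := in_C0H_bd _ _ _ _ _ b0 rr _ H'.
have L1 : lil R d b (- r) 0 eta by apply: in_C0H_lil.
have L2 : lil R d b (- r) 0 eta' by apply: in_C0H_lil.
apply: (bd_in_C0H _ _ _ _ _ (K + K')); [exact: addr_ge0|exact: bdB|].
move=> e e0; have [d1 d10 H1] := L1 (e / 2) ltac:(lra); have [d2 d20 H2] := L2 (e / 2) ltac:(lra).
exists (Num.min d1 d2); first by rewrite lt_min d10.
move=> s t i s1 st t1; rewrite lt_min => /andP[ts1 ts2].
rewrite !mxE (_ : _ - _ = (eta t ord0 i - eta s ord0 i) - (eta' t ord0 i - eta' s ord0 i)); last by ring.
apply: le_trans (ler_normB _ _) _.
rewrite (_ : e * _ = e / 2 * (t - s) `^ b + e / 2 * (t - s) `^ b); last by field.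
by apply: lerD; [exact: H1|exact: H2].
Qed.

(** The centre is a path near the polygon, continuous by construction, at the price of doubling the
    radius. If no path is near, any centre will do. *)
Lemma path_center (p : (nat * seq rat) * nat) : exists c : R -> R, continuous c /\
  forall w, hold R g1 (eps p.2 / 2) 0 p.2.+1%:R (fun t => kappa w t - pgon R p.1.1 p.1.2 t) ->
    hold R g1 (eps p.2) 0 p.2.+1%:R (fun t => kappa w t - c t).
Proof.
case: p => -[n q] m /=.
have [[w0 H0]|nex] := pselect (exists w0, hold R g1 (eps m / 2) 0 m.+1%:R (fun t => kappa w0 t - pgon R n q t));
  last first.
  by exists (fun _ => 0); split; [move=> x; exact: cvg_cst | move=> w Hw; case: nex; exists w].
exists (kappa w0); split; first exact: kappa_cont.
move=> w Hw; have := holdB _ _ _ _ _ _ _ _ Hw H0.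
have -> : eps m / 2 + eps m / 2 = eps m by field; rewrite /eps ?pnatr_eq0 // invr_eq0 pnatr_eq0.
apply: hold_eq => t _; ring.
Qed.

Definition polyrow (k : {ffun 'I_d -> nat * seq rat}) : R -> vec R d :=
  fun t => \row_i pgon R (k i).1 (k i).2 (r + t).

(** A generating ball must be centred in the space, so a state near the polygon replaces it. In 8 *
    kap, a factor 2 is for the doubled radius, 2 * kap for [holnorm_le] and a last 2 for
    strictness. *)
Lemma state_center (p : {ffun 'I_d -> nat * seq rat} * nat) : exists c : R -> vec R d, V c /\
  forall eta, V eta -> bd R d b (eps p.2 / (8 * kap)) (- r) 0 (fun t => eta t - polyrow p.1 t) ->
    holnorm R b (- r) 0 (eta \- c) < eps p.2.
Proof.
case: p => k m /=; have k0 := kap_gt0 R d; have rr := r_le0; have e0 := eps_gt0 m.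
set e := eps m / (8 * kap).
have ep : 0 < e by rewrite divr_gt0 // mulr_gt0.
have [[c [Vc Hc]]|nex] := pselect (exists c, V c /\ bd R d b e (- r) 0 (fun t => c t - polyrow k t));
  last first.
  exists (fun _ => 0); split; first exact: V0.
  by move=> eta Ve He; case: nex; exists eta.
exists c; split => // eta Ve He.
have H : bd R d b (e + e) (- r) 0 (eta \- c).
  have := bdB _ _ _ _ _ _ _ _ _ He Hc.
  by apply: bd_eq => t _ /=; rewrite opprB addrA subrK.
apply: le_lt_trans (holnorm_le _ _ _ _ _ rr _ _ _ H) _; first by rewrite addr_ge0 // ltW.
rewrite (_ : 2 * (kap * (e + e)) = eps m / 2); first lra.
by rewrite /e; field; rewrite gt_eqF.
Qed.

Lemma polyrow_dense eta (e : R) : V eta -> 0 < e ->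
  exists k, bd R d b e (- r) 0 (fun t => eta t - polyrow k t).
Proof.
move=> Ve e0; have rr := r_le0.
have L1 : lil R d b (- r) 0 eta by apply: in_C0H_lil.
have E (i : 'I_d) : exists p : nat * seq rat,
    hold R b e 0 r (fun x => eta (x - r) ord0 i - pgon R p.1 p.2 x) /\
    forall x, 0 <= x <= r -> `|eta (x - r) ord0 i - pgon R p.1 p.2 x| <= e.
  have [||n [q H]] := pgon_dense R b r e (fun x => eta (x - r) ord0 i) _ (ltW r0) _ e0.
  - by rewrite b0.
  - move=> e' e'0; have [del d0 Hd] := L1 e' e'0; exists del => // s t s0 st tr ts.
    rewrite (_ : t - s = (t - r) - (s - r)); last by ring.
    by apply: Hd; lra.
  by exists (n, q).
have [f Hf] := choice E.
exists [ffun i => f i] => i; have [h1 h2] := Hf i; split.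
  move=> t tr; rewrite !mxE ffunE.
  have := h2 (r + t) ltac:(lra).
  by rewrite (_ : r + t - r = t) //; ring.
have := hold_shift R b e 0 r r _ h1; rewrite sub0r subrr.
apply: hold_eq => t _; rewrite !mxE ffunE.
by rewrite (_ : r + t - r = t) //; ring.
Qed.

(* The state space is separable but uniform (Hoelder) neighbourhoods of a path are not open
   for the compact-open topology: Q is written as a countable union of boxes centred near
   rational polygons, whose path component is measurable because it involves rational times only. *)
Lemma open_prod3 (Q : set ((R * OmegaM R beta) * (R -> vec R d))) :
  (forall z, Q z -> 0 <= z.1.1 /\ V z.2) ->
  (forall t w eta, Q ((t, w), eta) -> exists2 del, 0 < del & forall t' w' eta',
     0 <= t' -> V eta' -> `|t - t'| < del -> hold R g1 del 0 (t + 1) (fun s => kappa w s - kappa w' s) ->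
     bd R d b del (- r) 0 (fun s => eta s - eta' s) -> Q ((t', w'), eta')) ->
  prod3_sigma R beta d SV Q.
Proof.
move=> QD Qo; have rr := r_le0; have k0 := kap_gt0 R d.
have [cw Hcw] := choice path_center.
have [ce Hce] := choice state_center.
pose Box (i : (nat * seq rat) * {ffun 'I_d -> nat * seq rat} * rat * nat) :
    set ((R * OmegaM R beta) * (R -> vec R d)) :=
  let: (j, k, q, m) := i in
  ((`[0, +oo[ `&` ball (ratr q : R) (eps m)) `*` path_ball R beta g1 g2 (cw (j, m)) m) `*`
  [set g | V g /\ holnorm R b (- r) 0 (g \- ce (k, m)) < eps m].
have mBox i : prod3_sigma R beta d SV (Box i).
  case: i => -[[j k] q] m; apply: sub_gen_smallest; rewrite /Box.
  exists (`[0, +oo[ `&` ball (ratr q : R) (eps m)), (path_ball R beta g1 g2 (cw (j, m)) m),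
    [set g | V g /\ holnorm R b (- r) 0 (g \- ce (k, m)) < eps m]; split; [|split; [|split]] => //.
  - by apply: measurableI; [exact: measurable_itv | exact: measurable_ball].
  - exact: path_ball_meas.
  - apply: sub_gen_smallest; exists (ce (k, m)), (eps m); split; last by split; first exact: eps_gt0.
    by have [] := Hce (k, m).
have -> : Q = [set z | exists i, [set z | Box i `<=` Q /\ Box i z] z].
  apply/seteqP; split => [z Qz|z [i [BQ Bz]]]; last exact: BQ.
  case: z Qz => -[t w] eta Qz.
  have [/= t0 Ve] := QD _ Qz.
  have [del d0 Hd] := Qo _ _ _ Qz.
  (* m is large enough for 2 * eps m <= del and for the horizon m.+1 to reach t + 1. *)
  pose m := (Num.truncn (2 / del) + Num.truncn t).+1.
  have m1 : 2 * eps m <= del.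
    rewrite /eps ler_pdivrMr // mulrC -ler_pdivrMr //; apply: ltW.
    apply: lt_le_trans (truncnS_gt (2 / del)) _.
    by rewrite ler_nat /m ltnS ltnW // ltnS leq_addr.
  have m3 : eps m + eps m <= del by move: m1; rewrite mulr_natl mulr2n.
  have m2 : t + 1 <= m.+1%:R.
    rewrite -natr1 lerD2r; apply: ltW; apply: lt_le_trans (truncnS_gt t) _.
    by rewrite ler_nat /m ltnS leq_addl.
  have e0 := eps_gt0 m.
  have [q hq] : exists q : rat, ratr q \in `](t - eps m), (t + eps m)[.
    have h : t - eps m < t + eps m by lra.
    by have [q hq] := rat_in_itvoo h; exists q.
  have [n [qs [hqs _]]] := pgon_dense R g1 m.+1%:R (eps m / 2) (kappa w)
    ltac:(by rewrite g10) (ler0n _ _) (kappa_slil R beta g1 g2 g10 g12 w m.+1%:R) ltac:(lra).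
  have [k hk] := polyrow_dense eta (eps m / (8 * kap)) Ve ltac:(by rewrite divr_gt0 // mulr_gt0).
  have [ccw Hw] := Hcw ((n, qs), m); have [Vce He] := Hce (k, m).
  have hw := Hw w hqs; have he := He eta Ve hk.
  exists ((n, qs), k, q, m); split; last first.
    split; last by split.
    split; last exact: hold_path_ball.
    split; first by rewrite /= in_itv /= t0.
    rewrite /ball /=; rewrite in_itv /= in hq.
    by move/andP: hq => [hq1 hq2]; rewrite ltr_norml; apply/andP; lra.
  move=> [[t' w'] eta'] [[[/= t'0 t'q] w'b] [Ve' he']].
  rewrite in_itv /= andbT in t'0.
  apply: Hd => //.
  - rewrite /ball /= in t'q; rewrite in_itv /= in hq.
    move: t'q => /ltr_normlP[q1 q2]; move/andP: hq => [q3 q4].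
    by rewrite ltr_norml; apply/andP; split; clear -q1 q2 q3 q4 m1 e0; lra.
  - have hw' := path_ball_hold R beta g1 g2 g10 _ _ _ ccw w'b.
    have H := hold_sub _ _ _ _ _ 0 (t + 1) _ (lexx _) m2 (holdB _ _ _ _ _ _ _ _ hw hw').
    have := hold_le _ _ _ _ _ _ _ m3 H.
    by apply: hold_eq => s _; ring.
  have B1 := holnorm_bd _ _ _ _ _ b0 rr _ (V_sub _ _ Ve Vce).
  have B2 := holnorm_bd _ _ _ _ _ b0 rr _ (V_sub _ _ Ve' Vce).
  have := bdB _ _ _ _ _ _ _ _ _ B1 B2.
  have E s : - r <= s <= 0 -> eta s - ce (k, m) s - (eta' s - ce (k, m) s) = eta s - eta' s.
    by move=> _; rewrite opprB addrA subrK.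
  move=> /(bd_eq _ _ _ _ _ _ _ _ E); apply: bd_le.
  have := ltW he; have := ltW he'; rewrite /= => a1 a2.
  exact: le_trans (lerD a2 a1) m3.
apply: sigma_bigcup_count => i.
have [BQ|nBQ] := pselect (Box i `<=` Q).
  have -> : [set z | Box i `<=` Q /\ Box i z] = Box i by apply/seteqP; split => z // [].
  exact: mBox.
have -> : [set z | Box i `<=` Q /\ Box i z] = set0 by apply/seteqP; split => z // [].
exact: sigma_set0.
Qed.

End OpenMeasurable.

Lemma sigma_setD (T : Type) (G : set (set T)) (A B : set T) :
  <<s G>> A -> <<s G>> B -> <<s G>> (A `\` B).
Proof.
have [_ sC _] := smallest_sigma_algebra setT G.
move=> /sC GA GB.
have -> : A `\` B = setT `\` [set x | exists i : bool, (if i then setT `\` A else B) x].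
  apply/seteqP; split => [x [Ax nBx]|x [_ H]].
    by split => // -[[|]] /=; [case|].
  split; first by apply: contrapT => nA; apply: H; exists true.
  by move=> Bx; apply: H; exists false.
by apply: (sC); apply: sigma_bigcup_count => -[|].
Qed.

(** * The random dynamical system *)

Section Flow.
Variables (R : realType) (d : nat) (r b beta g1 g2 L : R) (F G : (R -> vec R d) -> vec R d).
Hypotheses (r0 : 0 < r) (b0 : 0 < b) (bg : b < g1) (g12 : g1 < g2) (g11 : g1 < 1) (bg1 : 1 < b + g1).
Hypotheses (L0 : 0 <= L) (HF : lip_growth R d r b L F) (HG : lip_growth R d r b L G).
Hypothesis HG2 : second_diff R d r b L G.
Local Notation V := (@in_C0H R d b (- r) 0).
Local Notation kappa := (kappa R beta g2).
Local Notation sol := (sol R d r b F G).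
Local Notation std f := (f R d r b g1 L F G r0 b0 bg g11 bg1 L0 HF HG).

(** Solutions are chosen without regard to measurability: uniqueness makes the choice canonical from
    - r on, and continuity supplies measurability. *)
Lemma flow_exists : exists U : (R -> R) -> (R -> vec R d) -> R -> vec R d,
  forall w eta, good R g1 w -> reg R d r b eta -> forall T, 0 <= T -> sol T w eta (U w eta).
Proof.
have H (z : (R -> R) * (R -> vec R d)) : exists X : R -> vec R d,
    good R g1 z.1 -> reg R d r b z.2 -> forall T, 0 <= T -> sol T z.1 z.2 X.
  have [gz|ngz] := pselect (good R g1 z.1); last by exists (fun _ => 0).
  have [rz|nrz] := pselect (reg R d r b z.2); last by exists (fun _ => 0).
  by have [X HX] := std sol_global HG2 z.1 z.2 gz rz; exists X.
have [u Hu] := choice H.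
by exists (fun w eta => u (w, eta)) => w eta; exact: (Hu (w, eta)).
Qed.

Variable U : (R -> R) -> (R -> vec R d) -> R -> vec R d.
Hypothesis HU : forall w eta, good R g1 w -> reg R d r b eta -> forall T, 0 <= T -> sol T w eta (U w eta).

Definition flow (t : R) (w : OmegaM R beta) (eta : R -> vec R d) := seg R (U (kappa w) eta) t.

Lemma g1_gt0 : 0 < g1. Proof. exact: lt_trans bg. Qed.

Lemma b_lt1 : b < 1. Proof. exact: lt_trans g11. Qed.

Lemma Nr_le0 : - r <= 0. Proof. by rewrite oppr_le0 ltW. Qed.

Lemma V_reg eta : V eta -> reg R d r b eta.
Proof. by move=> /(in_C0H_bd _ _ _ _ _ b0 Nr_le0) [K _ HK]; exists K. Qed.

Lemma flow_sol w eta T : V eta -> 0 <= T -> sol T (kappa w) eta (U (kappa w) eta).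
Proof. by move=> Ve; apply: HU; [exact: kappa_good g1_gt0 g12 _|exact: V_reg]. Qed.

Lemma sol_C0H w eta T : V eta -> 0 <= T -> in_C0H R b (- r) T (U (kappa w) eta).
Proof.
move=> Ve T0; have HX := flow_sol w eta T Ve T0.
have [K K0 HK] := sol_bd R d r b F G T _ _ _ T0 HX.
have [W W0 HW] := kappa_good R beta g1 g2 g1_gt0 g12 w T.
apply: (bd_in_C0H _ _ _ _ _ K) => //.
by apply: (std sol_lil W T _ _ _ W0 T0 HW) HX; exact: in_C0H_lil Nr_le0 _ Ve.
Qed.

Lemma flow_C0H t w eta : 0 <= t -> V eta -> V (flow t w eta).
Proof.
move=> t0 Ve; have VU := sol_C0H w eta t Ve t0.
have rt : - r <= t by apply: le_trans t0; exact: Nr_le0.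
have [K K0 HK] := in_C0H_bd _ _ _ _ _ b0 rt _ VU.
have L1 := in_C0H_lil _ _ _ _ _ rt _ VU.
have tr : - r <= t - r by rewrite lerDr.
apply: (bd_in_C0H _ _ _ _ _ K) => //.
  have := bd_seg R d b K _ _ t _ (bd_sub _ _ _ _ _ _ _ _ _ tr (lexx t) HK).
  by rewrite subrr addrAC subrr add0r.
have := lil_seg R d b _ _ t _ (lil_sub _ _ _ _ _ _ _ _ tr (lexx t) L1).
by rewrite subrr addrAC subrr add0r.
Qed.

Lemma flow0 w eta s : V eta -> - r <= s <= 0 -> flow 0 w eta s = eta s.
Proof.
move=> Ve sr; rewrite /flow /seg add0r.
exact: (sol_init R d r b g1 L F G r0 b0 bg g11 bg1 L0 0 _ _ _ _ (flow_sol w eta 0 Ve (lexx 0)) (lexx 0) sr).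
Qed.

(** Both sides solve the equation of the shifted path from the segment at time s; [kappa_theta]
    makes this true for irregular paths as well. *)
Lemma flowD t s w eta u : 0 <= t -> 0 <= s -> V eta -> - r <= u <= 0 ->
  flow (t + s) w eta u = flow t (theta R beta s w) (flow s w eta) u.
Proof.
move=> t0 s0 Ve ur; have ts0 : 0 <= t + s by rewrite addr_ge0.
have [W W0 HW] := kappa_good R beta g1 g2 g1_gt0 g12 w (t + s).
have sts : 0 <= s <= t + s by rewrite s0 lerDr.
have H1 := std sol_shift W (t + s) (kappa w) eta _ s HW W0 sts (flow_sol w eta _ Ve ts0).
rewrite addrK in H1.
have kth := kappa_theta R beta g1 g2 g1_gt0 g12 s w.
have H2 := flow_sol (theta R beta s w) (flow s w eta) t (flow_C0H s w eta s0 Ve) t0.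
rewrite kth in H2.
have [W' W'0 HW'] := kappa_good R beta g1 g2 g1_gt0 g12 (theta R beta s w) t.
rewrite kth in HW'.
have tu : - r <= t + u <= t.
  by case/andP: ur => u1 u2; rewrite gerDl u2 andbT; apply: le_trans u1 _; rewrite lerDr.
have := std sol_uniq HG2 W' t _ _ _ _ _ W'0 t0 HW' (fun _ _ => erefl) H1 H2 (t + u) tu.
by rewrite /flow /seg kth addrA [s + t]addrC.
Qed.

Lemma flow_continuous t w eta e : 0 <= t -> V eta -> 0 < e -> exists2 del, 0 < del &
  forall t' w' eta', 0 <= t' -> V eta' -> `|t - t'| < del ->
    hold R g1 del 0 (t + 1) (fun s => kappa w s - kappa w' s) ->
    bd R d b del (- r) 0 (fun s => eta s - eta' s) ->
    holnorm R b (- r) 0 (flow t' w' eta' \- flow t w eta) < e.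
Proof.
move=> t0 Ve e0; have k0 := kap_gt0 R d.
have ek : 0 < e / (4 * kap R d) by rewrite divr_gt0 // mulr_gt0.
have [del d0 H] := std flow_cont HG2 (kappa w) eta (U (kappa w) eta) t
  (kappa_good R beta g1 g2 g1_gt0 g12 w) (V_reg _ Ve) (in_C0H_lil _ _ _ _ _ Nr_le0 _ Ve)
  (fun T => flow_sol w eta T Ve) t0 _ ek.
exists del => // t' w' eta' t'0 Ve' tt hw he.
have := H (kappa w') eta' (U (kappa w') eta') t' (fun T => flow_sol w' eta' T Ve') t'0 tt hw he.
move=> /bd_sym /(holnorm_le _ _ _ _ _ Nr_le0 _ _ (ltW ek)) /le_lt_trans; apply.
rewrite (_ : 2 * _ = e / 2); first by lra.
by field; rewrite gt_eqF.
Qed.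

Lemma flow_cont_state t w eta e : 0 <= t -> V eta -> 0 < e -> exists del, 0 < del /\
  forall eta', V eta' -> holnorm R b (- r) 0 (eta' \- eta) < del ->
    holnorm R b (- r) 0 (flow t w eta' \- flow t w eta) < e.
Proof.
move=> t0 Ve e0; have [del d0 H] := flow_continuous t w eta e t0 Ve e0.
exists del; split => // eta' Ve' he; apply: H => //.
- by rewrite subrr normr0.
- by move=> x y _ xy _; rewrite !subrr normr0 mulr_ge0 ?powR_ge0 // ltW.
- apply: bd_sym; apply: bd_le (ltW he) _.
  exact: (holnorm_bd _ _ _ _ _ b0 Nr_le0 _ (V_sub _ _ _ _ r0 b0 _ _ Ve' Ve)).
Qed.

Lemma flow_measurable (A : set (R -> vec R d)) : holder_borel R b (- r) 0 A ->
  prod3_sigma R beta d (holder_borel R b (- r) 0)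
    ([set z | 0 <= z.1.1 /\ V z.2] `&` [set z | A (flow z.1.1 z.1.2 z.2)]).
Proof.
pose D : set ((R * OmegaM R beta) * (R -> vec R d)) := [set z | 0 <= z.1.1 /\ V z.2].
pose pre (A : set (R -> vec R d)) : set ((R * OmegaM R beta) * (R -> vec R d)) :=
  [set z | A (flow z.1.1 z.1.2 z.2)].
rewrite -/D -/(pre A) => HA.
have om := open_prod3 R d r b beta g1 g2 r0 b0 b_lt1 g1_gt0 g11 g12.
(* The domain is itself open in the sense of [open_prod3]. *)
have mD : prod3_sigma R beta d (holder_borel R b (- r) 0) D.
  by apply: om => [//|t w eta _]; exists 1.
(* Sets whose preimage in D is measurable form a sigma-algebra, so generating balls suffice. *)
suff : holder_borel R b (- r) 0 `<=`
    [set A | prod3_sigma R beta d (holder_borel R b (- r) 0) (D `&` pre A)] by apply.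
apply: smallest_sub.
  split => [|B mB|B mB] /=.
  - have -> : D `&` pre set0 = set0 by apply/seteqP; split => z // [].
    exact: sigma_set0.
  - have -> : D `&` pre (setT `\` B) = D `\` (D `&` pre B).
      apply/seteqP; split => [z [Dz [_ nB]]|z [Dz nB]]; first by split => // -[_ /nB].
      by split => //; split => // Bz; apply: nB.
    exact: sigma_setD.
  have -> : D `&` pre (\bigcup_n B n) = [set z | exists n : nat, (D `&` pre (B n)) z].
    apply/seteqP; split => [z [Dz [n _ Bn]]|z [n [Dz Bn]]]; first by exists n.
    by split => //; exists n.
  exact: sigma_bigcup_count.
move=> _ [f [e [Vf [e0 ->]]]] /=; apply: om => [z []//|t w eta [[/= t0 Ve] [_ he]]].
set h := holnorm R b (- r) 0 (flow t w eta \- f) in he.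
(* The margin e - h keeps nearby images inside the ball. *)
have [del d0 H] := flow_continuous t w eta (e - h) t0 Ve ltac:(by rewrite subr_gt0).
exists del; first exact: d0.
move=> t' w' eta' t'0 Ve' tt hw hb; split; first by split.
split; first exact: flow_C0H.
have hh := H _ _ _ t'0 Ve' tt hw hb.
have V1 := flow_C0H t w eta t0 Ve; have V2 := flow_C0H t' w' eta' t'0 Ve'.
have := holnorm_triangle _ _ b _ _ _ _ b0 Nr_le0 (V_sub _ _ _ _ r0 b0 _ _ V2 V1)
  (V_sub _ _ _ _ r0 b0 _ _ V1 Vf).
rewrite (_ : (fun s => _ + _) = (flow t' w' eta' \- f)).
  by move=> /le_lt_trans; apply; rewrite -(subrK h e) ltrD2r.
by apply/funext => s /=; rewrite addrA subrK.
Qed.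

Lemma flow_solution w eta T : kappa w = oval w -> V eta -> 0 <= T ->
  is_solution R r T F G (oval w) eta (U (kappa w) eta).
Proof.
move=> E Ve T0; have [W W0 HW] := kappa_good R beta g1 g2 g1_gt0 g12 w T.
by rewrite -{1}E; apply: (std sol_is_solution W T) => //; exact: flow_sol.
Qed.

Lemma solution_unique w eta T Y t : kappa w = oval w -> V eta -> 0 <= T ->
  in_C0H R b (- r) T Y -> is_solution R r T F G (oval w) eta Y ->
  - r <= t <= T -> Y t = U (kappa w) eta t.
Proof.
move=> E Ve T0 VY HY tr; have [W W0 HW] := kappa_good R beta g1 g2 g1_gt0 g12 w T.
have rT : - r <= T by apply: le_trans T0; exact: Nr_le0.
have [K K0 HK] := in_C0H_bd _ _ _ _ _ b0 rT _ VY.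
rewrite -E in HY.
have sY := is_solution_sol R d r b g1 L F G b0 bg bg1 L0 HF HG K W T _ _ _ K0 W0 T0 HK HW HY.
exact: (std sol_uniq HG2 W T _ _ _ _ _ W0 T0 HW (fun _ _ => erefl) sY (flow_sol w eta T Ve T0) t tr).
Qed.

End Flow.

Theorem theorem1 (R : realType) (r : R) (d : nat) (H beta : R)
    (P : probability (OmegaM R beta) R)
    (F G : (R -> vec R d) -> vec R d) (alpha T : R) :
  0 < r -> 2^-1 < H < 1 ->
  0 < beta < H -> 1 - H < beta ->
  is_fbm_law R beta H P ->
  (* (i) *)
  (exists L1 L2 : R, 0 < L1 /\ 0 < L2 /\
     forall xi eta, in_Cr R r xi -> in_Cr R r eta ->
       enorm R (F xi - F eta) <= L1 * supn R r (xi \- eta) /\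
       enorm R (F xi) <= L2 * (1 + supn R r xi)) ->
  (* (ii) *)
  (exists (DG : (R -> vec R d) -> (R -> vec R d) -> vec R d) (L3 L4 : R),
     0 < L3 /\ 0 < L4 /\
     is_frechet_deriv R r G DG /\
     (forall xi, in_Cr R r xi -> forall e : R, 0 < e -> exists del : R, 0 < del /\
        forall eta, in_Cr R r eta -> supn R r (eta \- xi) < del ->
          opnorm R r (fun h => DG eta h - DG xi h) < e) /\
     (forall xi eta, in_Cr R r xi -> in_Cr R r eta ->
        opnorm R r (DG xi) <= L3 /\
        opnorm R r (fun h => DG xi h - DG eta h) <= L4 * supn R r (xi \- eta))) ->
  1 - H < alpha < 2^-1 -> 0 < T ->
  (* existence and uniqueness of the solution *)
  (forall eta : R -> vec R d, in_C0H R (1 - alpha) (- r) 0 eta ->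
     {ae P, forall w : OmegaM R beta,
       exists X : R -> vec R d,
         in_C0H R (1 - alpha) (- r) T X /\ is_solution R r T F G (oval w) eta X /\
         forall Y : R -> vec R d,
           in_C0H R (1 - alpha) (- r) T Y -> is_solution R r T F G (oval w) eta Y ->
           forall t, - r <= t <= T -> Y t = X t}) /\
  (* the solution generates a continuous random dynamical system on
     V = C^{0,1-alpha}([-r,0], R^d) *)
  (exists phi : R -> OmegaM R beta -> (R -> vec R d) -> (R -> vec R d),
     (* measurability w.r.t. B(R_+) (x) F (x) B(V) *)
     (forall A, holder_borel R (1 - alpha) (- r) 0 A ->
        prod3_sigma R beta d (holder_borel R (1 - alpha) (- r) 0)
          ([set z | 0 <= z.1.1 /\ in_C0H R (1 - alpha) (- r) 0 z.2] `&`
           [set z | A (phi z.1.1 z.1.2 z.2)])) /\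
     (* phi(t, w) maps V into V *)
     (forall t w eta, 0 <= t -> in_C0H R (1 - alpha) (- r) 0 eta ->
        in_C0H R (1 - alpha) (- r) 0 (phi t w eta)) /\
     (* phi(0, w) = id *)
     (forall w eta, in_C0H R (1 - alpha) (- r) 0 eta ->
        forall th, - r <= th <= 0 -> phi 0 w eta th = eta th) /\
     (* cocycle property *)
     (forall t s w eta, 0 <= t -> 0 <= s -> in_C0H R (1 - alpha) (- r) 0 eta ->
        forall th, - r <= th <= 0 ->
          phi (t + s) w eta th = phi t (theta R beta s w) (phi s w eta) th) /\
     (* continuity in the state variable *)
     (forall t w eta, 0 <= t -> in_C0H R (1 - alpha) (- r) 0 eta ->
        forall e : R, 0 < e -> exists del : R, 0 < del /\
          forall eta', in_C0H R (1 - alpha) (- r) 0 eta' ->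
            holnorm R (1 - alpha) (- r) 0 (eta' \- eta) < del ->
            holnorm R (1 - alpha) (- r) 0 (phi t w eta' \- phi t w eta) < e) /\
     (* phi(t, w, eta) = X_t(., w, eta) *)
     (forall eta : R -> vec R d, in_C0H R (1 - alpha) (- r) 0 eta ->
        {ae P, forall w : OmegaM R beta,
          forall (T' : R) (X : R -> vec R d), 0 < T' ->
            in_C0H R (1 - alpha) (- r) T' X -> is_solution R r T' F G (oval w) eta X ->
            forall t th, 0 <= t <= T' -> - r <= th <= 0 ->
              phi t w eta th = seg R X t th})).
Proof.
move=> r0 /andP[H12 H1] /andP[beta0 _] _ fbm [L1 [L2 [L10 [L20 HFL]]]]
  [DG [L3 [L4 [L30 [L40 [HD [_ HB]]]]]]] /andP[aH a12] T0.
set b := 1 - alpha; set V := in_C0H R b (- r) 0.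
(* Equidistant exponents between b = 1 - alpha and H; alpha < 1/2 puts b above 1/2, hence 1 < b +
   g1. *)
pose g1 := (2 * b + H) / 3; pose g2 := (b + 2 * H) / 3.
have [b0 bg g12 g2H] : [/\ 0 < b, b < g1, g1 < g2 & g2 < H].
  by rewrite /g1 /g2 /b; split; lra.
have [g11 bg1 g20 H0] : [/\ g1 < 1, 1 < b + g1, 0 < g2 & 0 < H].
  by rewrite /g1 /g2 /b in bg g12 g2H *; split; lra.
have k0 := kap_gt0 R d; have G0 := enorm_ge0 R d (G (fun _ => 0)).
pose LG := L3 * kap R d + L4 * kap R d * kap R d.
have LG0 : 0 <= LG by rewrite /LG addr_ge0 // !mulr_ge0 // ltW.
have LF0 : 0 <= (L1 + L2) * kap R d by rewrite mulr_ge0 ?addr_ge0 // ltW.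
(* One constant large enough for the drift, the diffusion and its second differences. *)
pose L := (L1 + L2) * kap R d + (LG + enorm R (G (fun _ => 0))).
have LGG : 0 <= LG + enorm R (G (fun _ => 0)) by rewrite addr_ge0.
have L0 : 0 <= L by rewrite addr_ge0.
have HF : lip_growth R d r b L F.
  by apply: (drift_lip_growth R d r b L1 L2 F r0 b0 L10 L20 HFL); rewrite lerDl.
have second := frechet_second_diff R d r b r0 b0 G DG L3 L4 L30 L40 HD HB.
have HG2 : second_diff R d r b L G.
  by apply: second; rewrite -/LG /L addrCA lerDl addr_ge0.
have HG : lip_growth R d r b L G.
  by apply: (second_diff_lip_growth R d r b r0 G LG L LG0 (second _ (lexx _))); rewrite lerDr.
have [U HU] := flow_exists R d r b g1 L F G r0 b0 bg g11 bg1 L0 HF HG HG2.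
have g10 : 0 < g1 by exact: lt_trans bg.
have [N0 [mN0 PN0 HN0]] := fbm_ae_holder R beta H P g2 fbm H0 g20 g2H beta0.
(* Almost every path is regular, and there [kappa] returns the path itself; every almost sure claim
   reduces to such paths. *)
have ae (Q : OmegaM R beta -> Prop) : (forall w, kappa R beta g2 w = oval w -> Q w) ->
    {ae P, forall w, Q w}.
  move=> HQ; exists N0; split => // w nQ; apply: contrapT => nN; apply: nQ; apply: HQ.
  by apply: kappa_regular; apply/(regular_pathsP R beta g1 g2 g10 g12) => N; exact: HN0.
split.
  move=> eta Ve; apply: ae => w E; exists (U (kappa R beta g2 w) eta).
  split; first exact: (sol_C0H R d r b beta g1 g2 L F G r0 b0 bg g12 g11 bg1 L0 HF HG U HU w eta T Ve (ltW T0)).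
  split; first exact: (flow_solution R d r b beta g1 g2 L F G r0 b0 bg g12 g11 bg1 L0 HF HG U HU w eta T E Ve (ltW T0)).
  move=> Y VY HY t.
  exact: (solution_unique R d r b beta g1 g2 L F G r0 b0 bg g12 g11 bg1 L0 HF HG HG2 U HU w eta T Y t E Ve (ltW T0) VY HY).
exists (flow R d beta g2 U); split; [|split; [|split; [|split; [|split]]]].
- exact: (flow_measurable R d r b beta g1 g2 L F G r0 b0 bg g12 g11 bg1 L0 HF HG HG2 U HU).
- exact: (flow_C0H R d r b beta g1 g2 L F G r0 b0 bg g12 g11 bg1 L0 HF HG U HU).
- move=> w eta Ve s; exact: (flow0 R d r b beta g1 g2 L F G r0 b0 bg g12 g11 bg1 L0 U HU).
- by move=> t s w eta t0 s0 Ve u; apply: (flowD R d r b beta g1 g2 L F G r0 b0 bg g12 g11 bg1 L0 HF HG HG2 U HU).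
- move=> t w eta t0 Ve e e0.
  exact: (flow_cont_state R d r b beta g1 g2 L F G r0 b0 bg g12 g11 bg1 L0 HF HG HG2 U HU t w eta e t0 Ve e0).
(* T' and X are quantified inside the almost sure statement: the null set [N0] depends on
   neither. *)
move=> eta Ve; apply: ae => w E T' X T'0 VX HX t u /andP[t0 tT] /andP[u0 u1].
apply: esym; apply: (solution_unique R d r b beta g1 g2 L F G r0 b0 bg g12 g11 bg1 L0 HF HG HG2 U HU w eta T' X
  (t + u) E Ve (ltW T'0) VX HX).
by rewrite (le_trans u0) ?lerDr // (le_trans _ tT) // gerDl.
Qed.
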